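(* With respect to the diamond product, $U/J$ is a free left $D^{-1}U(\mathfrak h)$-module on the set of monomials $$\{\bar x_{-2\alpha}^{\Diamond p}\Diamond\bar x_{-\alpha}^{\Diamond q}\Diamond\bar h^{\Diamond r}\Diamond\bar x_\alpha^{\Diamond s}\Diamond\bar x_{2\alpha}^{\Diamond t}\mid p,q,r,s,t\in\mathbb{Z}_{\ge0},\ q,s\le1\}.$$
   Context: Everything is over $\mathbb{C}$; $[\cdot,\cdot]$ is the supercommutator. The Lie superalgebra $\mathfrak{osp}(1|2)$ has even basis elements $x_{-2\alpha},h,x_{2\alpha}$ and odd basis elements $x_{-\alpha},x_\alpha$, with $[h,x_{k\alpha}]=-k\,x_{k\alpha}$ for $k\in\{\pm1,\pm2\}$, $[x_\alpha,x_\alpha]=-2x_{2\alpha}$, $[x_{-\alpha},x_{-\alpha}]=2x_{-2\alpha}$, $[x_\alpha,x_{-2\alpha}]=x_{-\alpha}$, $[x_{-\alpha},x_{2\alpha}]=x_\alpha$, $[x_\alpha,x_{-\alpha}]=h$, $[x_{-2\alpha},x_{2\alpha}]=h$, $[x_\alpha,x_{2\alpha}]=0=[x_{-\alpha},x_{-2\alpha}]$. Let $\mathfrak{G}=\mathfrak{osp}(1|2)\times\mathfrak{osp}(1|2)$. Put $X_{k\alpha}=(x_{k\alpha},x_{k\alpha})$, $H=(h,h)$, $\tilde x_{k\alpha}=(x_{k\alpha},-x_{k\alpha})$, $\tilde h=(h,-h)$. Let $\mathfrak h=\mathbb{C}H$, $\mathfrak g_\pm=\mathbb{C}X_{\pm\alpha}\oplus\mathbb{C}X_{\pm2\alpha}$.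 Let $D\subset U(\mathfrak h)=\mathbb{C}[H]$ be the multiplicative set generated by $\{H-n\mid n\in\mathbb{Z}\}$, $U=D^{-1}U(\mathfrak G)$ the localization, and $J=\mathfrak g_-U+U\mathfrak g_+$. Define rational functions by $\varphi_0(H)=1$, $\varphi_{2n-1}(H)=\frac{-1}{H-n}\varphi_{2n-2}(H)$, $\varphi_{2n}(H)=\frac1n\varphi_{2n-1}(H)$ for $n\ge1$. For $u\in U$ write $\bar u=u+J\in U/J$. The diamond product on $U/J$ is $$\bar u\Diamond\bar v=\sum_{n\ge0}u\,\varphi_n(H)X_{-\alpha}^nX_\alpha^n\,v+J$$ (all but finitely many terms lie in $J$); it is well defined and associative. Put $\bar x_{k\alpha}=\tilde x_{k\alpha}+J$, $\bar h=\tilde h+J$; $\bar u^{\Diamond p}$ denotes the $p$-th power with respect to $\Diamond$. The left $D^{-1}U(\mathfrak h)$-module structure is $f(H)\bar u=f(H)u+J=f(H)\Diamond\bar u$. The algebra $(U/J,\Diamond)$ is isomorphic to the diagonal reduction algebra $Z(\mathfrak G,\mathfrak g)$ of $\mathfrak{osp}(1|2)$, where $\mathfrak g=\{(x,x)\}$. *)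

(* Defs.v *)
From HB Require Import structures.
From mathcomp Require Import all_boot all_order all_algebra.
From mathcomp Require Import boolp classical_sets functions cardinality fsbigop.
From mathcomp Require Import reals complex.

Set Implicit Arguments.
Unset Strict Implicit.
Unset Printing Implicit Defensive.

Import GRing.Theory.

Local Open Scope ring_scope.
Local Open Scope quotient_scope.

(* An associative unital K-algebra, as a ring A with a ring morphism from K to
   the centre of A. MathComp's algType excludes the zero ring, which a
   localization may be. *)
HB.mixin Record isPzAlgebra (K : comNzRingType) A of GRing.PzRing A := {
  kcst : K -> A;
  kcst1 : kcst 1 = 1;
  kcstD : {morph kcst : a b / a + b};
  kcstM : {morph kcst : a b / a * b};
  kcstC : forall a x, kcst a * x = x * kcst a
}.

#[short(type="pzAlgType")]
HB.structure Definition PzAlgebra (K : comNzRingType) :=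
  {A of GRing.PzRing A & isPzAlgebra K A}.

Lemma kcst0 (K : comNzRingType) (A : pzAlgType K) : kcst 0 = 0 :> A.
Proof. by apply: (addIr (kcst 0)); rewrite -kcstD !add0r. Qed.

Lemma polyC_central (K : comNzRingType) (a : K) (p : {poly K}) :
  a%:P * p = p * a%:P.
Proof. exact: mulrC. Qed.

HB.instance Definition _ (K : comNzRingType) :=
  isPzAlgebra.Build K {poly K} (@polyC1 K) (@polyCD K) (@polyCM K)
    (@polyC_central K).

Inductive expr (K X : Type) :=
| ECst of K
| EGen of X
| EAdd of expr K X & expr K X
| EMul of expr K X & expr K X.
Arguments ECst {K X}.
Arguments EGen {K X}.

HB.instance Definition _ (K X : Type) := gen_eqMixin (expr K X).
HB.instance Definition _ (K X : Type) := gen_choiceMixin (expr K X).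

Section Presentation.
Variables (K : comNzRingType) (X : Type) (Rel : expr K X -> expr K X -> Prop).
Local Notation E := (expr K X).

(* The least congruence containing Rel whose quotient is an associative unital
   K-algebra. *)
Inductive pcong : E -> E -> Prop :=
| PRel e f : Rel e f -> pcong e f
| PRefl e : pcong e e
| PSym e f : pcong e f -> pcong f e
| PTrans f e g : pcong e f -> pcong f g -> pcong e g
| PAdd e e' f f' : pcong e e' -> pcong f f' -> pcong (EAdd e f) (EAdd e' f')
| PMul e e' f f' : pcong e e' -> pcong f f' -> pcong (EMul e f) (EMul e' f')
| PAddA e f g : pcong (EAdd e (EAdd f g)) (EAdd (EAdd e f) g)
| PAddC e f : pcong (EAdd e f) (EAdd f e)
| PAdd0 e : pcong (EAdd (ECst 0) e) e
| PMulA e f g : pcong (EMul e (EMul f g)) (EMul (EMul e f) g)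
| PMul0 e : pcong (EMul (ECst 0) e) (ECst 0)
| PMul1 e : pcong (EMul (ECst 1) e) e
| PMulDl e f g : pcong (EMul (EAdd e f) g) (EAdd (EMul e g) (EMul f g))
| PMulDr e f g : pcong (EMul e (EAdd f g)) (EAdd (EMul e f) (EMul e g))
| PCstD a b : pcong (ECst (a + b)) (EAdd (ECst a) (ECst b))
| PCstM a b : pcong (ECst (a * b)) (EMul (ECst a) (ECst b))
| PCstC a e : pcong (EMul (ECst a) e) (EMul e (ECst a)).

Definition pcongb (e f : E) : bool := `[< pcong e f >].

Lemma pcongb_equiv : equiv_class_of pcongb.
Proof.
split=> [e|e f|f e g].
- by apply/asboolP; exact: PRefl.
- by apply/asboolP/asboolP; exact: PSym.
- by move=> /asboolP ef /asboolP fg; apply/asboolP; exact: PTrans ef fg.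
Qed.

Canonical pcongb_equivRel := EquivRelPack pcongb_equiv.
Canonical pcongb_encModRel := defaultEncModRel pcongb.

Definition palg := {eq_quot pcongb}.

HB.instance Definition _ : EqQuotient E pcongb palg := EqQuotient.on palg.
HB.instance Definition _ := Choice.on palg.

Definition pcls (e : E) : palg := \pi_palg e.

Lemma pcls_eq e f : pcls e = pcls f <-> pcong e f.
Proof.
rewrite /pcls; split=> [/eqP|ef]; first by rewrite piE => /asboolP.
by apply/eqP; rewrite piE; apply/asboolP.
Qed.

Lemma pclsP (P : palg -> Prop) : (forall e, P (pcls e)) -> forall u, P u.
Proof. by move=> H u; rewrite -[u]reprK; exact: H. Qed.

Lemma pcls_repr e : pcong (repr (pcls e)) e.
Proof. by apply/pcls_eq; rewrite /pcls reprK. Qed.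

Definition pcst (a : K) : palg := pcls (ECst a).
Definition pgen (x : X) : palg := pcls (EGen x).
Definition padd (u v : palg) : palg := pcls (EAdd (repr u) (repr v)).
Definition pmul (u v : palg) : palg := pcls (EMul (repr u) (repr v)).
Definition popp (u : palg) : palg := pmul (pcst (-1)) u.

Lemma pcls_add e f : pcls (EAdd e f) = padd (pcls e) (pcls f).
Proof. by apply/pcls_eq/PSym/PAdd; exact: pcls_repr. Qed.

Lemma pcls_mul e f : pcls (EMul e f) = pmul (pcls e) (pcls f).
Proof. by apply/pcls_eq/PSym/PMul; exact: pcls_repr. Qed.

Lemma paddA : associative padd.
Proof.
do 3![elim/pclsP => ?]; rewrite -!pcls_add; apply/pcls_eq; exact: PAddA.
Qed.
Lemma paddC : commutative padd.
Proof.
do 2![elim/pclsP => ?]; rewrite -!pcls_add; apply/pcls_eq; exact: PAddC.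
Qed.
Lemma padd0 : left_id (pcst 0) padd.
Proof. by elim/pclsP => ?; rewrite -!pcls_add; apply/pcls_eq; exact: PAdd0. Qed.
Lemma pmulA : associative pmul.
Proof.
do 3![elim/pclsP => ?]; rewrite -!pcls_mul; apply/pcls_eq; exact: PMulA.
Qed.
Lemma pmul1 : left_id (pcst 1) pmul.
Proof. by elim/pclsP => ?; rewrite -!pcls_mul; apply/pcls_eq; exact: PMul1. Qed.
Lemma pcstC a u : pmul (pcst a) u = pmul u (pcst a).
Proof.
elim/pclsP: u => e; rewrite -!pcls_mul; apply/pcls_eq; exact: PCstC.
Qed.
Lemma pmulDl : left_distributive pmul padd.
Proof.
do 3![elim/pclsP => ?]; rewrite -!(pcls_add, pcls_mul).
by apply/pcls_eq; exact: PMulDl.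
Qed.
Lemma pmulDr : right_distributive pmul padd.
Proof.
do 3![elim/pclsP => ?]; rewrite -!(pcls_add, pcls_mul).
by apply/pcls_eq; exact: PMulDr.
Qed.
Lemma pcstD a b : pcst (a + b) = padd (pcst a) (pcst b).
Proof. by rewrite -pcls_add; apply/pcls_eq; exact: PCstD. Qed.
Lemma pcstM a b : pcst (a * b) = pmul (pcst a) (pcst b).
Proof. by rewrite -pcls_mul; apply/pcls_eq; exact: PCstM. Qed.
Lemma pmulr1 : right_id (pcst 1) pmul.
Proof. by move=> u; rewrite -pcstC pmul1. Qed.
Lemma pmul0 : left_zero (pcst 0) pmul.
Proof. by elim/pclsP => ?; rewrite -!pcls_mul; apply/pcls_eq; exact: PMul0. Qed.
Lemma paddN : left_inverse (pcst 0) popp padd.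
Proof. by move=> u; rewrite -{2}[u]pmul1 -pmulDl -pcstD addNr pmul0. Qed.

HB.instance Definition _ :=
  GRing.isZmodule.Build palg paddA paddC padd0 paddN.
HB.instance Definition _ :=
  GRing.Zmodule_isPzRing.Build palg pmulA pmul1 pmulr1 pmulDl pmulDr.

HB.instance Definition _ :=
  isPzAlgebra.Build K palg (erefl : pcst 1 = 1) pcstD pcstM pcstC.

Lemma pclsD e f : pcls (EAdd e f) = pcls e + pcls f.
Proof. exact: pcls_add. Qed.
Lemma pclsM e f : pcls (EMul e f) = pcls e * pcls f.
Proof. exact: pcls_mul. Qed.
Lemma pclsC a : pcls (ECst a) = kcst a.
Proof. by []. Qed.

Variables (B : pzAlgType K) (g : X -> B).

Fixpoint peval (e : E) : B :=
  match e with
  | ECst a => kcst a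
  | EGen x => g x
  | EAdd e f => peval e + peval f
  | EMul e f => peval e * peval f
  end.

Definition plift (u : palg) : B := peval (repr u).

Hypothesis gRel : forall e f, Rel e f -> peval e = peval f.

Lemma peval_cong e f : pcong e f -> peval e = peval f.
Proof.
elim=> {e f} //=.
- by move=> e f g' _ -> _ ->.
- by move=> e e' f f' _ -> _ ->.
- by move=> e e' f f' _ -> _ ->.
- by move=> *; rewrite addrA.
- by move=> *; rewrite addrC.
- by move=> *; rewrite kcst0 add0r.
- by move=> *; rewrite mulrA.
- by move=> *; rewrite kcst0 mul0r.
- by move=> *; rewrite kcst1 mul1r.
- by move=> *; rewrite mulrDl.
- by move=> *; rewrite mulrDr.
- by move=> *; rewrite kcstD.
- by move=> *; rewrite kcstM.
- by move=> *; rewrite kcstC.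
Qed.

Lemma plift_cls e : plift (pcls e) = peval e.
Proof. exact: peval_cong (pcls_repr e). Qed.
Lemma plift_gen x : plift (pgen x) = g x.
Proof. exact: plift_cls. Qed.
Lemma pliftD : {morph plift : u v / u + v}.
Proof. by do 2![elim/pclsP => ?]; rewrite -pclsD !plift_cls. Qed.
Lemma pliftM : {morph plift : u v / u * v}.
Proof. by do 2![elim/pclsP => ?]; rewrite -pclsM !plift_cls. Qed.
Lemma plift_cst a : plift (kcst a) = kcst a.
Proof. exact: plift_cls. Qed.
Lemma plift1 : plift 1 = 1.
Proof. by rewrite -(kcst1 (K := K)) plift_cst kcst1. Qed.

End Presentation.

Section Enveloping.
Variables (K : comNzRingType) (L : lmodType K).
Variables (homog : bool -> L -> Prop) (brk : L -> L -> L).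

Inductive env_rel : expr K L -> expr K L -> Prop :=
| EnvLin a u v :
    env_rel (EGen (a *: u + v)) (EAdd (EMul (ECst a) (EGen u)) (EGen v))
| EnvBrk (p q : bool) u v : homog p u -> homog q v ->
    env_rel (EMul (EGen u) (EGen v))
      (EAdd (EMul (ECst ((-1) ^+ (p && q))) (EMul (EGen v) (EGen u)))
            (EGen (brk u v))).

Definition envalg := palg env_rel.
HB.instance Definition _ := PzAlgebra.on envalg.

Definition env_in (u : L) : envalg := pgen env_rel u.

Lemma env_in_ZD a u v : env_in (a *: u + v) = kcst a * env_in u + env_in v.
Proof.
rewrite /env_in /pgen -[kcst a]pclsC -pclsM -pclsD.
exact/pcls_eq/PRel/EnvLin.
Qed.

Lemma env_in_brk (p q : bool) u v : homog p u -> homog q v ->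
  env_in u * env_in v =
  kcst ((-1) ^+ (p && q)) * (env_in v * env_in u) + env_in (brk u v).
Proof.
by move=> pu qv; have /pcls_eq := PRel (EnvBrk pu qv); rewrite pclsD !pclsM.
Qed.

End Enveloping.

Section Localization.
Variables (K : comNzRingType) (A : pzAlgType K) (S : A -> Prop).

Inductive loc_rel :
  expr K (A + {s : A | S s}) -> expr K (A + {s : A | S s}) -> Prop :=
| LocCst a : loc_rel (EGen (inl (kcst a))) (ECst a)
| LocAdd x y :
    loc_rel (EGen (inl (x + y))) (EAdd (EGen (inl x)) (EGen (inl y)))
| LocMul x y :
    loc_rel (EGen (inl (x * y))) (EMul (EGen (inl x)) (EGen (inl y)))
| LocInvl s : loc_rel (EMul (EGen (inr s)) (EGen (inl (sval s)))) (ECst 1)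
| LocInvr s : loc_rel (EMul (EGen (inl (sval s))) (EGen (inr s))) (ECst 1).

Definition loc := palg loc_rel.
HB.instance Definition _ := PzAlgebra.on loc.

Definition loc_in (x : A) : loc := pgen loc_rel (inl x).
Definition loc_inv (s : {s : A | S s}) : loc := pgen loc_rel (inr s).

Lemma loc_in_cst a : loc_in (kcst a) = kcst a.
Proof. exact/pcls_eq/PRel/LocCst. Qed.
Lemma loc_in1 : loc_in 1 = 1.
Proof. by rewrite -(kcst1 (K := K)) loc_in_cst kcst1. Qed.
Lemma loc_inD : {morph loc_in : x y / x + y}.
Proof.
move=> x y; rewrite /loc_in /pgen -pclsD; exact/pcls_eq/PRel/LocAdd.
Qed.
Lemma loc_inM : {morph loc_in : x y / x * y}.
Proof.
move=> x y; rewrite /loc_in /pgen -pclsM; exact/pcls_eq/PRel/LocMul.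
Qed.
Lemma loc_invl s : loc_inv s * loc_in (sval s) = 1.
Proof. rewrite -[LHS]pclsM; exact/pcls_eq/PRel/LocInvl. Qed.
Lemma loc_invr s : loc_in (sval s) * loc_inv s = 1.
Proof. rewrite -[LHS]pclsM; exact/pcls_eq/PRel/LocInvr. Qed.
Lemma loc_in0 : loc_in 0 = 0.
Proof. by rewrite -(kcst0 (K := K)) loc_in_cst kcst0. Qed.

End Localization.

Section Horner.
Variables (K : comNzRingType) (A : pzAlgType K) (x : A).

(* horner_alg would need a nonzero algebra. *)
Definition phorner (p : {poly K}) : A := \sum_(i < size p) kcst p`_i * x ^+ i.

Lemma phornerE n (p : {poly K}) : (size p <= n)%N ->
  phorner p = \sum_(i < n) kcst p`_i * x ^+ i.
Proof.
move=> sp; rewrite /phorner (big_ord_widen n (fun i => kcst p`_i * x ^+ i) sp).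
rewrite big_mkcond; apply: eq_bigr => i _; case: ltnP => // h.
by rewrite nth_default // kcst0 mul0r.
Qed.

Lemma phornerD : {morph phorner : p q / p + q}.
Proof.
move=> p q; set n := maxn (size p) (size q).
rewrite (@phornerE n p) ?leq_maxl // (@phornerE n q) ?leq_maxr //.
rewrite (@phornerE n) ?size_polyD // -big_split; apply: eq_bigr => i _.
by rewrite coefD kcstD mulrDl.
Qed.
Lemma phornerC a : phorner a%:P = kcst a.
Proof.
by rewrite (@phornerE 1) ?size_polyC_leq1 // big_ord1 expr0 coefC mulr1.
Qed.
Lemma phorner0 : phorner 0 = 0.
Proof. by rewrite phornerC kcst0. Qed.
Lemma phorner1 : phorner 1 = 1.
Proof. by rewrite phornerC kcst1. Qed.
Lemma phornerMX (p : {poly K}) : phorner (p * 'X) = phorner p * x.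
Proof.
rewrite (@phornerE (size p).+1); last first.
  by apply: leq_trans (size_polyMleq _ _) _; rewrite size_polyX addn2.
rewrite big_ord_recl coefMX /= kcst0 mul0r add0r mulr_suml.
by apply: eq_bigr => i _; rewrite coefMX /= -mulrA exprSr.
Qed.
Lemma phornerX : phorner 'X = x.
Proof. by rewrite -['X]mul1r phornerMX phorner1 mul1r. Qed.
Lemma phornerCM a (p : {poly K}) : phorner (a%:P * p) = kcst a * phorner p.
Proof.
rewrite (@phornerE (size p)); last first.
  by rewrite mul_polyC size_scale_leq.
rewrite mulr_sumr; apply: eq_bigr => i _.
by rewrite coefCM kcstM mulrA.
Qed.
Lemma phornerM : {morph phorner : p q / p * q}.
Proof.
move=> p; elim/poly_ind => [|q c IH]; first by rewrite !(mulr0, phorner0).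
rewrite mulrDr mulrA !phornerD !phornerMX IH mulrDr mulrA; congr (_ + _).
by rewrite mulrC phornerCM phornerC kcstC.
Qed.

End Horner.

(* b is a basis of M as a left A-module; \sum_(i \in setT) is the sum over the
   support, here finite. *)
Definition is_basis (A : pzRingType) (M : lmodType A) (I : choiceType)
    (b : I -> M) : Prop :=
  forall m : M, exists! c : I -> A,
    finite_set [set i | c i != 0]%classic /\
    m = \sum_(i \in [set: I]%classic) c i *: b i.

Section Osp.
Variable K : fieldType.

(* The coordinates are along x_{-2a}, x_{-a}, h, x_a, x_{2a}, in this order. *)
Definition osp := 'rV[K]_5.
HB.instance Definition _ := GRing.Lmodule.on osp.

Definition osp_basis (k : nat) : osp := delta_mx 0 (inord k).
Definition xm2 := osp_basis 0.
Definition xm1 := osp_basis 1.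
Definition xh := osp_basis 2.
Definition xp1 := osp_basis 3.
Definition xp2 := osp_basis 4.

(* The defining brackets, completed by super skew-symmetry. *)
Definition osp_table (i j : nat) : osp :=
  match i, j with
  | 2, 0 => 2%:R *: xm2 | 0, 2 => - (2%:R *: xm2)
  | 2, 1 => xm1         | 1, 2 => - xm1
  | 2, 3 => - xp1       | 3, 2 => xp1
  | 2, 4 => - (2%:R *: xp2) | 4, 2 => 2%:R *: xp2
  | 3, 3 => - (2%:R *: xp2)
  | 1, 1 => 2%:R *: xm2
  | 3, 0 => xm1         | 0, 3 => - xm1
  | 1, 4 => xp1         | 4, 1 => - xp1
  | 3, 1 => xh          | 1, 3 => xh
  | 0, 4 => xh          | 4, 0 => - xh
  | _, _ => 0
  end.

Definition osp_brk (u v : osp) : osp :=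
  \sum_(i < 5) \sum_(j < 5) (u 0 i * v 0 j) *: osp_table i j.

(* x_{-a} and x_a, the vectors of odd index, are the odd ones. *)
Definition osp_homog (p : bool) (u : osp) : Prop :=
  forall i : 'I_5, odd i != p -> u 0 i = 0.

Lemma osp_brk_basis (i j : nat) : (i < 5)%N -> (j < 5)%N ->
  osp_brk (osp_basis i) (osp_basis j) = osp_table i j.
Proof.
move=> i5 j5; rewrite /osp_brk (bigD1 (Ordinal i5)) //= [X in _ + X]big1 ?addr0.
  rewrite (bigD1 (Ordinal j5)) //= [X in _ + X]big1 ?addr0.
    rewrite !mxE !eqxx /= -!val_eqE /= !inordK // !eqxx.
    by rewrite mulr1 scale1r.
  move=> k; rewrite -val_eqE /= => kj; rewrite !mxE eqxx /=.
  by rewrite -[k == _]val_eqE /= inordK // (negPf kj) mulr0 scale0r.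
move=> k; rewrite -val_eqE /= => ki; apply: big1 => l _; rewrite !mxE eqxx /=.
by rewrite -[k == _]val_eqE /= inordK // (negPf ki) mul0r scale0r.
Qed.

Lemma osp_homog_basis (k : nat) : (k < 5)%N -> osp_homog (odd k) (osp_basis k).
Proof.
move=> k5 i ik; rewrite mxE eqxx /=; case: eqVneq => // ie.
by move: ik; rewrite ie inordK // eqxx.
Qed.

Definition gosp := (osp * osp)%type.
HB.instance Definition _ := GRing.Lmodule.on gosp.

Definition gosp_brk (u v : gosp) : gosp := (osp_brk u.1 v.1, osp_brk u.2 v.2).
Definition gosp_homog (p : bool) (u : gosp) : Prop :=
  osp_homog p u.1 /\ osp_homog p u.2.

Definition UG := envalg gosp_homog gosp_brk.
HB.instance Definition _ := PzAlgebra.on UG.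

Definition UG_in (u : gosp) : UG := env_in gosp_homog gosp_brk u.

(* U(h) = C[H] is {poly K}, with H = 'X; D is the multiplicative set generated
   by the H - n. *)
Definition D : {poly K} -> Prop := fun d =>
  exists s : seq int, d = \prod_(n <- s) ('X - n%:~R%:P).

Lemma D_subXn (n : int) : D ('X - n%:~R%:P).
Proof. by exists [:: n]; rewrite big_seq1. Qed.

Definition Uh_loc := loc D.
HB.instance Definition _ := PzAlgebra.on Uh_loc.

Definition Hinv (n : int) : Uh_loc := loc_inv (exist _ _ (D_subXn n)).

Definition polyH : {poly K} -> UG := phorner (UG_in (xh, xh)).

Definition D_UG : UG -> Prop := fun x => exists2 d, D d & x = polyH d.

Definition U := loc D_UG.
HB.instance Definition _ := PzAlgebra.on U.

Definition U_in (u : gosp) : U := loc_in D_UG (UG_in u).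

Definition X_ (x : osp) : U := U_in (x, x).
Definition tilde (x : osp) : U := U_in (x, - x).

Lemma U_in_ZD a (u v : gosp) : U_in (a *: u + v) = kcst a * U_in u + U_in v.
Proof. by rewrite /U_in /UG_in env_in_ZD loc_inD loc_inM loc_in_cst. Qed.

Lemma U_in_brk (p q : bool) (u v : gosp) : gosp_homog p u -> gosp_homog q v ->
  U_in u * U_in v =
  kcst ((-1) ^+ (p && q)) * (U_in v * U_in u) + U_in (gosp_brk u v).
Proof.
move=> pu qv; rewrite /U_in /UG_in -loc_inM (env_in_brk _ pu qv).
by rewrite loc_inD !loc_inM loc_in_cst.
Qed.

Lemma polyH_D (d : {poly K}) : D d -> D_UG (polyH d).
Proof. by move=> Dd; exists d. Qed.

Definition Uh_gen (x : {poly K} + {d : {poly K} | D d}) : U :=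
  match x with
  | inl p => loc_in D_UG (polyH p)
  | inr d => loc_inv (exist _ _ (polyH_D (svalP d)))
  end.

(* f |-> f(H), the morphism D^-1 U(h) -> U induced by U(h) -> U(G). *)
Definition atH (f : Uh_loc) : U := plift Uh_gen f.

Lemma Uh_gen_rel e f : loc_rel e f -> peval Uh_gen e = peval Uh_gen f.
Proof.
case=> /=.
- by move=> a; rewrite /kcst/= /polyH phornerC loc_in_cst.
- by move=> p q; rewrite /polyH phornerD loc_inD.
- by move=> p q; rewrite /polyH phornerM loc_inM.
- by move=> d; rewrite kcst1 (loc_invl (exist _ _ (polyH_D (svalP d)))).
- by move=> d; rewrite kcst1 (loc_invr (exist _ _ (polyH_D (svalP d)))).
Qed.

Lemma atHD : {morph atH : f g / f + g}. Proof. exact: pliftD Uh_gen_rel. Qed.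
Lemma atHM : {morph atH : f g / f * g}. Proof. exact: pliftM Uh_gen_rel. Qed.
Lemma atH1 : atH 1 = 1. Proof. exact: plift1 Uh_gen_rel. Qed.

(* J = g_- U + U g_+ ; g_- is spanned by X_{-a} and X_{-2a}, and g_+ by X_a and
   X_{2a}. *)
Definition J : {pred U} := fun x => `[< exists a b c d : U,
  x = X_ xm1 * a + X_ xm2 * b + (c * X_ xp1 + d * X_ xp2) >].

Lemma J_zmod_closed : zmod_closed J.
Proof.
split; first by apply/asboolP; exists 0, 0, 0, 0; rewrite !(mulr0, mul0r, addr0).
move=> x y /asboolP[a [b [c [d ->]]]] /asboolP[a' [b' [c' [d' ->]]]].
apply/asboolP; exists (a - a'), (b - b'), (c - c'), (d - d').
by rewrite !mulrBr !mulrBl !opprD !addrA [LHS](AC 8 (1*5*2*6*3*7*4*8))/=.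
Qed.

HB.instance Definition _ := GRing.isZmodClosed.Build U J J_zmod_closed.

Definition UJ := Quotient.quot J.
HB.instance Definition _ := GRing.Zmodule.on UJ.

Definition toUJ (u : U) : UJ := \pi_(Quotient.quot J) u.

Lemma X_h_comm (w : int) (x : osp) : osp_homog false x \/ osp_homog true x ->
  osp_brk xh x = w%:~R *: x ->
  X_ xh * X_ x = X_ x * (X_ xh + kcst w%:~R).
Proof.
move=> hx hw.
have -> : X_ xh * X_ x = X_ x * X_ xh + U_in (gosp_brk (xh, xh) (x, x)).
  have h0 : gosp_homog false (xh, xh) by split; exact: (@osp_homog_basis 2).
  by case: hx => hx; rewrite /X_ (U_in_brk h0 (conj hx hx : gosp_homog _ (x, x)))
    /= expr0 kcst1 mul1r.
rewrite mulrDr; congr (_ + _).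
rewrite /gosp_brk /= hw.
have := U_in_ZD w%:~R (x, x) 0.
have -> : U_in 0 = 0.
  have := U_in_ZD 1 0 0; rewrite scale1r addr0 kcst1 mul1r.
  by move/(congr1 (fun z => z - U_in 0)); rewrite subrr addrK.
rewrite !addr0 => ->; exact: kcstC.
Qed.

Lemma atH_polyE (p : {poly K}) : loc_in D_UG (polyH p) = phorner (X_ xh) p.
Proof.
elim/poly_ind: p => [|p c IH].
  by rewrite /polyH !phorner0 loc_in0.
rewrite /polyH !phornerD (phornerMX (UG_in (xh, xh))) (phornerMX (X_ xh)).
rewrite loc_inD loc_inM.
by rewrite [loc_in _ (phorner _ p)]IH !phornerC loc_in_cst.
Qed.

Lemma phorner_comm (w : int) (x : osp) (p : {poly K}) :
  X_ xh * X_ x = X_ x * (X_ xh + kcst w%:~R) ->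
  phorner (X_ xh) p * X_ x = X_ x * phorner (X_ xh) (p \Po ('X + w%:~R%:P)).
Proof.
move=> hx; elim/poly_ind: p => [|p c IH].
  by rewrite comp_poly0 phorner0 mul0r mulr0.
rewrite comp_polyD comp_polyC comp_polyM comp_polyX !phornerD.
rewrite (phornerMX (X_ xh) p) (phornerM _ (p \Po _)) phornerD phornerX.
rewrite !phornerC mulrDl mulrDr.
by rewrite -kcstC -mulrA hx mulrA IH mulrA.
Qed.

Lemma D_shift (w : int) (d : {poly K}) : D d -> D (d \Po ('X + w%:~R%:P)).
Proof.
move=> [s ->]; exists [seq n - w | n <- s].
rewrite big_map rmorph_prod /=; apply: eq_bigr => n _.
by rewrite comp_polyB comp_polyX comp_polyC rmorphB /= polyCB opprB addrA.
Qed.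

Lemma atH_comm (w : int) (x : osp) (f : Uh_loc) :
  X_ xh * X_ x = X_ x * (X_ xh + kcst w%:~R) ->
  exists g, atH f * X_ x = X_ x * g.
Proof.
move=> hx; elim/pclsP: f => e; rewrite /atH plift_cls; last exact: Uh_gen_rel.
elim: e => [a|[p|d]|e [g eg] f [g' fg']|e [g eg] f [g' fg']] /=.
- by exists (kcst a); rewrite kcstC.
- exists (phorner (X_ xh) (p \Po ('X + w%:~R%:P))).
  by rewrite atH_polyE; exact: phorner_comm.
- set i := exist _ _ _; set d' := sval d \Po ('X + w%:~R%:P).
  have Dd' : D_UG (polyH d') by exact/polyH_D/D_shift/(svalP d).
  exists (loc_inv (exist _ _ Dd')).
  rewrite -[X_ x in RHS]mul1r -(loc_invl i) -!mulrA; congr (_ * _).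
  rewrite [sval i]/= atH_polyE mulrA (phorner_comm _ hx) -atH_polyE -mulrA.
  by rewrite (loc_invr (exist _ _ Dd')) mulr1.
- by exists (g + g'); rewrite mulrDl eg fg' mulrDr.
- by exists (g * g'); rewrite -mulrA fg' mulrA eg mulrA.
Qed.

Lemma J_stable (f : Uh_loc) (x : U) : x \in J -> atH f * x \in J.
Proof.
move=> /asboolP[a [b [c [d ->]]]]; apply/asboolP.
have [g1 h1] : exists g, atH f * X_ xm1 = X_ xm1 * g.
  apply/(@atH_comm 1)/X_h_comm; first by right; exact: (@osp_homog_basis 1).
  by rewrite (@osp_brk_basis 2 1) //= scale1r.
have [g2 h2] : exists g, atH f * X_ xm2 = X_ xm2 * g.
  apply/(@atH_comm 2)/X_h_comm; first by left; exact: (@osp_homog_basis 0).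
  by rewrite (@osp_brk_basis 2 0).
exists (g1 * a), (g2 * b), (atH f * c), (atH f * d).
by rewrite !mulrDr !mulrA h1 h2.
Qed.

Lemma toUJ_repr u : repr (toUJ u) - u \in J.
Proof. by rewrite Quotient.idealrBE /toUJ reprK. Qed.

Lemma toUJD : {morph toUJ : u v / u + v}.
Proof. by move=> u v; rewrite /toUJ !piE. Qed.

Definition UJ_scale (f : Uh_loc) (m : UJ) : UJ := toUJ (atH f * repr m).

Lemma UJ_scaleE f u : UJ_scale f (toUJ u) = toUJ (atH f * u).
Proof.
apply/eqP; rewrite -[_ == _]Quotient.idealrBE -mulrBr.
exact/J_stable/toUJ_repr.
Qed.

Lemma UJP (P : UJ -> Prop) : (forall u, P (toUJ u)) -> forall m, P m.
Proof. by move=> H m; rewrite -[m]reprK; exact: H. Qed.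

Lemma UJ_scaleA f g m : UJ_scale f (UJ_scale g m) = UJ_scale (f * g) m.
Proof. by elim/UJP: m => u; rewrite !UJ_scaleE atHM mulrA. Qed.
Lemma UJ_scale1 : left_id 1 UJ_scale.
Proof. by elim/UJP => u; rewrite !UJ_scaleE atH1 mul1r. Qed.
Lemma UJ_scaleDr : right_distributive UJ_scale +%R.
Proof.
move=> f; elim/UJP => u; elim/UJP => v.
by rewrite -toUJD !UJ_scaleE -toUJD mulrDr.
Qed.
Lemma UJ_scaleDl m : {morph UJ_scale^~ m : f g / f + g}.
Proof.
by move=> f g; elim/UJP: m => u; rewrite !UJ_scaleE atHD mulrDl toUJD.
Qed.

HB.instance Definition _ := GRing.Zmodule_isLmodule.Build Uh_loc UJ
  UJ_scaleA UJ_scale1 UJ_scaleDr UJ_scaleDl.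

Fixpoint phi (n : nat) : Uh_loc :=
  match n with
  | 0%N => 1
  | m.+1 => if odd m.+1 then - Hinv (uphalf m.+1) * phi m
            else kcst (m.+1./2)%:R^-1 * phi m
  end.

(* The sum is over the support of the terms, which is finite. It is taken at
   representatives of the two classes; the result does not depend on them. *)
Definition diamond (a b : UJ) : UJ :=
  \sum_(n \in [set: nat]%classic)
    toUJ (repr a * atH (phi n) * X_ xm1 ^+ n * X_ xp1 ^+ n * repr b).

Definition bar (x : osp) : UJ := toUJ (tilde x).

Definition diamond_exp (a : UJ) (p : nat) : UJ := iter p (diamond a) (toUJ 1).

End Osp.

Arguments xm2 {K}.
Arguments xm1 {K}.
Arguments xh {K}.
Arguments xp1 {K}.
Arguments xp2 {K}.
Arguments diamond {K}.
Arguments diamond_exp {K}.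

Notation "a <o> b" := (diamond a b)
  (at level 40, left associativity) : ring_scope.
Notation "a ^<o> p" := (diamond_exp a p)
  (at level 29, left associativity) : ring_scope.

(* Main.v *)
(* Write x = x_a and y = x_{-a}; then x^2 = - x_{2a} and y^2 = x_{-2a} in the
   enveloping algebra, so that J = yU + Ux for the diagonal y and x, and modulo J
   the bar generators are the classes of 2 x_{k a} and 2 h - H with x_{k a}, h
   taken in the first factor of G. As that factor is an ideal complementary to the
   diagonal, U/J is spanned over D^-1 U(h) by the classes of the monomials
   y1^a h1^b x1^c of the first factor. They are linearly independent: for
   non-integral lam they are separated by the action of U on the vector 1 of
   U / (Ux + U (H - lam)), read modulo the image of y, up to evaluation of the
   coefficients at lam + a - c.

   By x P = 0 = P y for P = sum phi_n(H) y^n x^n, the diamond product may be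
   computed on any representatives, and on monomials of the first factor its n-th
   term is (ad y1)^n u (ad x1)^n v up to coefficients in H. Only n <= 2 occurs when
   multiplying by a generator in the order of the statement, and it follows that
   the (p, q, r, s, t) bar monomial is a nonzero scalar times
   y1^A h1^r x1^(s+2t), A = 2p+q, plus monomials y1^a h1^b x1^c with b < r, or
   with b = r, A odd and a even. So the change of family is triangular for the
   rank 2b + (a mod 2), hence invertible. *)
Require Import Defs.
From HB Require Import structures.
From mathcomp Require Import all_boot all_order all_algebra.
From mathcomp Require Import boolp classical_sets functions cardinality fsbigop.
From mathcomp Require Import reals complex zify ring.

Set Implicit Arguments.
Unset Strict Implicit.
Unset Printing Implicit Defensive.

Import Order.TTheory GRing.Theory Num.Theory.

Local Open Scope ring_scope.

(** * Noncommutative ring identities *)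

(** [UG] and [U] are given by generators and relations only, so independence has to be witnessed by
    an explicit module in which every H - n is invertible. In the one used, H acts by scalars in lam
    plus the integers, which is why lam must not be an integer. A single lam sees a coefficient, a
    polynomial once denominators are cleared, at one point only; letting lam run through all n + 1/2
    gives infinitely many points. The degree in h1 alone is not a triangular order. For odd A the
    term n = 1 of the product of y1 ^ A h1 ^ r with x_a contains y1 ^ (A + 1) p(h1) x1 ^ 2 with p
    still of degree r, because h1 ^ r is added to its shift instead of subtracted from it. The
    exponent of y1 has then become even, so the parity of a breaks the tie; for even A the degree
    drops. *)

Section AbelianCancellation.
Variable V : zmodType.
Implicit Types l r s t p q x y : V.

(** In [l + p = r + q], the sums [l] and [r] hold the summands still to be sorted, and [p] and [q]
    collect summands without sign; a negated summand changes sides. *)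
Lemma cancel_start l r : 0 + l + 0 = 0 + r + 0 -> l = r.
Proof. by rewrite !addr0 !add0r. Qed.
Lemma cancel_lN l t p r q : l + p = r + (q + t) -> l - t + p = r + q.
Proof. by rewrite addrA => e; rewrite addrAC e addrK. Qed.
Lemma cancel_l l t p r q : l + (p + t) = r + q -> l + t + p = r + q.
Proof. by rewrite -addrA (addrC t). Qed.
Lemma cancel_rN l t p r q : l + (p + t) = r + q -> l + p = r - t + q.
Proof. by move=> e; apply/esym/cancel_lN. Qed.
Lemma cancel_r l t p r q : l + p = r + (q + t) -> l + p = r + t + q.
Proof. by move=> e; apply/esym/cancel_l. Qed.
Lemma cancel_end p q : p = q -> 0 + p = 0 + q.
Proof. by move->. Qed.
Lemma cancel_take p t q q' : q - t = q' -> p = q' -> p + t = q.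
Proof. by move=> <- ->; rewrite subrK. Qed.
Lemma cancel_found x t : x + t - t = x.
Proof. exact: addrK. Qed.
Lemma cancel_find x t r y : x - t = y -> x + r - t = y + r.
Proof. by move=> <-; rewrite addrAC. Qed.

End AbelianCancellation.

Ltac cancel_move :=
  match goal with
  | |- 0 + _ = 0 + _ => apply: cancel_end
  | |- _ - _ + _ = _ => apply: cancel_lN; cancel_move
  | |- _ + _ + _ = _ => apply: cancel_l; cancel_move
  | |- _ = _ - _ + _ => apply: cancel_rN; cancel_move
  | |- _ = _ + _ + _ => apply: cancel_r; cancel_move
  end.
Ltac cancel_search :=
  first [ eapply cancel_found | eapply cancel_find; cancel_search ].
Ltac cancel_match :=
  match goal with
  | |- 0 = 0 => reflexivity
  | |- _ + _ = _ => eapply cancel_take; [cancel_search | cancel_match]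
  end.

(* Proves equalities that hold in every ring: both sides are expanded, and their
   summands are matched one by one. *)
Ltac nc_ring :=
  rewrite ?(mulrDl, mulrDr, mulNr, mulrN, opprD, opprK, mulr1, mul1r, mulr0, mul0r, addr0, add0r, oppr0, mulrA, mulr2n);
  apply: cancel_start; rewrite ?addrA; cancel_move; cancel_match.

Section PzAlgebraTheory.
Variables (K : comNzRingType) (B : pzAlgType K).
Implicit Types (a b : K) (u v x h : B) (p q : {poly K}).

Lemma kcstN a : kcst (- a) = - kcst a :> B.
Proof. by apply: (addIr (kcst a)); rewrite -kcstD !addNr kcst0. Qed.

Lemma kcst_nat n : kcst n%:R = n%:R :> B.
Proof.
elim: n => [|n IH]; first exact: kcst0.
by rewrite -addn1 !natrD kcstD IH kcst1.
Qed.

Lemma kcst_sign n : kcst ((-1) ^+ n) = (-1) ^+ n :> B.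
Proof. by rewrite -signr_odd -[in RHS]signr_odd; case: (odd n); rewrite ?kcstN kcst1. Qed.

Lemma signrC n u : (-1) ^+ n * u = u * (-1) ^+ n.
Proof. by rewrite -kcst_sign kcstC. Qed.

Lemma phornerN h p : phorner h (- p) = - phorner h p.
Proof. by apply: (addIr (phorner h p)); rewrite -phornerD !addNr phorner0. Qed.

Lemma phorner_nat h n : phorner h n%:R = n%:R.
Proof. by rewrite -polyC_natr phornerC kcst_nat. Qed.

Lemma phorner_sign h n : phorner h ((-1) ^+ n) = (-1) ^+ n.
Proof. by rewrite -signr_odd -[in RHS]signr_odd; case: (odd n); rewrite ?phornerN phorner1. Qed.

Lemma phornerXn h n : phorner h 'X^n = h ^+ n.
Proof.
by elim: n => [|n IH]; rewrite ?expr0 ?phorner1 // !exprSr phornerMX IH.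
Qed.

Lemma phorner_id h p : GRing.comm h (phorner h p).
Proof. by rewrite /GRing.comm -[h in h * _](phornerX h) -phornerM mulrC phornerM phornerX. Qed.

Lemma phorner_shiftl h u (w : K) p : h * u = u * (h + kcst w) ->
  phorner h p * u = u * phorner h (p \Po ('X + w%:P)).
Proof.
move=> hu; elim/poly_ind: p => [|p c IH].
  by rewrite comp_poly0 phorner0 mul0r mulr0.
rewrite comp_polyD comp_polyC comp_polyM comp_polyX !phornerD.
rewrite phornerMX [phorner h ((_ \Po _) * _)]phornerM phornerD phornerX !phornerC mulrDl mulrDr.
by rewrite -kcstC -mulrA hu mulrA IH mulrA.
Qed.

Lemma phorner_shiftr h u (w : K) p : u * h = (h + kcst w) * u ->
  u * phorner h p = phorner h (p \Po ('X + w%:P)) * u.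
Proof.
move=> hu; elim/poly_ind: p => [|p c IH].
  by rewrite comp_poly0 phorner0 mul0r mulr0.
rewrite comp_polyD comp_polyC comp_polyM comp_polyX !phornerD.
rewrite phornerMX [phorner h ((_ \Po _) * _)]phornerM phornerD phornerX !phornerC mulrDl mulrDr.
by rewrite kcstC mulrA IH -mulrA hu mulrA.
Qed.

Lemma phorner_comm_gen h u p : GRing.comm h u -> GRing.comm (phorner h p) u.
Proof.
move=> hu; rewrite /GRing.comm (@phorner_shiftl _ _ 0) ?kcst0 ?addr0 //.
by rewrite comp_polyXr.
Qed.

End PzAlgebraTheory.

(** * The relations of osp(1|2) *)

(* The polynomials with [x, y ^ a]_super = y ^ (a - 1) * (kap a)(h) in
   U(osp(1|2)); note kap 0 = 0. *)
Definition kap (K : nzRingType) (a : nat) : {poly K} :=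
  if odd a then 'X + (a./2)%:R else (a./2)%:R.
Arguments kap {K}.

Section OspTriple.
Variables (K : comNzRingType) (B : pzAlgType K).

(* x, y, h satisfy the relations of x_a, x_{-a}, h in osp(1|2); these three
   generate it, since x_{2a} = - x_a ^ 2 and x_{-2a} = x_{-a} ^ 2 in the
   enveloping algebra. *)
Definition osp_triple (x y h : B) : Prop :=
  [/\ x * y = h - y * x, h * y = y * (h + 1) & x * h = (h + 1) * x].

(** The recursion that comes from moving x past one more y: the last y shifts the polynomial found
    so far, and x y = h - y x contributes (-1) ^ a h. *)
Lemma kapS a : kap a \Po ('X + 1) + (-1) ^+ a * 'X = kap a.+1 :> {poly K}.
Proof.
rewrite /kap /= -signr_odd uphalf_half.
by case: (odd a) => /=; rewrite ?comp_polyD ?comp_polyX -!polyC_natr ?comp_polyC ?add0n ?natrD ?polyCD; ring.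
Qed.

Variables x y h : B.
Hypothesis xyh : osp_triple x y h.

Lemma triple_hy (p : {poly K}) : phorner h p * y = y * phorner h (p \Po ('X + 1)).
Proof. by case: xyh => _ hy _; rewrite (@phorner_shiftl _ _ _ _ 1) // kcst1. Qed.

Lemma triple_xh (p : {poly K}) : x * phorner h p = phorner h (p \Po ('X + 1)) * x.
Proof. by case: xyh => _ _ xh; rewrite (@phorner_shiftr _ _ _ _ 1) // kcst1. Qed.

Lemma triple_xyn a :
  x * y ^+ a = y ^+ a.-1 * phorner h (kap a) + (-1) ^+ a * (y ^+ a * x).
Proof.
have [xy _ _] := xyh.
elim: a => [|a IH]; first by rewrite /kap /= phorner0 mulr0 add0r !expr0 !(mulr1, mul1r).
rewrite exprSr mulrA IH mulrDl -(mulrA (y ^+ _)) triple_hy mulrA -exprSr.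
(* [a.-1.+1] differs from [a] only for a = 0, where [kap 0] vanishes. *)
have -> : y ^+ a.-1.+1 * phorner h (kap a \Po ('X + 1)) = y ^+ a * phorner h (kap a \Po ('X + 1)).
  by case: (a) => //; rewrite /kap /= comp_polyC phorner0 !mulr0.
rewrite /= -kapS phornerD phornerM phorner_sign phornerX [(-1) ^+ a.+1]exprSr.
rewrite -!mulrA xy !mulrDr [y ^+ a * ((-1) ^+ a * h)]mulrA -[y ^+ a * (-1) ^+ a]signrC; nc_ring.
Qed.

Lemma triple_xny c :
  x ^+ c * y = phorner h (kap c) * x ^+ c.-1 + (-1) ^+ c * (y * x ^+ c).
Proof.
have [xy _ _] := xyh.
elim: c => [|c IH]; first by rewrite /kap /= phorner0 mul0r add0r !expr0 !(mulr1, mul1r).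
rewrite exprS -mulrA IH mulrDr mulrA triple_xh -mulrA -exprS.
have -> : phorner h (kap c \Po ('X + 1)) * x ^+ c.-1.+1 = phorner h (kap c \Po ('X + 1)) * x ^+ c.
  by case: (c) => //; rewrite /kap /= comp_polyC phorner0 !mul0r.
rewrite /= -kapS phornerD phornerM phorner_sign phornerX [(-1) ^+ c.+1]exprSr.
rewrite [x * (_ * _)]mulrA -[x * (-1) ^+ c]signrC -[(-1) ^+ c * x * _]mulrA [x * (y * _)]mulrA xy; nc_ring.
Qed.

Lemma triple_yM a (p : {poly K}) : phorner h p * y ^+ a = y ^+ a * phorner h (p \Po ('X + a%:R)).
Proof.
have [_ hy _] := xyh.
rewrite -polyC_natr; apply: phorner_shiftl; rewrite kcst_nat.
elim: a => [|a IH]; first by rewrite expr0 addr0 mul1r mulr1.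
by rewrite exprSr mulrA IH -[in RHS]natr1 -mulrA mulrDl hy mulr_natl -[y *+ a]mulr_natr; nc_ring.
Qed.

End OspTriple.

Definition super_commute (B : pzRingType) (x1 y1 h1 x2 y2 h2 : B) : Prop :=
  [/\ [/\ x1 * x2 = - (x2 * x1), x1 * y2 = - (y2 * x1) & x1 * h2 = h2 * x1],
      [/\ y1 * x2 = - (x2 * y1), y1 * y2 = - (y2 * y1) & y1 * h2 = h2 * y1]
    & [/\ h1 * x2 = x2 * h1, h1 * y2 = y2 * h1 & h1 * h2 = h2 * h1]].

Lemma osp_triple_diag (K : comNzRingType) (B : pzAlgType K)
    (x1 y1 h1 x2 y2 h2 : B) :
  osp_triple x1 y1 h1 -> osp_triple x2 y2 h2 ->
  super_commute x1 y1 h1 x2 y2 h2 ->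
  osp_triple (x1 + x2) (y1 + y2) (h1 + h2).
Proof.
case=> xy1 hy1 xh1 [xy2 hy2 xh2] [[xx xy xh] [yx yy yh] [hx hy hh]].
split; rewrite !(mulrDl, mulrDr) ?mulr1 ?mul1r.
- by rewrite xy1 xy2 xy yx; nc_ring.
- by rewrite hy1 hy2 hy -yh; nc_ring.
- by rewrite xh1 xh2 xh hx; nc_ring.
Qed.

(** * Generators of the two factors and of the diagonal in U *)

Section Generators.
Variable K : numFieldType.

Lemma U_in0 : U_in (0 : gosp K) = 0.
Proof.
have := U_in_ZD 1 (0 : gosp K) 0; rewrite scale1r addr0 kcst1 mul1r => e.
by apply: (addIr (U_in 0)); rewrite -e add0r.
Qed.

Lemma U_inZ a (u : gosp K) : U_in (a *: u) = kcst a * U_in u.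
Proof. by rewrite -[a *: u]addr0 U_in_ZD U_in0 addr0. Qed.

Lemma U_inD (u v : gosp K) : U_in (u + v) = U_in u + U_in v.
Proof. by rewrite -[u]scale1r U_in_ZD kcst1 mul1r scale1r. Qed.

Lemma U_inN (u : gosp K) : U_in (- u) = - U_in u.
Proof. by rewrite -scaleN1r U_inZ kcstN kcst1 mulN1r. Qed.

Definition eL (u : osp K) : U K := U_in (u, 0).
Definition eR (u : osp K) : U K := U_in (0, u).

Lemma eL_ZD a u v : eL (a *: u + v) = kcst a * eL u + eL v.
Proof. by rewrite /eL -U_in_ZD; congr U_in; congr pair; rewrite /= scaler0 addr0. Qed.
Lemma eR_ZD a u v : eR (a *: u + v) = kcst a * eR u + eR v.
Proof. by rewrite /eR -U_in_ZD; congr U_in; congr pair; rewrite /= scaler0 addr0. Qed.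
Lemma eL0 : eL 0 = 0. Proof. exact: U_in0. Qed.
Lemma eR0 : eR 0 = 0. Proof. exact: U_in0. Qed.
Lemma eLZ a u : eL (a *: u) = kcst a * eL u.
Proof. by rewrite -[a *: u]addr0 eL_ZD eL0 addr0. Qed.
Lemma eRZ a u : eR (a *: u) = kcst a * eR u.
Proof. by rewrite -[a *: u]addr0 eR_ZD eR0 addr0. Qed.
Lemma eLN u : eL (- u) = - eL u.
Proof. by rewrite -scaleN1r eLZ kcstN kcst1 mulN1r. Qed.
Lemma eRN u : eR (- u) = - eR u.
Proof. by rewrite -scaleN1r eRZ kcstN kcst1 mulN1r. Qed.

Lemma osp_brk0l (u : osp K) : osp_brk 0 u = 0.
Proof. by rewrite /osp_brk big1 // => i _; rewrite big1 // => j _; rewrite mxE mul0r scale0r. Qed.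
Lemma osp_brk0r (u : osp K) : osp_brk u 0 = 0.
Proof. by rewrite /osp_brk big1 // => i _; rewrite big1 // => j _; rewrite mxE mulr0 scale0r. Qed.
Lemma osp_homog0 p : osp_homog p (0 : osp K).
Proof. by move=> i _; rewrite mxE. Qed.

Local Notation b := (@osp_basis K).

Lemma eLM i j : (i < 5)%N -> (j < 5)%N -> eL (b i) * eL (b j) =
  (-1) ^+ (odd i && odd j) * (eL (b j) * eL (b i)) + eL (osp_table K i j).
Proof.
move=> i5 j5; rewrite /eL (@U_in_brk _ (odd i) (odd j)).
- by rewrite kcst_sign /gosp_brk /= osp_brk0l osp_brk_basis.
- by split; [exact: osp_homog_basis|exact: osp_homog0].
- by split; [exact: osp_homog_basis|exact: osp_homog0].
Qed.

Lemma eRM i j : (i < 5)%N -> (j < 5)%N -> eR (b i) * eR (b j) =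
  (-1) ^+ (odd i && odd j) * (eR (b j) * eR (b i)) + eR (osp_table K i j).
Proof.
move=> i5 j5; rewrite /eR (@U_in_brk _ (odd i) (odd j)).
- by rewrite kcst_sign /gosp_brk /= osp_brk0l osp_brk_basis.
- by split; [exact: osp_homog0|exact: osp_homog_basis].
- by split; [exact: osp_homog0|exact: osp_homog_basis].
Qed.

Lemma eLR i j : (i < 5)%N -> (j < 5)%N -> eL (b i) * eR (b j) =
  (-1) ^+ (odd i && odd j) * (eR (b j) * eL (b i)).
Proof.
move=> i5 j5; rewrite /eR /eL (@U_in_brk _ (odd i) (odd j)).
- by rewrite kcst_sign /gosp_brk /= osp_brk0l osp_brk0r U_in0 addr0.
- by split; [exact: osp_homog_basis|exact: osp_homog0].
- by split; [exact: osp_homog0|exact: osp_homog_basis].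
Qed.

Lemma two_neq0 : 2%:R != 0 :> K. Proof. by rewrite pnatr_eq0. Qed.

(** The brackets of x_a and x_{-a} with themselves determine only twice the squares of these odd
    vectors. *)
Lemma double_inj (B : pzAlgType K) (u v : B) : u + u = v + v -> u = v.
Proof.
move=> e; rewrite -[u]mul1r -[v]mul1r -kcst1 -(mulVf two_neq0) kcstM -!mulrA kcst_nat.
by rewrite !mulr_natl !mulr2n e.
Qed.

Lemma eL_xm2 : eL xm2 = eL xm1 ^+ 2.
Proof.
apply: double_inj; have := @eLM 1 1 isT isT; rewrite expr1 mulN1r eLZ kcst_nat mulr_natl.
by rewrite expr2 mulr2n => {1}->; nc_ring.
Qed.
Lemma eL_xp2 : eL xp2 = - eL xp1 ^+ 2.
Proof.
apply: double_inj; have := @eLM 3 3 isT isT; rewrite expr1 mulN1r eLN eLZ kcst_nat mulr_natl.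
by rewrite expr2 mulr2n => {1}->; nc_ring.
Qed.
Lemma eR_xm2 : eR xm2 = eR xm1 ^+ 2.
Proof.
apply: double_inj; have := @eRM 1 1 isT isT; rewrite expr1 mulN1r eRZ kcst_nat mulr_natl.
by rewrite expr2 mulr2n => {1}->; nc_ring.
Qed.
Lemma eR_xp2 : eR xp2 = - eR xp1 ^+ 2.
Proof.
apply: double_inj; have := @eRM 3 3 isT isT; rewrite expr1 mulN1r eRN eRZ kcst_nat mulr_natl.
by rewrite expr2 mulr2n => {1}->; nc_ring.
Qed.

Lemma triple_eL : osp_triple (eL xp1) (eL xm1) (eL xh).
Proof.
split.
- by rewrite (@eLM 3 1) //= expr1 mulN1r addrC.
- by rewrite (@eLM 2 1) //= expr0 mul1r mulrDr mulr1.
- by rewrite (@eLM 3 2) //= expr0 mul1r mulrDl mul1r.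
Qed.
Lemma triple_eR : osp_triple (eR xp1) (eR xm1) (eR xh).
Proof.
split.
- by rewrite (@eRM 3 1) //= expr1 mulN1r addrC.
- by rewrite (@eRM 2 1) //= expr0 mul1r mulrDr mulr1.
- by rewrite (@eRM 3 2) //= expr0 mul1r mulrDl mul1r.
Qed.
Lemma super_eLR : super_commute (eL xp1) (eL xm1) (eL xh) (eR xp1) (eR xm1) (eR xh).
Proof. by do 2!split; rewrite eLR //= ?(expr0, expr1) ?(mul1r, mulN1r). Qed.

Lemma X_E u : X_ u = eL u + eR u.
Proof. by rewrite /eL /eR -U_inD; congr U_in; congr pair; rewrite /= ?addr0 ?add0r. Qed.
Lemma tildeE u : tilde u = 2%:R * eL u - X_ u.
Proof.
rewrite X_E mulr_natl mulr2n /tilde.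
have -> : (u, - u) = (u, 0) + - (0, u) :> gosp K by congr pair; rewrite /= ?oppr0 ?addr0 ?add0r.
rewrite U_inD U_inN -/(eL u) -/(eR u); nc_ring.
Qed.

Lemma triple_X : osp_triple (X_ xp1 : U K) (X_ xm1) (X_ xh).
Proof. by rewrite !X_E; apply: osp_triple_diag; [exact: triple_eL|exact: triple_eR|exact: super_eLR]. Qed.

Lemma X_xm2 : X_ xm2 = (X_ xm1 : U K) ^+ 2.
Proof.
have [_ [_ yy _] _] := super_eLR.
by rewrite !X_E eL_xm2 eR_xm2 !expr2 mulrDl !mulrDr yy; nc_ring.
Qed.
Lemma X_xp2 : X_ xp2 = - (X_ xp1 : U K) ^+ 2.
Proof.
have [[xx _ _] _ _] := super_eLR.
by rewrite !X_E eL_xp2 eR_xp2 !expr2 mulrDl !mulrDr xx; nc_ring.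
Qed.
End Generators.

Section SumProducts.
Variables (K : comNzRingType) (B : pzAlgType K) (I J : finType).
Variables (u : I -> K) (v : J -> K) (f : I -> B) (g : J -> B).

Lemma pair_sum_mul :
  (\sum_i kcst (u i) * f i) * (\sum_j kcst (v j) * g j) =
  \sum_i \sum_j kcst (u i * v j) * (f i * g j).
Proof.
rewrite mulr_suml; apply: eq_bigr => i _; rewrite mulr_sumr; apply: eq_bigr => j _.
by rewrite kcstM -!mulrA [f i * _]mulrA -kcstC !mulrA.
Qed.

Lemma pair_sum_mulC :
  (\sum_j kcst (v j) * g j) * (\sum_i kcst (u i) * f i) =
  \sum_i \sum_j kcst (u i * v j) * (g j * f i).
Proof.
rewrite mulr_sumr; apply: eq_bigr => i _; rewrite mulr_suml; apply: eq_bigr => j _.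
by rewrite mulrC kcstM -!mulrA [g j * _]mulrA -kcstC !mulrA.
Qed.
End SumProducts.

(** * Algebra morphisms out of U *)

Section OspMap.
Variables (K : fieldType) (B : pzAlgType K) (x y h : B).

Definition osp_image (k : nat) : B := nth 0 [:: y ^+ 2; y; h; x; - x ^+ 2] k.

Definition osp_map (u : osp K) : B := \sum_(k < 5) kcst (u 0 k) * osp_image k.

Lemma osp_map_ZD a u v : osp_map (a *: u + v) = kcst a * osp_map u + osp_map v.
Proof.
rewrite /osp_map mulr_sumr -big_split; apply: eq_bigr => k _ /=.
by rewrite !mxE kcstD kcstM mulrDl mulrA.
Qed.
Lemma osp_map0 : osp_map 0 = 0.
Proof. by rewrite /osp_map big1 // => k _; rewrite mxE kcst0 mul0r. Qed.
Lemma osp_mapD u v : osp_map (u + v) = osp_map u + osp_map v.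
Proof. by rewrite -[u]scale1r osp_map_ZD kcst1 mul1r scale1r. Qed.
Lemma osp_mapZ a u : osp_map (a *: u) = kcst a * osp_map u.
Proof. by rewrite -[a *: u]addr0 osp_map_ZD osp_map0 addr0. Qed.
Lemma osp_mapN u : osp_map (- u) = - osp_map u.
Proof. by rewrite -scaleN1r osp_mapZ kcstN kcst1 mulN1r. Qed.

Lemma osp_map_basis k : (k < 5)%N -> osp_map (osp_basis K k) = osp_image k.
Proof.
move=> k5; rewrite /osp_map (bigD1 (Ordinal k5)) //= big1 ?addr0 => [|i].
  by rewrite mxE eqxx -val_eqE /= inordK // eqxx kcst1 mul1r.
by rewrite -val_eqE /= => ik; rewrite mxE eqxx -val_eqE /= inordK // (negPf ik) kcst0 mul0r.
Qed.

Hypothesis xyh : osp_triple x y h.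

Lemma osp_image_brk i j : (i < 5)%N -> (j < 5)%N -> osp_image i * osp_image j =
  (-1) ^+ (odd i && odd j) * (osp_image j * osp_image i) + osp_map (osp_table K i j).
Proof.
have [xy hy xh] := xyh.
(* The three relations, also behind a prefix [u], move y to the left and x to the right; both sides
   of each of the 25 relations reach the normal order y, h, x. *)
have xyA u : u * x * y = u * h - u * y * x by rewrite -mulrA xy mulrBr mulrA.
have hyA u : u * h * y = u * y * h + u * y by rewrite -mulrA hy mulrDr mulr1 mulrDr mulrA.
have xhA u : u * x * h = u * h * x + u * x by rewrite -mulrA xh mulrDl mul1r mulrDr mulrA.
move: i j => [|[|[|[|[|//]]]]] [|[|[|[|[|//]]]]] _ _ /=;
rewrite ?(osp_map0, osp_mapN, osp_mapZ) ?osp_map_basis // ?kcst_nat /osp_image /= ?(expr0, expr1) ?expr2 ?mulr_natl ?(mulN1r,mul1r) ?(mulrN,mulNr,opprK,mulrA,mulrDl,mulrDr,mulr1,xy,hy,xh,xyA,hyA,xhA,opprD,addrA);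
nc_ring.
Qed.

Lemma osp_map_brk p q u v : osp_homog p u -> osp_homog q v ->
  osp_map u * osp_map v =
  (-1) ^+ (p && q) * (osp_map v * osp_map u) + osp_map (osp_brk u v).
Proof.
move=> pu qv.
have -> : osp_map (osp_brk u v) =
    \sum_(i < 5) \sum_(j < 5) kcst (u 0 i * v 0 j) * osp_map (osp_table K i j).
  rewrite /osp_brk (big_morph osp_map osp_mapD osp_map0); apply: eq_bigr => i _.
  rewrite (big_morph osp_map osp_mapD osp_map0); apply: eq_bigr => j _.
  exact: osp_mapZ.
rewrite /osp_map pair_sum_mul pair_sum_mulC mulr_sumr -big_split; apply: eq_bigr => i _.
rewrite /= mulr_sumr -big_split; apply: eq_bigr => j _ /=.
have [/eqP pi|/pu->] := boolP (odd i == p); last by rewrite mul0r kcst0 !mul0r mulr0 addr0.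
have [/eqP qj|/qv->] := boolP (odd j == q); last by rewrite mulr0 kcst0 !mul0r mulr0 addr0.
by rewrite osp_image_brk // pi qj mulrDr !mulrA kcstC.
Qed.
End OspMap.

Section GospMap.
Variables (K : fieldType) (B : pzAlgType K) (x1 y1 h1 x2 y2 h2 : B).
Hypothesis xyh1 : osp_triple x1 y1 h1.
Hypothesis xyh2 : osp_triple x2 y2 h2.
Hypothesis xyh12 : super_commute x1 y1 h1 x2 y2 h2.

Local Notation f1 := (osp_map x1 y1 h1).
Local Notation f2 := (osp_map x2 y2 h2).

Lemma osp_image_cross i j : (i < 5)%N -> (j < 5)%N ->
  osp_image x1 y1 h1 i * osp_image x2 y2 h2 j =
  (-1) ^+ (odd i && odd j) * (osp_image x2 y2 h2 j * osp_image x1 y1 h1 i).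
Proof.
have [[xx xy xh] [yx yy yh] [hx hy hh]] := xyh12.
have xxA u : u * x1 * x2 = - (u * x2 * x1) by rewrite -mulrA xx mulrN mulrA.
have xyA u : u * x1 * y2 = - (u * y2 * x1) by rewrite -mulrA xy mulrN mulrA.
have xhA u : u * x1 * h2 = u * h2 * x1 by rewrite -mulrA xh mulrA.
have yxA u : u * y1 * x2 = - (u * x2 * y1) by rewrite -mulrA yx mulrN mulrA.
have yyA u : u * y1 * y2 = - (u * y2 * y1) by rewrite -mulrA yy mulrN mulrA.
have yhA u : u * y1 * h2 = u * h2 * y1 by rewrite -mulrA yh mulrA.
have hxA u : u * h1 * x2 = u * x2 * h1 by rewrite -mulrA hx mulrA.
have hyA u : u * h1 * y2 = u * y2 * h1 by rewrite -mulrA hy mulrA.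
have hhA u : u * h1 * h2 = u * h2 * h1 by rewrite -mulrA hh mulrA.
by move: i j => [|[|[|[|[|//]]]]] [|[|[|[|[|//]]]]] _ _; rewrite /osp_image /= ?(expr0, expr1) ?expr2 ?(mulN1r,mul1r) ?(mulrN,mulNr,opprK,mulrA,xx,xy,xh,yx,yy,yh,hx,hy,hh,xxA,xyA,xhA,yxA,yyA,yhA,hxA,hyA,hhA).
Qed.

Lemma osp_map_cross p q u v : osp_homog p u -> osp_homog q v ->
  f1 u * f2 v = (-1) ^+ (p && q) * (f2 v * f1 u).
Proof.
move=> pu qv; rewrite /osp_map pair_sum_mul pair_sum_mulC mulr_sumr; apply: eq_bigr => i _.
rewrite /= mulr_sumr; apply: eq_bigr => j _ /=.
have [/eqP pi|/pu->] := boolP (odd i == p); last by rewrite mul0r kcst0 !mul0r mulr0.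
have [/eqP qj|/qv->] := boolP (odd j == q); last by rewrite mulr0 kcst0 !mul0r mulr0.
by rewrite osp_image_cross // pi qj !mulrA kcstC.
Qed.

Definition gosp_map (u : gosp K) : B := f1 u.1 + f2 u.2.

Lemma gosp_map_rel e f : env_rel (@gosp_homog K) (@gosp_brk K) e f ->
  peval gosp_map e = peval gosp_map f.
Proof.
case=> [a u v|p q u v [pu1 pu2] [qv1 qv2]] /=.
  by rewrite /gosp_map !osp_map_ZD; nc_ring.
rewrite kcst_sign /gosp_map !(mulrDl, mulrDr) (osp_map_brk xyh1 pu1 qv1) (osp_map_brk xyh2 pu2 qv2).
rewrite (osp_map_cross pu1 qv2) (osp_map_cross qv1 pu2) andbC.
rewrite [(-1) ^+ _ * ((-1) ^+ _ * _)]mulrA -signr_addb addbb mul1r.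
nc_ring.
Qed.

Definition env_map : UG K -> B := plift gosp_map.

Lemma env_mapD : {morph env_map : u v / u + v}. Proof. exact: pliftD gosp_map_rel. Qed.
Lemma env_mapM : {morph env_map : u v / u * v}. Proof. exact: pliftM gosp_map_rel. Qed.
Lemma env_map_cst a : env_map (kcst a) = kcst a. Proof. exact: (plift_cst gosp_map_rel a). Qed.
Lemma env_map_in u : env_map (UG_in u) = gosp_map u. Proof. exact: (plift_gen gosp_map_rel u). Qed.
Lemma env_map_sum (I : Type) (r : seq I) (P : pred I) (F : I -> UG K) :
  env_map (\sum_(i <- r | P i) F i) = \sum_(i <- r | P i) env_map (F i).
Proof. by apply: (big_morph _ env_mapD); rewrite -(kcst0 (K := K)) env_map_cst kcst0. Qed.
Lemma env_mapX u n : env_map (u ^+ n) = env_map u ^+ n.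
Proof.
elim: n => [|n IH]; last by rewrite !exprS env_mapM IH.
by rewrite !expr0 -(kcst1 (K := K)) env_map_cst kcst1.
Qed.

Lemma env_map_H : env_map (UG_in (xh, xh)) = h1 + h2.
Proof. by rewrite env_map_in /gosp_map /= !(osp_map_basis _ _ _ (k := 2)). Qed.

Lemma env_map_polyH p : env_map (polyH p) = phorner (h1 + h2) p.
Proof.
rewrite /polyH /phorner env_map_sum; apply: eq_bigr => i _.
by rewrite env_mapM env_map_cst env_mapX env_map_H.
Qed.

Hypothesis D_inv : forall d : {poly K}, D d ->
  {b : B | b * phorner (h1 + h2) d = 1 /\ phorner (h1 + h2) d * b = 1}.

(** The inverse is data rather than an existence statement, because [loc_gen] must send a formal
    inverse to an element; the polynomial is picked by classical choice. *)
Definition D_UG_inv (s : {s : UG K | D_UG s}) :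
  {b : B | b * env_map (sval s) = 1 /\ env_map (sval s) * b = 1}.
Proof.
case: s => s /= /cid2[d Dd ->]; rewrite env_map_polyH; exact: D_inv.
Defined.

Definition loc_gen (u : UG K + {s : UG K | D_UG s}) : B :=
  match u with inl u => env_map u | inr s => sval (D_UG_inv s) end.

Lemma loc_gen_rel e f : loc_rel e f -> peval loc_gen e = peval loc_gen f.
Proof.
case=> /= [a|u v|u v|s|s].
- exact: env_map_cst.
- exact: env_mapD.
- exact: env_mapM.
- by rewrite kcst1; case: (svalP (D_UG_inv s)).
- by rewrite kcst1; case: (svalP (D_UG_inv s)).
Qed.

Definition U_map : U K -> B := plift loc_gen.

Lemma U_mapD : {morph U_map : u v / u + v}. Proof. exact: pliftD loc_gen_rel. Qed.
Lemma U_mapM : {morph U_map : u v / u * v}. Proof. exact: pliftM loc_gen_rel. Qed.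
Lemma U_map_cst a : U_map (kcst a) = kcst a. Proof. exact: (plift_cst loc_gen_rel a). Qed.
Lemma U_map_in u : U_map (U_in u) = gosp_map u.
Proof. by rewrite /U_map (plift_gen loc_gen_rel) /= env_map_in. Qed.
Lemma U_map_polyH p : U_map (loc_in (@D_UG K) (polyH p)) = phorner (h1 + h2) p.
Proof. by rewrite /U_map (plift_gen loc_gen_rel) /= env_map_polyH. Qed.
End GospMap.

(** * A module separating the monomials *)

Section LinearEndomorphisms.
Variables (K : comNzRingType) (V : lmodType K).

Record lend := Lend {
  lend_fun :> V -> V;
  lend_linear : forall a u v, lend_fun (a *: u + v) = a *: lend_fun u + lend_fun v
}.

HB.instance Definition _ := gen_eqMixin lend.
HB.instance Definition _ := gen_choiceMixin lend.

Implicit Types f g h : lend.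

Lemma lendP f g : (forall v, f v = g v) -> f = g.
Proof.
case: f g => [f lf] [g lg] /= /funext fg; case: _ / fg in lg *.
congr Lend; exact: Prop_irrelevance.
Qed.

Lemma lendD f u v : f (u + v) = f u + f v.
Proof. by rewrite -[u]scale1r lend_linear !scale1r. Qed.
Lemma lend0 f : f 0 = 0.
Proof. by apply: (addIr (f 0)); rewrite -lendD !add0r. Qed.
Lemma lendZ f a u : f (a *: u) = a *: f u.
Proof. by rewrite -[a *: u]addr0 lend_linear lend0 addr0. Qed.

Program Definition lend_add f g := @Lend (fun v => f v + g v) _.
Next Obligation. by rewrite !lend_linear scalerDr addrACA. Qed.
Program Definition lend_zero := @Lend (fun=> 0) _.
Next Obligation. by rewrite scaler0 addr0. Qed.
Program Definition lend_opp f := @Lend (fun v => - f v) _.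
Next Obligation. by rewrite lend_linear opprD scalerN. Qed.
Program Definition lend_one := @Lend (fun v => v) _.
Program Definition lend_mul f g := @Lend (fun v => f (g v)) _.
Next Obligation. by rewrite !lend_linear. Qed.
Program Definition lend_cst a := @Lend (fun v => a *: v) _.
Next Obligation. by rewrite scalerDr !scalerA mulrC. Qed.

Lemma lend_addA : associative lend_add.
Proof. by move=> f g h; apply: lendP => v /=; rewrite addrA. Qed.
Lemma lend_addC : commutative lend_add.
Proof. by move=> f g; apply: lendP => v /=; rewrite addrC. Qed.
Lemma lend_add0 : left_id lend_zero lend_add.
Proof. by move=> f; apply: lendP => v /=; rewrite add0r. Qed.
Lemma lend_addN : left_inverse lend_zero lend_opp lend_add.
Proof. by move=> f; apply: lendP => v /=; rewrite addNr. Qed.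
HB.instance Definition _ :=
  GRing.isZmodule.Build lend lend_addA lend_addC lend_add0 lend_addN.

Lemma lend_mulA : associative lend_mul. Proof. by move=> f g h; apply: lendP. Qed.
Lemma lend_mul1 : left_id lend_one lend_mul. Proof. by move=> f; apply: lendP. Qed.
Lemma lend_mulr1 : right_id lend_one lend_mul. Proof. by move=> f; apply: lendP. Qed.
Lemma lend_mulDl : left_distributive lend_mul lend_add.
Proof. by move=> f g h; apply: lendP. Qed.
Lemma lend_mulDr : right_distributive lend_mul lend_add.
Proof. by move=> f g h; apply: lendP => v /=; rewrite lendD. Qed.
HB.instance Definition _ := GRing.Zmodule_isPzRing.Build lend
  lend_mulA lend_mul1 lend_mulr1 lend_mulDl lend_mulDr.

Lemma lend_cst1 : lend_cst 1 = 1.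
Proof. by apply: lendP => v /=; rewrite scale1r. Qed.
Lemma lend_cstD : {morph lend_cst : a b / a + b}.
Proof. by move=> a b; apply: lendP => v /=; rewrite scalerDl. Qed.
Lemma lend_cstM : {morph lend_cst : a b / a * b}.
Proof. by move=> a b; apply: lendP => v /=; rewrite scalerA. Qed.
Lemma lend_cstC a f : lend_cst a * f = f * lend_cst a.
Proof. by apply: lendP => v /=; rewrite lendZ. Qed.
HB.instance Definition _ :=
  isPzAlgebra.Build K lend lend_cst1 lend_cstD lend_cstM lend_cstC.

Lemma lendDE f g v : (f + g) v = f v + g v. Proof. by []. Qed.
Lemma lendNE f v : (- f) v = - f v. Proof. by []. Qed.
Lemma lendME f g v : (f * g) v = f (g v). Proof. by []. Qed.
Lemma lend0E v : (0 : lend) v = 0. Proof. by []. Qed.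
Lemma lend_kcstE a v : (kcst a : lend) v = a *: v. Proof. by []. Qed.
Lemma lend_signE n f v : ((-1) ^+ n * f) v = (-1) ^+ n *: f v.
Proof. by rewrite -kcst_sign lendME lend_kcstE. Qed.
End LinearEndomorphisms.

(** This is the relation x y + y x = h read at level a of the induced module, where h acts by eta +
    a. *)
Lemma kap_add (K : comNzRingType) a : kap a.+1 + kap a = 'X + a%:R :> {poly K}.
Proof.
rewrite /kap /= uphalf_half -[in RHS](odd_double_half a) -addnn.
by case: (odd a) => /=; rewrite ?add0n !natrD; ring.
Qed.

(* The representation of osp(1|2) induced from a representation of its Borel
   subalgebra, on which h and x_a act by eta and xi: the vector of value w at d
   (and 0 elsewhere) is x_{-a} ^ d (w). Infinite sums of such vectors are
   allowed. *)
Section Induced.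
Variables (K : comNzRingType) (W : lmodType K) (eta xi : lend W).
Local Notation V := (nat -> W).

Program Definition indY := @Lend K V (fun v d => if d is d'.+1 then v d' else 0) _.
Next Obligation. by apply/funext => -[|d] //=; rewrite !fctE scaler0 addr0. Qed.

Program Definition indH := @Lend K V (fun v d => eta (v d) + d%:R *: v d) _.
Next Obligation.
apply/funext => d; rewrite !fctE lend_linear !scalerDr !scalerA [_ * a]mulrC.
by rewrite addrACA.
Qed.

Program Definition indX := @Lend K V (fun v d =>
  phorner eta (kap d.+1) (v d.+1) + (-1) ^+ d *: xi (v d)) _.
Next Obligation.
apply/funext => d; rewrite !fctE !lend_linear !scalerDr !scalerA [_ * a]mulrC.
by rewrite addrACA.
Qed.

(** The sign is the Koszul sign of an operator of parity [e] passing x_{-a} ^ d. *)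
Program Definition indlift (e : bool) (f : lend W) :=
  @Lend K V (fun v d => (-1) ^+ (e * d) *: f (v d)) _.
Next Obligation.
by apply/funext => d; rewrite !fctE lend_linear scalerDr !scalerA mulrC.
Qed.

Implicit Types (f g : lend W) (A B : lend V) (v : V).

Lemma lendV (A B : lend V) : (forall v d, A v d = B v d) -> A = B.
Proof. by move=> AB; apply: lendP => v; apply/funext => d. Qed.
Lemma fun_DE A B v d : (A + B) v d = A v d + B v d. Proof. by []. Qed.
Lemma fun_NE A v d : (- A) v d = - A v d. Proof. by []. Qed.
Lemma fun_ME A B v d : (A * B) v d = A (B v) d. Proof. by []. Qed.
Lemma fun_1E v d : (1 : lend V) v d = v d. Proof. by []. Qed.
Lemma fun_signE n A v d : ((-1) ^+ n * A) v d = (-1) ^+ n *: A v d.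
Proof. by rewrite lend_signE. Qed.
Lemma indY0 v : indY v 0 = 0. Proof. by []. Qed.
Lemma indYS v d : indY v d.+1 = v d. Proof. by []. Qed.
Lemma indHE v d : indH v d = eta (v d) + d%:R *: v d. Proof. by []. Qed.
Lemma indXE v d : indX v d =
  phorner eta (kap d.+1) (v d.+1) + (-1) ^+ d *: xi (v d).
Proof. by []. Qed.
Lemma indliftE e f v d : indlift e f v d = (-1) ^+ (e * d) *: f (v d).
Proof. by []. Qed.

Lemma indliftD e f g : indlift e (f + g) = indlift e f + indlift e g.
Proof. by apply: lendV => v d; rewrite fun_DE !indliftE lendDE scalerDr. Qed.
Lemma indliftN e f : indlift e (- f) = - indlift e f.
Proof. by apply: lendV => v d; rewrite fun_NE !indliftE lendNE scalerN. Qed.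
Lemma indlift1 : indlift false 1 = 1.
Proof. by apply: lendV => v d; rewrite indliftE mul0n scale1r. Qed.
Lemma indliftM e e' f g : indlift e f * indlift e' g = indlift (e (+) e') (f * g).
Proof.
apply: lendV => v d; rewrite fun_ME !indliftE lendZ scalerA -exprD lendME.
by rewrite -mulnDl -signr_odd oddM oddD !oddb -[in RHS]signr_odd oddM !oddb.
Qed.

Lemma triple_lift x y h : osp_triple x y h ->
  osp_triple (indlift true x) (indlift true y) (indlift false h).
Proof.
case=> xy hy xh.
by split; rewrite -?indlift1 -?indliftD !indliftM ?(xy, hy, xh) /= -?(indliftN, indliftD).
Qed.

Section Supercommutation.
Variables (e : bool) (f : lend W).
Hypothesis feta : f * eta = eta * f.
Hypothesis fxi : f * xi = (-1) ^+ e * (xi * f).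

Lemma indlift_indY : indlift e f * indY = (-1) ^+ e * (indY * indlift e f).
Proof.
apply: lendV => v [|d]; rewrite fun_signE !fun_ME indliftE ?indY0 ?indYS.
  by rewrite lend0 !scaler0.
by rewrite indliftE scalerA -exprD mulnS.
Qed.

Lemma indlift_indH : indlift e f * indH = indH * indlift e f.
Proof.
apply: lendV => v d; rewrite !fun_ME indliftE !indHE indliftE lendD !lendZ -lendME feta lendME.
by rewrite scalerDr !scalerA mulrC.
Qed.

Lemma indlift_indX : indlift e f * indX = (-1) ^+ e * (indX * indlift e f).
Proof.
apply: lendV => v d; rewrite fun_signE !fun_ME indliftE !indXE !indliftE lendD !lendZ -!lendME fxi.
have -> : f * phorner eta (kap d.+1) = phorner eta (kap d.+1) * f.
  by symmetry; apply: phorner_comm_gen.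
rewrite lend_signE !scalerDr !scalerA -!exprD mulnS; congr (_ + _).
  by rewrite addnA addnn exprD -[(-1) ^+ _.*2]signr_odd odd_double mul1r.
by rewrite addnC [(_ * _ + _)%N]addnC addnA.
Qed.
End Supercommutation.

Hypothesis xieta : xi * eta = (eta + 1) * xi.

Lemma triple_ind : osp_triple indX indY indH.
Proof.
split; apply: lendV => v d.
- rewrite fun_DE fun_NE !fun_ME indHE indXE indYS.
  case: d => [|d].
    rewrite !indY0 lend0 scaler0 scale0r !addr0 subr0 /kap /=.
    by rewrite phornerD phornerX phorner0 addr0.
  have := congr1 (fun p => phorner eta p (v d.+1)) (kap_add K d.+1).
  rewrite /= !phornerD phornerX phorner_nat !lendDE -kcst_nat lend_kcstE => <-.
  by rewrite exprS mulN1r scaleNr opprD addrA addrK.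
- rewrite !fun_ME; case: d => [|d]; rewrite !indHE ?indY0 ?indYS ?lend0 ?scaler0 ?addr0 //.
  by rewrite fun_DE fun_1E indHE -[d.+1%:R]natr1 scalerDl scale1r addrA.
- rewrite !fun_ME fun_DE fun_1E !indHE !indXE !indHE !lendD !lendZ -!lendME xieta.
  rewrite phorner_id -[d.+1%:R]natr1 mulrDl mul1r lendDE !scalerDr !scalerDl !scale1r !scalerA [_ * d%:R]mulrC.
  nc_ring.
Qed.

Lemma super_lift x y h : osp_triple x y h -> 
  x * eta = eta * x -> y * eta = eta * y -> h * eta = eta * h ->
  x * xi = - (xi * x) -> y * xi = - (xi * y) -> h * xi = xi * h ->
  super_commute (indlift true x) (indlift true y) (indlift false h) indX indY indH.
Proof.
move=> xyh xe ye he xx yx hx; split; split;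
  rewrite ?(indlift_indX, indlift_indY, indlift_indH) ?(expr0, expr1) ?(mul1r, mulN1r) //.
Qed.
End Induced.

(* The G-module U / (U g_+ + U (H - lam)): the value of v at d, a, c is the
   coefficient p(h) of x_{-a,2} ^ d x_{-a,1} ^ a p(h_1) x_{a,1} ^ c. Here
   x_{a,2} and h_2 act on the cyclic vector as - x_{a,1} and lam - h_1, that
   is, on U(osp(1|2)) x 1 as right multiplications. *)
Section Model.
Variables (K : numFieldType) (lam : K).

Local Notation W0 := (nat -> {poly K}).
Local Notation W1 := (nat -> W0).
Local Notation W2 := (nat -> W1).

Program Definition eta0 := @Lend K W0 (fun v c => 'X * v c) _.
Next Obligation. by apply/funext => c; rewrite !fctE mulrDr scalerAr. Qed.
Program Definition xi0 := @Lend K W0 (fun v c =>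
  if c is c'.+1 then v c' \Po ('X + 1) else 0) _.
Next Obligation.
by apply/funext => -[|c]; rewrite !fctE ?scaler0 ?addr0 // comp_polyD comp_polyZ.
Qed.
(** Right multiplication by lam - h1: moving h1 to the left of x1 ^ c turns it into h1 + c. *)
Program Definition rh := @Lend K W0 (fun v c => (lam%:P - 'X - c%:R) * v c) _.
Next Obligation. by apply/funext => c; rewrite !fctE mulrDr scalerAr. Qed.
(** Right multiplication by - x1: the sign combines this -1 with the (-1) ^ (c - 1) of x_{a,2}
    passing c - 1 odd factors. *)
Program Definition rx := @Lend K W0 (fun v c =>
  if c is c'.+1 then (-1) ^+ c *: v c' else 0) _.
Next Obligation.
apply/funext => -[|c]; rewrite !fctE ?scaler0 ?addr0 // scalerDr !scalerA.
by rewrite [_ * a]mulrC.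
Qed.

Lemma xi0_eta0 : xi0 * eta0 = (eta0 + 1) * xi0.
Proof.
apply: lendV => v [|c]; rewrite mulrDl mul1r fun_DE !fun_ME /= ?mulr0 ?addr0 //.
by rewrite comp_polyM comp_polyX mulrDl mul1r.
Qed.
Lemma rx_rh : rx * rh = (rh + 1) * rx.
Proof.
apply: lendV => v [|c]; rewrite mulrDl mul1r fun_DE !fun_ME /= ?mulr0 ?addr0 //.
rewrite -!mul_polyC -natr1; ring.
Qed.
Lemma rh_eta0 : rh * eta0 = eta0 * rh.
Proof. by apply: lendV => v c; rewrite !fun_ME /= mulrCA. Qed.
Lemma rx_eta0 : rx * eta0 = eta0 * rx.
Proof. by apply: lendV => v [|c]; rewrite !fun_ME /= ?mulr0 // scalerAr. Qed.
Lemma rh_xi0 : rh * xi0 = xi0 * rh.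
Proof.
apply: lendV => v [|c]; rewrite !fun_ME /= ?mulr0 // comp_polyM; congr (_ * _).
rewrite !comp_polyB comp_polyC comp_polyX -!polyC_natr comp_polyC -natr1 polyCD; ring.
Qed.
Lemma rx_xi0 : rx * xi0 = - (xi0 * rx).
Proof.
apply: lendV => v [|[|c]]; rewrite fun_NE !fun_ME /= ?comp_poly0 ?scaler0 ?oppr0 //.
by rewrite comp_polyZ [in LHS]exprS mulN1r scaleNr.
Qed.

Definition eta1 : lend W1 := indlift false rh.
Definition xi1 : lend W1 := indlift true rx.
Local Notation Y1 := (indY W0).
Local Notation H1 := (indH eta0).
Local Notation X1 := (indX eta0 xi0).

Lemma xi1_eta1 : xi1 * eta1 = (eta1 + 1) * xi1.
Proof. by rewrite -indlift1 -indliftD !indliftM rx_rh. Qed.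

Definition mY1 : lend W2 := indlift true Y1.
Definition mH1 : lend W2 := indlift false H1.
Definition mX1 : lend W2 := indlift true X1.
Definition mY2 : lend W2 := indY W1.
Definition mH2 : lend W2 := indH eta1.
Definition mX2 : lend W2 := indX eta1 xi1.

Lemma triple_m1 : osp_triple mX1 mY1 mH1.
Proof. exact/triple_lift/triple_ind/xi0_eta0. Qed.
Lemma triple_m2 : osp_triple mX2 mY2 mH2.
Proof. exact/triple_ind/xi1_eta1. Qed.
Lemma super_m : super_commute mX1 mY1 mH1 mX2 mY2 mH2.
Proof.
have e0 : rh * xi0 = (-1) ^+ false * (xi0 * rh) by rewrite expr0 mul1r rh_xi0.
have e1 : rx * xi0 = (-1) ^+ true * (xi0 * rx) by rewrite expr1 mulN1r rx_xi0.
apply: super_lift; first exact/triple_ind/xi0_eta0.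
- by rewrite (indlift_indX rh_eta0 e0) expr0 mul1r.
- by rewrite (indlift_indY false rh) expr0 mul1r.
- by rewrite (indlift_indH false rh_eta0).
- by rewrite (indlift_indX rx_eta0 e1) expr1 mulN1r opprK.
- by rewrite (indlift_indY true rx) expr1 mulN1r opprK.
- by rewrite (indlift_indH true rx_eta0).
Qed.

Definition wt (d a c : nat) : K := lam + d%:R + a%:R - c%:R.

(** The variable of h1 cancels against the one in lam - h1. So H acts by scalars, and elements of D
    can be inverted, although h1 itself acts through a free variable. *)
Lemma m_weight v d a c : (mH1 + mH2) v d a c = wt d a c *: v d a c.
Proof.
have -> : (mH1 + mH2) v d a c =
    (-1) ^+ (false * d) *: ('X * v d a c + a%:R *: v d a c) +
    ((-1) ^+ (false * a) *: ((lam%:P - 'X - c%:R) * v d a c) + d%:R *: v d a c).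
  by [].
rewrite !mul0n expr0 !scale1r -!mul_polyC -!polyC_natr /wt polyCB !polyCD; ring.
Qed.

Lemma phorner_weight p v d a c :
  phorner (mH1 + mH2) p v d a c = p.[wt d a c] *: v d a c.
Proof.
elim/poly_ind: p v => [|p k IH] v; first by rewrite phorner0 horner0 scale0r.
rewrite phornerD phornerMX phornerC hornerMXaddC scalerDl -scalerA -m_weight -IH.
by [].
Qed.

Hypothesis lam_nint : forall m : int, lam != m%:~R.

Lemma horner_wt_neq0 (p : {poly K}) d a c : D p -> p.[wt d a c] != 0.
Proof.
case=> s ->; rewrite horner_prod prodf_seq_neq0; apply/allP => n _ /=.
rewrite hornerXsubC subr_eq0 /wt; apply: contra_neq (lam_nint (n - d%:Z - a%:Z + c%:Z)).
by move=> e; rewrite !(rmorphD, rmorphB, rmorphN) /= -e -!pmulrn; ring.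
Qed.

Program Definition mDinv (p : {poly K}) := @Lend K W2
  (fun v d a c => (p.[wt d a c])^-1 *: v d a c) _.
Next Obligation.
apply/funext => d; apply/funext => a'; apply/funext => c; rewrite !fctE scalerDr !scalerA.
by rewrite [_^-1 * a]mulrC.
Qed.

Lemma m_D_inv (p : {poly K}) : D p ->
  {b : lend W2 | b * phorner (mH1 + mH2) p = 1 /\ phorner (mH1 + mH2) p * b = 1}.
Proof.
move=> Dp; exists (mDinv p); split; apply: lendP => v;
  apply/funext => d; apply/funext => a; apply/funext => c.
  by rewrite lendME /= phorner_weight scalerA mulVf ?scale1r // horner_wt_neq0.
by rewrite lendME phorner_weight /= scalerA divff ?scale1r // horner_wt_neq0.
Qed.

Definition rho : U K -> lend W2 := U_map triple_m1 triple_m2 super_m m_D_inv.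

Lemma rhoD : {morph rho : u v / u + v}. Proof. exact: U_mapD. Qed.
Lemma rhoM : {morph rho : u v / u * v}. Proof. exact: U_mapM. Qed.
Lemma rho_cst a : rho (kcst a) = kcst a. Proof. exact: U_map_cst. Qed.

Lemma rho_eL k : (k < 5)%N ->
  rho (eL (osp_basis K k)) = osp_image mX1 mY1 mH1 k.
Proof. by move=> k5; rewrite /rho /eL U_map_in /gosp_map /= osp_map0 addr0 osp_map_basis. Qed.
Lemma rho_eR k : (k < 5)%N ->
  rho (eR (osp_basis K k)) = osp_image mX2 mY2 mH2 k.
Proof. by move=> k5; rewrite /rho /eR U_map_in /gosp_map /= osp_map0 add0r osp_map_basis. Qed.
Lemma rho_polyH p v d a c :
  rho (loc_in (@D_UG K) (polyH p)) v d a c = p.[wt d a c] *: v d a c.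
Proof. by rewrite /rho U_map_polyH phorner_weight. Qed.
Lemma rhoX u n : rho (u ^+ n) = rho u ^+ n.
Proof.
elim: n => [|n IH]; last by rewrite !exprS rhoM IH.
by rewrite !expr0 -(kcst1 (K := K)) rho_cst kcst1.
Qed.
Lemma rho0 : rho 0 = 0. Proof. by rewrite -(kcst0 (K := K)) rho_cst kcst0. Qed.
Lemma rho_phorner u p : rho (phorner u p) = phorner (rho u) p.
Proof.
rewrite /phorner (big_morph rho rhoD rho0); apply: eq_bigr => i _.
by rewrite rhoM rho_cst rhoX.
Qed.

End Model.

(** * Coefficient functionals vanishing on J *)

Section Functionals.
Variables (K : numFieldType) (lam : K).
Hypothesis lam_nint : forall m : int, lam != m%:~R.

Local Notation W1 := (nat -> nat -> {poly K}).
Local Notation W2 := (nat -> W1).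
Local Notation rho := (@rho K lam lam_nint).
Local Notation mY1 := (mY1 K).
Local Notation mX1 := (mX1 K).
Local Notation mH1 := (mH1 K).
Local Notation mY2 := (mY2 K).

Definition bvec (a : nat) (p : {poly K}) (c : nat) : W2 := fun d a' c' =>
  if [&& d == 0, a' == a & c' == c] then p else 0.

Lemma mY1_bvec a p c : mY1 (bvec a p c) = bvec a.+1 p c.
Proof.
apply/funext => d; apply/funext => a'; apply/funext => c'; rewrite /bvec.
have -> : mY1 (bvec a p c) d a' c' = (-1) ^+ (true * d) *:
  (if a' is a''.+1 then bvec a p c d a'' c' else 0) by case: a'.
case: a' => [|a'] /=; first by rewrite scaler0 andbF.
by rewrite /bvec eqSS; case: eqVneq => [->|]; rewrite ?muln0 ?expr0 ?scale1r //= scaler0.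
Qed.

Lemma mH1_bvec p c : mH1 (bvec 0 p c) = bvec 0 ('X * p) c.
Proof.
apply/funext => d; apply/funext => a'; apply/funext => c'; rewrite /bvec.
have -> : mH1 (bvec 0 p c) d a' c' = (-1) ^+ (false * d) *:
  ('X * bvec 0 p c d a' c' + a'%:R *: bvec 0 p c d a' c') by [].
rewrite mul0n expr0 scale1r /bvec; case: ifP => [|_]; last by rewrite mulr0 scaler0 addr0.
by case/and3P=> _ /eqP-> _; rewrite scale0r addr0.
Qed.

Lemma phorner_mH1_bvec p c : phorner mH1 p (bvec 0 1 c) = bvec 0 p c.
Proof.
elim/poly_ind: p => [|p k IH].
  rewrite phorner0; apply/funext => d; apply/funext => a'; apply/funext => c'.
  by rewrite /bvec if_same.
rewrite phornerD phornerMX phornerC -phorner_id lendDE lendME IH mH1_bvec.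
rewrite lend_kcstE; apply/funext => d; apply/funext => a'; apply/funext => c'.
rewrite !fctE /bvec; case: ifP => _; last by rewrite scaler0 addr0.
by rewrite mulrC -mul_polyC mulr1.
Qed.

Lemma mX1_bvec c : mX1 (bvec 0 1 c) = bvec 0 1 c.+1.
Proof.
apply/funext => d; apply/funext => a'; apply/funext => c'.
have -> : mX1 (bvec 0 1 c) d a' c' = (-1) ^+ (true * d) *:
  (phorner (eta0 K) (kap a'.+1) (bvec 0 1 c d a'.+1) c' +
   (-1) ^+ a' *: (if c' is c''.+1 then bvec 0 1 c d a' c'' \Po ('X + 1) else 0)).
  by case: c'.
have -> : phorner (eta0 K) (kap a'.+1) (bvec 0 1 c d a'.+1) c' = 0.
  rewrite (_ : bvec _ _ _ _ _ = 0) ?lend0 //.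
  by apply/funext => c''; rewrite /bvec /= andbF.
rewrite add0r.
case: c' => [|c']; first by rewrite !scaler0 /bvec /= !andbF.
rewrite /bvec eqSS; case: ifP => [/and3P[/eqP-> /eqP-> _]|_].
  by rewrite comp_polyC muln0 !expr0 !scale1r.
by rewrite comp_poly0 !scaler0.
Qed.

Lemma mX2_bvec0 : mX2 lam (bvec 0 1 0) = - bvec 0 1 1.
Proof.
apply/funext => d; rewrite /mX2 indXE (_ : bvec _ _ _ _.+1 = 0) // lend0 add0r.
apply/funext => a'; apply/funext => c'.
have -> : (- bvec 0 1 1) d a' c' = - bvec 0 1 1 d a' c' by [].
have -> : ((-1) ^+ d *: xi1 K (bvec 0 1 0 d)) a' c' =
  (-1) ^+ d *: ((-1) ^+ (true * a') *:
     (if c' is c''.+1 then (-1) ^+ c' *: bvec 0 1 0 d a' c'' else 0)).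
  by case: c'.
case: c' => [|c']; first by rewrite !scaler0 /bvec /= !andbF oppr0.
rewrite /bvec eqSS; case: ifP => [/and3P[/eqP-> /eqP-> /eqP->]|_].
  by rewrite muln0 !expr0 !scale1r expr1 scaleN1r.
by rewrite !scaler0 oppr0.
Qed.

Lemma X_bvec0 : (mX1 + mX2 lam) (bvec 0 1 0) = 0.
Proof. by rewrite lendDE mX1_bvec mX2_bvec0 subrr. Qed.

(** Modulo the image of y, a leading x_{-a,2} may be replaced by - x_{-a,1}, which then passes the
    remaining x_{-a,2} ^ d' with sign (-1) ^ d'. *)
Fixpoint coinv_sign (d : nat) : K :=
  if d is d'.+1 then - ((-1) ^+ d' * coinv_sign d') else 1.

(* Coefficients modulo the image of x_{-a,1} + x_{-a,2}, by which
   x_{-a,2} ^ d x_{-a,1} ^ a is congruent to coinv_sign d * x_{-a,1} ^ (a + d). *)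
Definition ell (a c : nat) (v : W2) : {poly K} :=
  \sum_(d < a.+1) coinv_sign d *: v d (a - d)%N c.

Lemma ellD a c v w : ell a c (v + w) = ell a c v + ell a c w.
Proof. by rewrite /ell -big_split; apply: eq_bigr => d _; rewrite /= !fctE scalerDr. Qed.
Lemma ell0 a c : ell a c 0 = 0.
Proof. by rewrite /ell big1 // => d _; rewrite scaler0. Qed.

(** The sum telescopes: the [mY1] part at d cancels against the [mY2] part at d + 1. *)
Lemma ell_ker a c v : ell a c ((mY1 + mY2) v) = 0.
Proof.
rewrite /ell.
have E d a' : (mY1 + mY2) v d a' c = (-1) ^+ (true * d) *: (if a' is a''.+1 then v d a'' c else 0) +
  (if d is d'.+1 then v d' a' c else 0).
  by case: a' d => [|a'] [|d].
under eq_bigr do rewrite E mul1n scalerDr.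
rewrite big_split /= big_ord_recr /= subnn !scaler0 addr0.
rewrite [X in _ + X]big_ord_recl /= scaler0 add0r -big_split big1 // => d _ /=.
rewrite !add0n /bump leq0n add1n; have -> : (a - d = (a - d.+1).+1)%N by have := ltn_ord d; lia.
by rewrite scalerA mulrC scaleNr subrr.
Qed.

Lemma ell_bvec a c a' p c' :
  ell a c (bvec a' p c') = if (a == a') && (c == c') then p else 0.
Proof.
rewrite /ell big_ord_recl subn0 scale1r big1 ?addr0 => [|d _]; first by rewrite /bvec.
by rewrite /bvec /= scaler0.
Qed.

Definition pbw (a : nat) (p : {poly K}) (c : nat) : U K :=
  eL xm1 ^+ a * phorner (eL xh) p * eL xp1 ^+ c.

Lemma rho_mon a p c : rho (pbw a p c) (bvec 0 1 0) = bvec a p c.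
Proof.
rewrite /pbw !rhoM !rhoX rho_phorner.
have -> : rho (eL xm1) = mY1 := rho_eL lam_nint (isT : (1 < 5)%N).
have -> : rho (eL xh) = mH1 := rho_eL lam_nint (isT : (2 < 5)%N).
have -> : rho (eL xp1) = mX1 := rho_eL lam_nint (isT : (3 < 5)%N).
rewrite !lendME.
have -> : forall n, (mX1 ^+ n) (bvec 0 1 0) = bvec 0 1 n.
  by elim=> [|n IH]; rewrite ?expr0 // exprS lendME IH mX1_bvec.
rewrite phorner_mH1_bvec.
by elim: a => [|a IH]; rewrite ?expr0 // exprS lendME IH mY1_bvec.
Qed.

Lemma rho_Xxm1 : rho (X_ xm1) = mY1 + mY2.
Proof. by rewrite X_E rhoD (rho_eL lam_nint (isT : (1 < 5)%N)) // (rho_eR lam_nint (isT : (1 < 5)%N)). Qed.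
Lemma rho_Xxp1 : rho (X_ xp1) = mX1 + mX2 lam.
Proof. by rewrite X_E rhoD (rho_eL lam_nint (isT : (3 < 5)%N)) // (rho_eR lam_nint (isT : (3 < 5)%N)). Qed.

Definition coinv_coef (a c : nat) (u : U K) : {poly K} :=
  ell a c (rho u (bvec 0 1 0)).

Lemma coinv_coefD a c u v : coinv_coef a c (u + v) = coinv_coef a c u + coinv_coef a c v.
Proof. by rewrite /coinv_coef rhoD lendDE ellD. Qed.

Lemma coinv_coef0 a c : coinv_coef a c 0 = 0.
Proof. by rewrite /coinv_coef rho0 lend0E ell0. Qed.

(** Since X_{-2a} = y ^ 2 and X_{2a} = - x ^ 2, an element of J is in y U + U x; [ell] kills the
    image of y, and x kills the cyclic vector [bvec 0 1 0]. *)
Lemma coinv_coef_J a c u : u \in @J K -> coinv_coef a c u = 0.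
Proof.
move=> /asboolP[e [f [g [k ->]]]]; rewrite X_xm2 X_xp2 !coinv_coefD /coinv_coef.
rewrite !expr2 mulrN -mulNr mulrA -[_ * _ * f]mulrA !rhoM !lendME.
by rewrite rho_Xxm1 rho_Xxp1 !ell_ker X_bvec0 !lend0 ell0 !addr0.
Qed.

Lemma coinv_coef_pbw a c (p : {poly K}) a' q c' :
  coinv_coef a c (loc_in (@D_UG K) (polyH p) * pbw a' q c') =
  if (a == a') && (c == c') then p.[lam + a'%:R - c'%:R] *: q else 0.
Proof.
rewrite /coinv_coef rhoM lendME rho_mon -ell_bvec; congr ell.
apply/funext => d; apply/funext => b; apply/funext => e; rewrite rho_polyH /bvec.
case: ifP => [/and3P[/eqP-> /eqP-> /eqP->]|_]; last by rewrite scaler0.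
by rewrite /wt addr0.
Qed.
End Functionals.

(** * Linear independence of the monomials *)

Section Fractions.
Variable K : numFieldType.
Local Notation lin := (loc_in (@D K)).

Lemma D_1 : D (1 : {poly K}).
Proof. by exists [::]; rewrite big_nil. Qed.
Lemma D_M (p q : {poly K}) : D p -> D q -> D (p * q).
Proof. by case=> s -> [t ->]; exists (s ++ t); rewrite big_cat. Qed.

Lemma lin_comm (p q : {poly K}) : lin p * lin q = lin q * lin p.
Proof. by rewrite -!loc_inM [p * q](@mulrC {poly K}). Qed.

Lemma Uh_loc_frac (f : Uh_loc K) : exists d p, D d /\ lin d * f = lin p.
Proof.
elim/pclsP: f; elim=> [a|[p|d]|e [d [p [Dd ep]]] f [d' [p' [Dd' fp]]]|e [d [p [Dd ep]]] f [d' [p' [Dd' fp]]]].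
- by exists 1, a%:P; split; [exact: D_1|rewrite loc_in1 mul1r loc_in_cst].
- by exists 1, p; split; [exact: D_1|rewrite loc_in1 mul1r].
- exists (sval d), 1; split; [exact: svalP|].
  by rewrite loc_in1 -(loc_invr d).
- exists (d * d'), (d' * p + d * p'); split; first exact: D_M.
  rewrite pclsD mulrDr loc_inD {1}[d * d']mulrC !loc_inM -mulrA ep -mulrA fp //.
- exists (d' * d), (p * p'); split; first exact: D_M.
  by rewrite pclsM !loc_inM mulrA -[_ * _ * pcls _ e]mulrA ep (lin_comm d' p) -mulrA fp.
Qed.

Lemma loc_in_D_inj (d : {poly K}) (f g : Uh_loc K) : D d -> lin d * f = lin d * g -> f = g.
Proof.
move=> Dd e; rewrite -[f]mul1r -[g]mul1r -(loc_invl (exist _ d Dd)) -!mulrA.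
by rewrite [sval _]/= e.
Qed.

Lemma Uh_loc_common (s : seq (Uh_loc K)) :
  exists2 d, D d & forall f, f \in s -> exists p, lin d * f = lin p.
Proof.
elim: s => [|g s [d Dd ds]]; first by exists 1; first exact: D_1.
have [d' [p [Dd' gp]]] := Uh_loc_frac g.
exists (d * d'); first exact: D_M.
move=> f; rewrite inE => /orP[/eqP->|/ds[q fq]].
  by exists (d * p); rewrite !loc_inM -mulrA gp.
by exists (d' * q); rewrite mulrC !loc_inM -mulrA fq.
Qed.

(** Supplies infinitely many admissible values of lam. *)
Lemma half_notin_int (n : nat) (m : int) : n%:R + 2^-1 != m%:~R :> K.
Proof.
apply/eqP => /(congr1 (fun z => 2 * z)); rewrite mulrDr divff ?pnatr_eq0 //.
rewrite -[1]/(1%:R) -natrM -natrD -[LHS]mulrz_nat -[2]/(2%:~R) -intrM => /eqP.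
rewrite eqr_int => /eqP; lia.
Qed.

Lemma poly_half_eq0 (p : {poly K}) (k : K) :
  (forall n, p.[n%:R + 2^-1 + k] = 0) -> p = 0.
Proof.
move=> p0; pose s := [seq (i%:R + 2^-1 + k : K) | i <- iota 0 (size p)].
apply: (@roots_geq_poly_eq0 _ p s).
- by apply/allP => _ /mapP[i _ ->]; apply/rootP.
- rewrite map_inj_uniq ?iota_uniq // => i j /addIr/addIr/eqP.
  by rewrite eqr_nat => /eqP.
- by rewrite size_map size_iota.
Qed.

End Fractions.

Section Independence.
Variable K : numFieldType.
Local Notation lin := (loc_in (@D K)).
Local Notation tri := (nat * nat * nat)%type.

Definition pbw_class (t : tri) : UJ K := toUJ (pbw t.1.1 'X^(t.1.2) t.2).
Definition comb (l : seq (Uh_loc K * tri)) : UJ K := \sum_(x <- l) x.1 *: pbw_class x.2.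
Definition coef (l : seq (Uh_loc K * tri)) (t : tri) : Uh_loc K :=
  \sum_(x <- l | x.2 == t) x.1.

Lemma toUJ0 : toUJ 0 = 0 :> UJ K.
Proof. by apply: (addIr (toUJ 0)); rewrite -toUJD !add0r. Qed.
Lemma toUJ_eq0 (u : U K) : toUJ u = 0 <-> u \in @J K.
Proof.
by rewrite -[u in u \in _]subr0 Quotient.idealrBE -toUJ0; split=> /eqP.
Qed.

Lemma scale_toUJ (f : Uh_loc K) u : f *: toUJ u = toUJ (atH f * u).
Proof. exact: UJ_scaleE. Qed.

Lemma atH_in p : atH (lin p) = loc_in (@D_UG K) (polyH p).
Proof. exact: plift_gen (@Uh_gen_rel K) _. Qed.

(** Denominators are cleared by a common d. For t = (a, b, c) and lam = n + 1/2, the functional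
    [coinv_coef] at (a, c) kills the relation, and the coefficient of X ^ b in the result is the
    value at lam + a - c of the numerator of [coef l t]. As n varies, this polynomial has infinitely
    many zeros. *)
Lemma pbw_class_free l t : comb l = 0 -> coef l t = 0.
Proof.
move=> l0; have [d Dd dl] := Uh_loc_common (map fst l).
have /choice[pf pfP] : forall f : Uh_loc K, exists p, f \in map fst l -> lin d * f = lin p.
  by move=> f; have [/dl[p]|] := boolP (f \in _); [exists p|exists 0].
apply: (loc_in_D_inj Dd); rewrite mulr0 mulr_sumr big_seq_cond.
under eq_bigr => x /andP[xl _] do rewrite pfP ?map_f//.
rewrite -big_seq_cond -(big_morph _ (loc_inD _) (loc_in0 _)) (_ : \sum_(x <- l | _) _ = 0) ?loc_in0 //.
case: t => -[a b] c.
apply: (@poly_half_eq0 _ _ (a%:R - c%:R)) => n.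
have lamP := half_notin_int K n.
have : toUJ (\sum_(x <- l) loc_in (@D_UG K) (polyH (pf x.1)) * pbw x.2.1.1 'X^(x.2.1.2) x.2.2) = 0.
  transitivity (lin d *: comb l); last by rewrite l0 scaler0.
  rewrite (big_morph _ (@toUJD K) toUJ0) scaler_sumr.
  rewrite !big_seq; apply: eq_bigr => x xl.
  by rewrite scalerA pfP ?map_f // scale_toUJ atH_in.
move=> /toUJ_eq0/(coinv_coef_J lamP a c).
rewrite (big_morph _ (coinv_coefD lamP a c) (coinv_coef0 lamP a c)).
under eq_bigr do rewrite coinv_coef_pbw.
move=> /(congr1 (fun p : {poly K} => p`_b)); rewrite coef0 coef_sum => <-.
rewrite horner_sum big_mkcond; apply: eq_bigr => -[f [[a' b'] c']] _ /=.
rewrite !xpair_eqE [a == _]eq_sym [c == _]eq_sym andbAC.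
case: (boolP ((a' == a) && (c' == c))) => [/andP[/eqP-> /eqP->]|_] /=; last by rewrite coef0.
rewrite coefZ coefXn [b == _]eq_sym; case: eqP => _; rewrite ?mulr1 ?mulr0 //.
by rewrite addrA.
Qed.
End Independence.

(** * Straightening in U *)

Section Weights.
Variable K : numFieldType.
Local Notation y1 := (eL (xm1 : osp K)).
Local Notation h1 := (eL (xh : osp K)).
Local Notation x1 := (eL (xp1 : osp K)).
Local Notation y2 := (eR (xm1 : osp K)).
Local Notation x2 := (eR (xp1 : osp K)).
Local Notation y := (X_ (xm1 : osp K)).
Local Notation H := (X_ (xh : osp K)).
Local Notation x := (X_ (xp1 : osp K)).

Definition shift_gen (w : int) (z : {poly K} + {d : {poly K} | D d}) : Uh_loc K :=
  match z with
  | inl p => loc_in (@D K) (p \Po ('X + w%:~R%:P))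
  | inr d => loc_inv (exist _ _ (D_shift w (svalP d)))
  end.

Lemma shift_gen_rel w e f : loc_rel e f ->
  peval (shift_gen w) e = peval (shift_gen w) f.
Proof.
case=> /=.
- by move=> a; rewrite comp_polyC loc_in_cst.
- by move=> p q; rewrite comp_polyD loc_inD.
- by move=> p q; rewrite comp_polyM loc_inM.
- by move=> d; rewrite kcst1 (loc_invl (exist _ _ (D_shift w (svalP d)))).
- by move=> d; rewrite kcst1 (loc_invr (exist _ _ (D_shift w (svalP d)))).
Qed.

(* f(H) |-> f(H + w) *)
Definition shift (w : int) (f : Uh_loc K) : Uh_loc K := plift (shift_gen w) f.

Lemma shiftD w : {morph shift w : f g / f + g}. Proof. exact: pliftD (@shift_gen_rel w). Qed.
Lemma shiftM w : {morph shift w : f g / f * g}. Proof. exact: pliftM (@shift_gen_rel w). Qed.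
Lemma shift1 w : shift w 1 = 1. Proof. exact: plift1 (@shift_gen_rel w). Qed.
Lemma shift_cst w a : shift w (kcst a) = kcst a.
Proof. exact: (plift_cst (@shift_gen_rel w) a). Qed.
Lemma shift_in w p : shift w (loc_in (@D K) p) = loc_in (@D K) (p \Po ('X + w%:~R%:P)).
Proof. exact: (plift_gen (@shift_gen_rel w) (inl p)). Qed.

Lemma atH_cst (k : K) : atH (kcst k) = kcst k.
Proof. exact: (plift_cst (@Uh_gen_rel K) k). Qed.
Lemma atH_phorner p : atH (loc_in (@D K) p) = phorner H p.
Proof. by rewrite atH_in atH_polyE. Qed.
Lemma atH0 : atH (0 : Uh_loc K) = 0.
Proof. by rewrite -(kcst0 (K := K)) atH_cst kcst0. Qed.

(** The sign is that of - ad H, which gives x_a weight 1 and x_{-a} weight -1. *)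
Definition has_wt (w : int) (z : U K) := z * H = (H + kcst w%:~R) * z.

Lemma has_wt_atH w z (f : Uh_loc K) : has_wt w z -> z * atH f = atH (shift w f) * z.
Proof.
move=> zw; elim/pclsP: f => e.
rewrite /atH /shift !plift_cls; [|exact: shift_gen_rel|exact: Uh_gen_rel].
elim: e => [a|[p|d]|e eg f fg|e eg f fg]; rewrite /= -/(atH _).
- by rewrite atH_cst kcstC.
- by rewrite -atH_in !atH_phorner (phorner_shiftr _ zw).
- set i := exist _ _ _; set i' := exist _ _ _.
  have Fd : atH (loc_inv i') * phorner H (sval i') = 1.
    by rewrite -atH_phorner -atHM loc_invl atH1.
  have := phorner_shiftr (sval d) zw; rewrite -[_ \Po _]/(sval i') => dz.
  rewrite -[LHS]mul1r -Fd -!mulrA [phorner _ _ * _]mulrA -dz -mulrA.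
  by rewrite -atH_phorner atH_in (loc_invr i) mulr1.
- by rewrite mulrDr eg fg atHD mulrDl.
- by rewrite mulrA eg -mulrA fg mulrA -atHM.
Qed.

Lemma has_wtM v w z z' : has_wt v z -> has_wt w z' -> has_wt (v + w) (z * z').
Proof.
rewrite /has_wt => zv zw; rewrite -mulrA zw mulrA mulrDr zv intrD kcstD -kcstC; nc_ring.
Qed.

Lemma has_wt1 : has_wt 0 1.
Proof. by rewrite /has_wt kcst0 addr0 mulr1 mul1r. Qed.

Lemma has_wtX w z n : has_wt w z -> has_wt (w *+ n) (z ^+ n).
Proof.
move=> zw; elim: n => [|n IH]; first by rewrite mulr0n expr0; exact: has_wt1.
by rewrite mulrS exprS; exact: has_wtM.
Qed.

Lemma has_wtD w u v : has_wt w u -> has_wt w v -> has_wt w (u + v).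
Proof. by rewrite /has_wt => uw vw; rewrite mulrDl uw vw mulrDr. Qed.

Lemma wt_y1 : has_wt (-1) y1.
Proof.
have [_ hy _] := triple_eL K; have [_ [_ _ yh] _] := super_eLR K.
rewrite /has_wt X_E mulrDr yh mulrNz kcstN kcst1 !mulrDl hy; nc_ring.
Qed.
Lemma wt_x1 : has_wt 1 x1.
Proof.
have [_ _ xh] := triple_eL K; have [[_ _ xh2] _ _] := super_eLR K.
rewrite /has_wt X_E mulrDr xh2 kcst1 !mulrDl xh; nc_ring.
Qed.
Lemma wt_h1 : has_wt 0 h1.
Proof.
have [_ _ [_ _ hh]] := super_eLR K.
by rewrite /has_wt X_E mulrDr hh kcst0 addr0 mulrDl.
Qed.
Lemma wt_y2 : has_wt (-1) y2.
Proof.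
have [_ hy _] := triple_eR K; have [_ _ [_ hy2 _]] := super_eLR K.
rewrite /has_wt X_E mulrDr -hy2 mulrNz kcstN kcst1 !mulrDl hy; nc_ring.
Qed.
Lemma wt_x2 : has_wt 1 x2.
Proof.
have [_ _ xh] := triple_eR K; have [_ _ [hx _ _]] := super_eLR K.
rewrite /has_wt X_E mulrDr -hx kcst1 !mulrDl xh; nc_ring.
Qed.
Lemma wt_y : has_wt (-1) y.
Proof. by rewrite X_E; apply: has_wtD; [exact: wt_y1|exact: wt_y2]. Qed.
Lemma wt_x : has_wt 1 x.
Proof. by rewrite X_E; apply: has_wtD; [exact: wt_x1|exact: wt_x2]. Qed.

Lemma wt_phorner p : has_wt 0 (phorner h1 p).
Proof.
rewrite /has_wt kcst0 addr0; apply: phorner_comm_gen.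
by have := wt_h1; rewrite /has_wt kcst0 addr0.
Qed.

Lemma wt_mon a p c : has_wt (c%:Z - a%:Z) (pbw a p c).
Proof.
have := has_wtM (has_wtM (has_wtX a wt_y1) (wt_phorner p)) (has_wtX c wt_x1).
by rewrite addr0 mulNrn addrC !natz.
Qed.

Lemma shiftK w : cancel (shift (- w)) (shift w).
Proof.
move=> f; have [d [p [Dd fp]]] := Uh_loc_frac f.
have lK q : shift w (shift (- w) (loc_in (@D K) q)) = loc_in (@D K) q.
  rewrite !shift_in -comp_polyA comp_polyD comp_polyX comp_polyC.
  by rewrite -addrA -polyCD mulrNz subrr polyC0 addr0 comp_polyXr.
by apply: (loc_in_D_inj Dd); rewrite fp -[in LHS]lK -!shiftM fp lK.
Qed.

Lemma atH_has_wt w z (f : Uh_loc K) : has_wt w z -> atH f * z = z * atH (shift (- w) f).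
Proof. by move=> zw; rewrite (has_wt_atH _ zw) shiftK. Qed.

Local Notation mon := (@pbw K).

Lemma mon_signl n a p c : mon a ((-1) ^+ n * p) c = (-1) ^+ n * mon a p c.
Proof. by rewrite /pbw phornerM phorner_sign !mulrA signrC. Qed.

Lemma monD a p q c : mon a (p + q) c = mon a p c + mon a q c.
Proof. by rewrite /pbw phornerD mulrDr mulrDl. Qed.

Lemma monN a p c : mon a (- p) c = - mon a p c.
Proof. by rewrite /pbw phornerN mulrN mulNr. Qed.
Lemma monB a p q c : mon a (p - q) c = mon a p c - mon a q c.
Proof. by rewrite monD monN. Qed.

Lemma y1_mon a p c : y1 * mon a p c = mon a.+1 p c.
Proof. by rewrite /pbw exprS !mulrA. Qed.
Lemma y1X_mon n a p c : y1 ^+ n * mon a p c = mon (n + a) p c.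
Proof. by rewrite /pbw exprD !mulrA. Qed.
Lemma mon_x1 a p c : mon a p c * x1 = mon a p c.+1.
Proof. by rewrite /pbw exprSr !mulrA. Qed.
Lemma mon_x1X a p c n : mon a p c * x1 ^+ n = mon a p (c + n).
Proof. by rewrite /pbw exprD !mulrA. Qed.

Lemma h1_mon a p c : h1 * mon a p c = mon a (('X + a%:R) * p) c.
Proof.
rewrite /pbw phornerM !mulrA -{1}(phornerX h1) (triple_yM (triple_eL K)).
by rewrite comp_polyX.
Qed.

Lemma x1_mon a p c : x1 * mon a p c =
  mon a.-1 (kap a * p) c + mon a ((-1) ^+ a * (p \Po ('X + 1))) c.+1.
Proof.
have T := triple_eL K.
rewrite mon_signl {1}/pbw !mulrA (triple_xyn T) !mulrDl; congr (_ + _).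
  by rewrite /pbw phornerM !mulrA.
by rewrite /pbw exprS -!mulrA [x1 * _]mulrA (triple_xh T) !mulrA.
Qed.

Lemma mon_y1 a p c : mon a p c * y1 =
  mon a (kap c * p) c.-1 + mon a.+1 ((-1) ^+ c * (p \Po ('X + 1))) c.
Proof.
have T := triple_eL K.
rewrite mon_signl {1}/pbw -!mulrA (triple_xny T) !mulrDr; congr (_ + _).
  by rewrite /pbw mulrC phornerM !mulrA.
rewrite /pbw exprSr !mulrA -[_ * (-1) ^+ c]signrC -!mulrA; do 2 congr (_ * _).
by rewrite !mulrA (triple_hy T).
Qed.

Lemma signU_comm n (u : U K) : (-1) ^+ n * u = u * (-1) ^+ n.
Proof. exact: signrC. Qed.

Definition scomm (n : nat) (u v : U K) := u * v = (-1) ^+ n * (v * u).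

Lemma scommM m n u v w : scomm m u w -> scomm n v w -> scomm (m + n) (u * v) w.
Proof.
rewrite /scomm => uw vw; rewrite -mulrA vw [u * (_ * _)]mulrA -[u * (-1) ^+ n]signU_comm -[_ * u * _]mulrA.
rewrite [u * (w * v)]mulrA uw addnC exprD.
by rewrite !mulrA.
Qed.

Lemma scomm_sym n u v : scomm n u v -> scomm n v u.
Proof. by rewrite /scomm => ->; rewrite mulrA -exprD addnn -signr_odd odd_double mul1r. Qed.

Lemma scommX n u v k : scomm n u v -> scomm (n * k) (u ^+ k) v.
Proof.
move=> uv; elim: k => [|k IH]; first by rewrite /scomm muln0 !expr0 !mul1r mulr1.
by rewrite exprS mulnS; apply: scommM.
Qed.

Lemma scomm_phorner u v (p : {poly K}) : scomm 0 u v -> scomm 0 (phorner u p) v.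
Proof. by rewrite /scomm !expr0 !mul1r => uv; apply: phorner_comm_gen. Qed.

Lemma scomm_mon n z a p c : scomm n y1 z -> scomm 0 h1 z -> scomm n x1 z ->
  scomm (n * (a + c)) (mon a p c) z.
Proof.
move=> yz hz xz; rewrite mulnDr; apply/scommM/(scommX _ xz); rewrite -[(n * a)%N]addn0.
exact: (scommM (scommX _ yz) (scomm_phorner _ hz)).
Qed.

Lemma mon_y2 a p c : mon a p c * y2 = (-1) ^+ (a + c) * (y2 * mon a p c).
Proof.
have [[_ xy _] [_ yy _] [_ hy _]] := super_eLR K.
rewrite -[(a + c)%N]mul1n; apply: scomm_mon; rewrite /scomm ?(expr1, expr0) ?(mulN1r, mul1r) //.
Qed.

Lemma x2_mon a p c : x2 * mon a p c = (-1) ^+ (a + c) * (mon a p c * x2).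
Proof.
have [[xx _ _] [yx _ _] [hx _ _]] := super_eLR K.
rewrite -[(a + c)%N]mul1n; apply/scomm_sym/scomm_mon; rewrite /scomm ?(expr1, expr0) ?(mulN1r, mul1r) //.
Qed.

(* x = x1 + x2 and x2 supercommutes with the first factor, so the supercommutator
   with x is the one with x1. *)
Lemma x_mon a p c : x * mon a p c =
  mon a.-1 (kap a * p) c
  + mon a ((-1) ^+ a * (p \Po ('X + 1) - (-1) ^+ c * p)) c.+1
  + (-1) ^+ (a + c) * (mon a p c * x).
Proof.
by rewrite X_E mulrDl x1_mon x2_mon !mon_signl monB mon_signl [mon a p c * (_ + _)]mulrDr mon_x1 exprD; nc_ring.
Qed.

Lemma mon_y a p c : mon a p c * y =
  mon a (kap c * p) c.-1
  + mon a.+1 ((-1) ^+ c * (p \Po ('X + 1) - (-1) ^+ a * p)) c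
  + (-1) ^+ (a + c) * (y * mon a p c).
Proof.
by rewrite X_E [LHS]mulrDr mon_y1 mon_y2 !mon_signl monB mon_signl [(y1 + _) * _]mulrDl y1_mon addnC exprD; nc_ring.
Qed.
End Weights.

(** * Monomials span U/J *)

Section Spanning.
Variable K : numFieldType.
Local Notation y1 := (eL (xm1 : osp K)).
Local Notation h1 := (eL (xh : osp K)).
Local Notation x1 := (eL (xp1 : osp K)).
Local Notation y2 := (eR (xm1 : osp K)).
Local Notation h2 := (eR (xh : osp K)).
Local Notation x2 := (eR (xp1 : osp K)).
Local Notation y := (X_ (xm1 : osp K)).
Local Notation H := (X_ (xh : osp K)).
Local Notation x := (X_ (xp1 : osp K)).
Local Notation mon := (@pbw K).
Implicit Types (S : nat -> nat -> nat -> bool) (u v w z : U K) (f : Uh_loc K).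

(** The predicate [S] restricts the exponents (a, b, c), so that straightening also records which
    monomials occur; triangularity is expressed by it. *)
Inductive uspan S : U K -> Prop :=
| uspan0 : uspan S 0
| uspanS f a b c u : S a b c -> uspan S u -> uspan S (atH f * mon a 'X^b c + u).

Lemma uspanD S u v : uspan S u -> uspan S v -> uspan S (u + v).
Proof.
by move=> + Sv; elim=> [|f a b c w Sabc _ IH]; rewrite ?add0r // -addrA; apply: uspanS.
Qed.

Lemma uspan_map S S' (T : U K -> U K) : T 0 = 0 -> {morph T : u v / u + v} ->
  (forall f a b c, S a b c -> uspan S' (T (atH f * mon a 'X^b c))) ->
  forall u, uspan S u -> uspan S' (T u).
Proof.
move=> T0 TD TS u; elim=> [|f a b c w Sabc _ IH]; first by rewrite T0; exact: uspan0.
by rewrite TD; apply: uspanD => //; exact: TS.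
Qed.

Lemma uspan_scale S f u : uspan S u -> uspan S (atH f * u).
Proof.
apply: (uspan_map (T := fun u => atH f * u)) => [|v w|g a b c Sabc].
- by rewrite mulr0.
- by rewrite mulrDr.
by rewrite mulrA -atHM -[_ * _]addr0; apply: uspanS => //; exact: uspan0.
Qed.

Lemma uspan_cst S k u : uspan S u -> uspan S (kcst k * u).
Proof. by rewrite -atH_cst; exact: uspan_scale. Qed.
Lemma uspanN S u : uspan S u -> uspan S (- u).
Proof. by rewrite -mulN1r -kcst1 -kcstN; exact: uspan_cst. Qed.
Lemma uspanB S u v : uspan S u -> uspan S v -> uspan S (u - v).
Proof. by move=> Su Sv; apply/uspanD/uspanN. Qed.
Lemma uspan_sign S n u : uspan S u -> uspan S ((-1) ^+ n * u).
Proof. by rewrite -kcst_sign; exact: uspan_cst. Qed.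

Lemma uspan_sum S (I : Type) (r : seq I) (P : pred I) (F : I -> U K) :
  (forall i, P i -> uspan S (F i)) -> uspan S (\sum_(i <- r | P i) F i).
Proof. move=> SF; apply: big_ind => //; [exact: uspan0|exact: uspanD]. Qed.

Lemma sub_uspan S S' u : (forall a b c, S a b c -> S' a b c) -> uspan S u -> uspan S' u.
Proof.
move=> SS'; elim=> [|f a b c v /SS' ? _ IH]; [exact: uspan0|exact: uspanS].
Qed.

Lemma uspan_mon S f a (p : {poly K}) c :
  (forall b, (b < size p)%N -> S a b c) -> uspan S (atH f * mon a p c).
Proof.
move=> Sp; apply: uspan_scale.
rewrite /pbw /phorner mulr_sumr mulr_suml; apply: uspan_sum => i _.
rewrite mulrA -kcstC -!mulrA -atH_cst -phornerXn [eL _ ^+ a * _]mulrA -[X in uspan _ X]addr0.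
by apply: uspanS; [exact: Sp|exact: uspan0].
Qed.

Lemma uspan_mon1 S a (p : {poly K}) c :
  (forall b, (b < size p)%N -> S a b c) -> uspan S (mon a p c).
Proof. by rewrite -[mon _ _ _]mul1r -(atH1 K); exact: uspan_mon. Qed.

Lemma uspan_comb S u : uspan S u -> exists2 l : seq (Uh_loc K * (nat * nat * nat)),
  all (fun t => S t.2.1.1 t.2.1.2 t.2.2) l & toUJ u = comb l.
Proof.
elim=> [|f a b c v Sabc _ [l Sl vl]]; first by exists [::]; rewrite // /comb big_nil toUJ0.
exists ((f, (a, b, c)) :: l); first by rewrite /= Sabc.
by rewrite toUJD vl /comb big_cons /pbw_class /= scale_toUJ.
Qed.

Lemma eL_sum (u : osp K) : eL u = \sum_k kcst (u 0 k) * eL (osp_basis K k).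
Proof.
rewrite {1}[u]row_sum_delta (big_morph (@eL K) (id1 := 0) (op1 := +%R)).
- by apply: eq_bigr => i _; rewrite eLZ /osp_basis inord_val.
- by move=> v w; rewrite -[v]scale1r eL_ZD scale1r kcst1 mul1r.
- exact: eL0.
Qed.
Lemma eR_sum (u : osp K) : eR u = \sum_k kcst (u 0 k) * eR (osp_basis K k).
Proof.
rewrite {1}[u]row_sum_delta (big_morph (@eR K) (id1 := 0) (op1 := +%R)).
- by apply: eq_bigr => i _; rewrite eRZ /osp_basis inord_val.
- by move=> v w; rewrite -[v]scale1r eR_ZD scale1r kcst1 mul1r.
- exact: eR0.
Qed.

Lemma U_ind (P : U K -> Prop) :
  (forall k, P (kcst k)) -> (forall u v, P u -> P v -> P (u + v)) ->
  (forall u v, P u -> P v -> P (u * v)) -> (forall f, P (atH f)) ->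
  P y1 -> P h1 -> P x1 -> P y2 -> P h2 -> P x2 -> forall u, P u.
Proof.
move=> Pk PD PM PH Py1 Ph1 Px1 Py2 Ph2 Px2.
have PN u : P u -> P (- u) by rewrite -mulN1r -kcst1 -kcstN; apply: PM.
have Psum (I : Type) (r : seq I) (F : I -> U K) : (forall i, P (F i)) -> P (\sum_(i <- r) F i).
  by move=> PF; apply: big_ind => //; rewrite -(kcst0 (K := K)).
have PL (u : osp K) : P (eL u).
  rewrite eL_sum; apply: Psum => -[[|[|[|[|[|//]]]]] k5] /=; apply: (PM _ _ (Pk _)) => //.
    by rewrite -/xm2 eL_xm2 expr2; exact: PM.
  by rewrite -/xp2 eL_xp2 expr2; exact/PN/PM.
have PR (u : osp K) : P (eR u).
  rewrite eR_sum; apply: Psum => -[[|[|[|[|[|//]]]]] k5] /=; apply: (PM _ _ (Pk _)) => //.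
    by rewrite -/xm2 eR_xm2 expr2; exact: PM.
  by rewrite -/xp2 eR_xp2 expr2; exact/PN/PM.
have PUG (g : UG K) : P (loc_in (@D_UG K) g).
  elim/pclsP: g; elim=> [k|[u v]|e Pe f Pf|e Pe f Pf].
  - by rewrite pclsC loc_in_cst.
  - rewrite -[loc_in _ _]/(U_in (u, v)) (_ : (u, v) = (u, 0) + (0, v)) ?U_inD; first exact: PD (PL u) (PR v).
    by congr pair; rewrite /= ?addr0 ?add0r.
  - by rewrite pclsD loc_inD; exact: PD.
  - by rewrite pclsM loc_inM; exact: PM.
elim/pclsP; elim=> [k|[g|s]|e Pe f Pf|e Pe f Pf].
- exact: Pk.
- exact: PUG.
- have [d Dd sd] := svalP s.
  (* A formal inverse in [U] and the image of the one in D^-1 U(h) are both inverse to d(H), hence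
     equal. *)
  suff -> : pcls (loc_rel (S:=D_UG (K:=K))) (EGen (inr s)) = atH (loc_inv (exist _ d Dd)) by [].
  rewrite -[RHS]mulr1 -(loc_invr s) sd -atH_in mulrA -atHM.
  by rewrite (loc_invl (exist _ d Dd)) atH1 mul1r.
- by rewrite pclsD; exact: PD.
- by rewrite pclsM; exact: PM.
Qed.

Local Notation uall := (uspan (fun _ _ _ => true)).

Lemma uall_mon a (p : {poly K}) c : uall (mon a p c).
Proof. exact: uspan_mon1. Qed.

Lemma uall_mul (k : int) z : has_wt k z -> (forall a b c, uall (z * mon a 'X^b c)) ->
  forall u, uall u -> uall (z * u).
Proof.
move=> zw zmon; apply: (uspan_map (T := fun u => z * u)) => [|u v|f a b c _].
- by rewrite mulr0.
- by rewrite mulrDr.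
by rewrite mulrA (has_wt_atH _ zw) -mulrA; exact: uspan_scale.
Qed.

Lemma uall_y1 u : uall u -> uall (y1 * u).
Proof. by apply: uall_mul (wt_y1 K) _ _ => a b c; rewrite y1_mon; exact: uall_mon. Qed.
Lemma uall_h1 u : uall u -> uall (h1 * u).
Proof. by apply: uall_mul (wt_h1 K) _ _ => a b c; rewrite h1_mon; exact: uall_mon. Qed.
Lemma uall_x1 u : uall u -> uall (x1 * u).
Proof.
apply: uall_mul (wt_x1 K) _ _ => a b c; rewrite x1_mon.
by apply: uspanD; exact: uall_mon.
Qed.

(* Sums of y2 ^ i * u with u in the span of the monomials of the first factor,
   modulo the left ideal U x. *)
Inductive zspan : U K -> Prop :=
| zspanx v : zspan (v * x)
| zspanS i w u : uall w -> zspan u -> zspan (y2 ^+ i * w + u).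

Lemma zspan0 : zspan 0. Proof. by rewrite -(mul0r x); exact: zspanx. Qed.
Lemma zspan1 i w : uall w -> zspan (y2 ^+ i * w).
Proof. by move=> ww; rewrite -[_ * _]addr0; apply: zspanS => //; exact: zspan0. Qed.
Lemma zspanD u v : zspan u -> zspan v -> zspan (u + v).
Proof.
elim=> [w|i w u' ww _ IH] vs; last by rewrite -addrA; apply: zspanS => //; exact: IH.
elim: vs => [w'|i w' u' ww _ IH]; first by rewrite -mulrDl; exact: zspanx.
by rewrite addrCA; exact: zspanS.
Qed.
Lemma zspan_mul z : (forall i w, uall w -> zspan (z * (y2 ^+ i * w))) ->
  forall u, zspan u -> zspan (z * u).
Proof.
move=> zz u; elim=> [v|i w v ww _ IH]; first by rewrite mulrA; exact: zspanx.
by rewrite mulrDr; apply: zspanD => //; exact: zz.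
Qed.

Lemma zspan_comm n z u : scomm n y2 z -> (forall w, uall w -> uall (z * w)) ->
  zspan u -> zspan (z * u).
Proof.
move=> yz zz; apply: zspan_mul => i w ww; rewrite mulrA (scomm_sym (scommX i yz)) -!mulrA.
by rewrite -kcst_sign mulrA kcstC -mulrA; apply: zspan1; apply/uspan_cst/zz.
Qed.

Lemma zspan_atH f u : zspan u -> zspan (atH f * u).
Proof.
apply: zspan_mul => i w ww.
by rewrite mulrA (atH_has_wt _ (has_wtX i (wt_y2 K))) -mulrA; apply/zspan1/uspan_scale.
Qed.

Lemma uall_h2 u : uall u -> uall (h2 * u).
Proof.
move=> uu; have -> : h2 = H - h1 by rewrite X_E addrC addKr.
rewrite mulrBl; apply: uspanB; last exact: uall_h1.
by rewrite -(phornerX H) -atH_phorner; exact: uspan_scale.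
Qed.

Lemma uall_phorner_h2 p u : uall u -> uall (phorner h2 p * u).
Proof.
move=> uu; elim/poly_ind: p => [|p k IH]; first by rewrite phorner0 mul0r; exact: uspan0.
rewrite phornerD phornerMX phornerC mulrDl -phorner_id -mulrA.
by apply: uspanD; [exact: uall_h2|exact: uspan_cst].
Qed.

(** x2 passes a monomial of the first factor up to sign; on the right it is x - x1, where x1 extends
    the monomial and x goes into the left ideal. *)
Lemma uall_x2 u : uall u -> exists2 w, uall w & exists v, x2 * u = w + v * x.
Proof.
elim=> [|f a b c v _ _ [w ww [v' xv]]].
  by exists 0; [exact: uspan0|exists 0; rewrite mulr0 mul0r addr0].
pose g := atH (shift 1 f) * (-1) ^+ (a + c).
exists (- (g * mon a 'X^b c.+1) + w).
  apply: uspanD => //; apply: uspanN; rewrite -mulrA; apply: uspan_scale.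
  by rewrite -kcst_sign; apply: uspan_cst; exact: uall_mon.
exists (g * mon a 'X^b c + v'); rewrite mulrDr xv mulrA (has_wt_atH _ (wt_x2 K)) -mulrA.
rewrite x2_mon -mon_x1 (_ : x2 = x - x1); last by rewrite X_E addrC addKr.
rewrite /g; nc_ring.
Qed.

Lemma zspan_x2 u : zspan u -> zspan (x2 * u).
Proof.
apply: zspan_mul => i w ww; rewrite mulrA (triple_xyn (triple_eR K)) mulrDl -!mulrA.
apply: zspanD; first by apply: zspan1; exact: uall_phorner_h2.
have [w' ww' [v ->]] := uall_x2 ww; rewrite !mulrDr; apply: zspanD.
  by rewrite -kcst_sign mulrA kcstC -mulrA; apply: zspan1; exact: uspan_cst.
by rewrite !mulrA; exact: zspanx.
Qed.

(** [zspan] contains 1 and is stable under left multiplication by generators. The induction replaces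
    1 by an arbitrary element of [zspan], so that products are handled one factor at a time. *)
Lemma zspan_all u : zspan u.
Proof.
rewrite -[u]mulr1; have : zspan 1.
  rewrite -(expr0 y2) -[_ ^+ _]mulr1; apply: zspan1.
  by have := uall_mon 0 1 0; rewrite /pbw !expr0 phorner1 !mulr1.
have [[_ xy _] [_ yy _] [_ hy _]] := super_eLR K.
elim/U_ind: u 1 => [k|u v IHu IHv|u v IHu IHv|f|||||| ] z zs.
- by rewrite -atH_cst; exact: zspan_atH.
- by rewrite mulrDl; apply: zspanD; [exact: IHu|exact: IHv].
- by rewrite -mulrA; apply/IHu/IHv.
- exact: zspan_atH.
- by apply: (zspan_comm (n := 1)) => // [|w]; [rewrite /scomm expr1 mulN1r yy opprK|exact: uall_y1].
- by apply: (zspan_comm (n := 0)) => // [|w]; [rewrite /scomm expr0 mul1r hy|exact: uall_h1].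
- by apply: (zspan_comm (n := 1)) => // [|w]; [rewrite /scomm expr1 mulN1r xy opprK|exact: uall_x1].
- by move: z zs; apply: zspan_mul => i w ww; rewrite mulrA -exprS; exact: zspan1.
- have -> : h2 = H - h1 by rewrite X_E addrC addKr.
  rewrite mulrBl -mulN1r -kcst1 -kcstN -atH_cst; apply: zspanD.
    by rewrite -(phornerX H) -atH_phorner; exact: zspan_atH.
  by apply: zspan_atH; apply: (zspan_comm (n := 0)) => // [|w]; [rewrite /scomm expr0 mul1r hy|exact: uall_h1].
- exact: zspan_x2.
Qed.

Lemma toUJ_y u : toUJ (y * u) = 0.
Proof. by apply/toUJ_eq0/asboolP; exists u, 0, 0, 0; rewrite mulr0 !mul0r !addr0. Qed.
Lemma toUJ_x u : toUJ (u * x) = 0.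
Proof. by apply/toUJ_eq0/asboolP; exists 0, 0, u, 0; rewrite !mulr0 !mul0r !addr0 add0r. Qed.
Lemma toUJN u : toUJ (- u) = - toUJ u.
Proof. by apply: (addIr (toUJ u)); rewrite -toUJD !addNr toUJ0. Qed.
Lemma toUJB u v : toUJ (u - v) = toUJ u - toUJ v.
Proof. by rewrite toUJD toUJN. Qed.

(** Modulo y U, a leading y2 is - y1, and y1 moves past the other factors y2 into the first factor.
    This removes the y2 left by [zspan_all] one by one. *)
Lemma pbw_class_generate (m : UJ K) : exists l, m = comb l.
Proof.
elim/UJP: m => u; suff [w ww ->] : exists2 w, uall w & toUJ u = toUJ w.
  by have [l _ ->] := uspan_comb ww; exists l.
elim: (zspan_all u) => [v|i w v ww _ [w' ww' vw']].
  by exists 0; [exact: uspan0|rewrite toUJ_x toUJ0].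
suff [w'' ww'' e] : exists2 w'', uall w'' & toUJ (y2 ^+ i * w) = toUJ w''.
  by exists (w'' + w'); [exact: uspanD|rewrite !toUJD e vw'].
elim: i w ww => [|i IH] w ww; first by exists w; rewrite ?expr0 ?mul1r.
have [w'' ww'' e] := IH _ (uspan_sign i (uall_y1 ww)).
exists (- w''); first exact: uspanN.
have [_ [_ yy _] _] := super_eLR K.
rewrite toUJN -e exprS -mulrA.
have -> : y2 * (y2 ^+ i * w) = y * (y2 ^+ i * w) - y1 * (y2 ^+ i * w).
  by rewrite X_E mulrDl; nc_ring.
rewrite toUJB toUJ_y sub0r; congr (- toUJ _).
have yy' : scomm 1 y2 y1 by rewrite /scomm expr1 mulN1r yy opprK.
rewrite mulrA (scomm_sym (scommX i yy')) mul1n -!mulrA.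
by rewrite -kcst_sign mulrA kcstC -mulrA.
Qed.

End Spanning.

(** * The diamond product on representatives *)

Lemma fsbigT_seq (T : choiceType) (V : nmodType) (r : seq T) (f : T -> V) :
  uniq r -> (forall i, i \notin r -> f i = 0) ->
  \sum_(i \in [set: T]%classic) f i = \sum_(i <- r) f i.
Proof.
move=> ur fr; rewrite (fsbigE r) // => [|i _]; last exact: fr.
by apply: eq_bigl => i; rewrite in_setT.
Qed.

Section Diamond.
Variable K : numFieldType.
Local Notation y1 := (eL (xm1 : osp K)).
Local Notation h1 := (eL (xh : osp K)).
Local Notation x1 := (eL (xp1 : osp K)).
Local Notation y2 := (eR (xm1 : osp K)).
Local Notation h2 := (eR (xh : osp K)).
Local Notation x2 := (eR (xp1 : osp K)).
Local Notation y := (X_ (xm1 : osp K)).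
Local Notation H := (X_ (xh : osp K)).
Local Notation x := (X_ (xp1 : osp K)).
Local Notation lin := (loc_in (@D K)).
Implicit Types (u v w z : U K) (f : Uh_loc K).

(* ad x is locally nilpotent; this makes the diamond products finite sums. *)
Definition x_nil v := forall k, exists N w, x ^+ N * v = w * x ^+ k.

(** For X = x ^ 2 the commutator z' = [X, z] commutes with X, so X ^ (k + 1) z = (z X + (k + 1) z')
    X ^ k. *)
Lemma x_nil_sqr z z' : x ^+ 2 * z = z * x ^+ 2 + z' -> x ^+ 2 * z' = z' * x ^+ 2 ->
  x_nil z.
Proof.
move=> xz xz' k; exists (2 * k.+1)%N, ((z * x ^+ 2 + z' *+ k.+1) * x ^+ k).
have E (X : U K) n : X * z = z * X + z' -> X * z' = z' * X ->
    X ^+ n.+1 * z = (z * X + z' *+ n.+1) * X ^+ n.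
  move=> Xz Xz'; elim: n => [|n IH]; first by rewrite expr1 expr0 mulr1 Xz.
  rewrite [X ^+ n.+2]exprS -mulrA IH mulrA mulrDr [X * (z * _)]mulrA Xz mulrnAr Xz'.
  rewrite [X ^+ n.+1]exprS mulrA -mulrnAl; congr (_ * _).
  by rewrite -mulrDl [z' *+ n.+2]mulrS addrA.
by rewrite exprM E // -[RHS]mulrA -exprD addnn -mul2n exprM.
Qed.

(** As e commutes with the triple, commutators with x ^ 2 are those with a ^ 2: they are 0 for a, a
    for b and 2 a ^ 2 for c, and all commute with x ^ 2. *)
Lemma x_nil_triple (a b c e : U K) : osp_triple a b c -> x ^+ 2 = a ^+ 2 + e ->
  e * a = a * e -> e * b = b * e -> e * c = c * e ->
  [/\ x_nil a, x_nil b & x_nil c].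
Proof.
move=> T xe ea eb ec.
have xa : x ^+ 2 * a = a * x ^+ 2 by rewrite xe mulrDl ea mulrDr -exprS -exprSr.
split.
- by apply: (@x_nil_sqr _ 0); rewrite ?addr0 // mulr0 mul0r.
- apply: (@x_nil_sqr _ a) => //; rewrite xe mulrDl eb (triple_xny T) /= mulrDr.
  by rewrite /kap /= phorner1 sqrrN expr1n !mul1r expr1; nc_ring.
- apply: (@x_nil_sqr _ (a ^+ 2 *+ 2)).
    have [_ _ ac] := T; rewrite xe mulrDl ec !expr2 -mulrA ac mulrA mulrDr ac.
    by rewrite mulr1 !mulrDr !mulrDl !mulrA !mul1r mulr2n; nc_ring.
  by rewrite mulrnAr mulrnAl [a ^+ 2]expr2 mulrA xa -mulrA xa mulrA.
Qed.

Lemma x_sqr : x ^+ 2 = x1 ^+ 2 + x2 ^+ 2.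
Proof. by apply: oppr_inj; rewrite -X_xp2 X_E eL_xp2 eR_xp2 opprD. Qed.

Lemma sqr_comm (a b : U K) : (a * b = b * a \/ a * b = - (b * a)) -> b ^+ 2 * a = a * b ^+ 2.
Proof.
rewrite expr2 => -[e|e]; first by rewrite -mulrA -e mulrA -e mulrA.
have e' : b * a = - (a * b) by rewrite e opprK.
by rewrite -mulrA e' mulrN [b * (a * b)]mulrA e' mulNr opprK mulrA.
Qed.

Lemma x_nil_all v : x_nil v.
Proof.
have [[xx xy xh2] [yx yy yh] [hx hy hh]] := super_eLR K.
have [Nx1 Ny1 Nh1] : [/\ x_nil x1, x_nil y1 & x_nil h1].
  by apply: (x_nil_triple (triple_eL K) x_sqr); apply: sqr_comm; rewrite ?xx ?yx ?hx; [right|right|left].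
have [Nx2 Ny2 Nh2] : [/\ x_nil x2, x_nil y2 & x_nil h2].
  apply: (x_nil_triple (e := x1 ^+ 2) (triple_eR K)); first by rewrite x_sqr addrC.
  - by apply: sqr_comm; right; rewrite xx opprK.
  - by apply: sqr_comm; right; rewrite xy opprK.
  - by apply: sqr_comm; left; rewrite xh2.
elim/U_ind: v => // [k|u v IHu IHv|u v IHu IHv|f] n.
- by exists n, (kcst k); rewrite kcstC.
- have [N [w e]] := IHu n; have [N' [w' e']] := IHv n.
  exists (N + N')%N, (x ^+ N' * w + x ^+ N * w'); rewrite mulrDr {1}addnC !exprD -!mulrA e e'.
  by rewrite mulrDl !mulrA.
- have [N [w e]] := IHv n; have [N' [w' e']] := IHu N.
  by exists N', (w' * w); rewrite mulrA e' -!mulrA e.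
- by exists n, (atH (shift (1 *+ n) f)); rewrite (has_wt_atH _ (has_wtX n (wt_x K))).
Qed.

Lemma x_pow_right v : exists N, forall n, (N <= n)%N -> exists w, x ^+ n * v = w * x.
Proof.
have [N [w e]] := x_nil_all v 1; exists N => n Nn; exists (x ^+ (n - N) * w).
by rewrite -{1}(subnK Nn) exprD -!mulrA e expr1.
Qed.

Lemma lin_commr f p : f * lin p = lin p * f.
Proof.
have [d [q [Dd fq]]] := Uh_loc_frac f.
apply: (loc_in_D_inj Dd); rewrite [LHS]mulrA fq [RHS]mulrA (lin_comm d p) -[RHS]mulrA fq.
exact: lin_comm.
Qed.

(** The shifted [kap] is H - m for n + 1 = 2 m - 1 and m for n + 1 = 2 m, the denominators in the
    definition of [phi]. The recursion makes neighbouring terms cancel in [x_trunc] and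
    [trunc_y]. *)
Lemma phi_rec n :
  phi K n.+1 * shift (- (n.+1)%:Z) (lin (kap n.+1)) = - ((-1) ^+ n * phi K n).
Proof.
rewrite shift_in lin_commr -signr_odd; have := odd_double_half n.
case: (boolP (odd n)) => odd_n nE.
  have -> : phi K n.+1 = kcst (n.+1./2)%:R^-1 * phi K n by rewrite /= odd_n.
  rewrite /kap /= odd_n /= -polyC_natr comp_polyC expr1 mulN1r opprK mulrA.
  rewrite [lin _](loc_in_cst (@D K)) -kcstM divff ?kcst1 ?mul1r //.
  by rewrite pnatr_eq0 -lt0n -nE uphalf_half /= odd_double.
have -> : phi K n.+1 = - Hinv K (uphalf n.+1)%:Z * phi K n by rewrite /= odd_n.
rewrite expr0 mul1r mulNr mulrN mulrA.
rewrite (_ : kap n.+1 \Po _ = sval (exist (@D K) _ (D_subXn K (uphalf n.+1)%:Z))) ?loc_invr ?mul1r //=.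
rewrite /kap /= odd_n /= comp_polyD comp_polyX -polyC_natr comp_polyC -addrA -polyCD -polyCN; congr (_ + _%:P).
rewrite uphalf_half (negPf odd_n) add0n -{1}nE add0n mulrNz -!pmulrn -addnn -!natr1 natrD; ring.
Qed.

(* Truncations of the extremal projector. *)
Definition trunc (N : nat) : U K := \sum_(n < N) atH (phi K n) * y ^+ n * x ^+ n.

Lemma truncS N : trunc N.+1 = trunc N + atH (phi K N) * y ^+ N * x ^+ N.
Proof. exact: big_ord_recr. Qed.

Lemma yn_phorner n p :
  y ^+ n * phorner H p = atH (shift (- n%:Z) (lin p)) * y ^+ n.
Proof.
by rewrite -atH_phorner (has_wt_atH _ (has_wtX n (wt_y K))) mulNrn natz.
Qed.

Lemma shift_shift_in (v w : int) p : shift v (shift w (lin p)) = shift (v + w) (lin p).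
Proof.
rewrite !shift_in -comp_polyA comp_polyD comp_polyX comp_polyC.
by rewrite -addrA -polyCD -intrD.
Qed.

Lemma atH_sign n : atH ((-1) ^+ n : Uh_loc K) = (-1) ^+ n.
Proof. by rewrite -kcst_sign atH_cst kcst_sign. Qed.

Lemma atHN f : atH (- f) = - atH f.
Proof. by apply: (addIr (atH f)); rewrite -atHD !addNr atH0. Qed.

Lemma shiftN (w : int) f : shift w (- f) = - shift w f.
Proof.
by apply: (addIr (shift w f)); rewrite -shiftD !addNr -(kcst0 (K := K)) shift_cst.
Qed.

Lemma shift_sign (w : int) n : shift w ((-1) ^+ n : Uh_loc K) = (-1) ^+ n.
Proof. by rewrite -kcst_sign shift_cst kcst_sign. Qed.

(** The sum telescopes. The surviving term ends in x ^ (N + 1), hence disappears in U/J in front of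
    any v with x ^ (N + 1) v in U x. *)
Lemma x_trunc N : x * trunc N.+1 =
  (-1) ^+ N * (atH (shift 1 (phi K N)) * y ^+ N * x ^+ N.+1).
Proof.
elim: N => [|N IH].
  by rewrite /trunc big_ord1 /= shift1 !atH1 !expr0 !mulr1 !mul1r expr1.
rewrite truncS mulrDr IH [x ^+ N.+2]exprS !mulrA (has_wt_atH _ (wt_x K)) -[_ * x * y ^+ _]mulrA.
rewrite (triple_xyn (triple_X K)) succnK yn_phorner mulrDr mulrDl addrA.
rewrite [X in _ + X + _](_ : _ = - ((-1) ^+ N * atH (shift 1 (phi K N)) * y ^+ N * x ^+ N.+1)).
  rewrite addrN add0r !mulrA -[_ * (-1) ^+ N.+1]signU_comm ?mulrA //.
have -> : shift (- N%:Z) (lin (kap N.+1)) = shift 1 (shift (- (N.+1)%:Z) (lin (kap N.+1))).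
  by rewrite shift_shift_in; congr (shift _ _); lia.
by rewrite mulrA -atHM -shiftM phi_rec shiftN shiftM shift_sign atHN atHM atH_sign !mulNr.
Qed.

Lemma trunc_y N : trunc N.+1 * y =
  (-1) ^+ N * (atH (phi K N) * y ^+ N.+1 * x ^+ N).
Proof.
elim: N => [|N IH].
  by rewrite /trunc big_ord1 /= atH1 !expr0 !mulr1 !mul1r.
rewrite truncS mulrDl IH [y ^+ N.+2]exprSr -[_ * x ^+ _ * y]mulrA (triple_xny (triple_X K)) succnK mulrDr addrA.
rewrite [X in _ + X + _](_ : _ = - ((-1) ^+ N * (atH (phi K N) * y ^+ N.+1 * x ^+ N))).
  rewrite addrN add0r [LHS]mulrA -[_ * (-1) ^+ N.+1]signU_comm ?mulrA //.
rewrite [LHS]mulrA -[_ * y ^+ _ * phorner _ _]mulrA yn_phorner !mulrA -atHM phi_rec.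
by rewrite atHN atHM atH_sign !mulNr.
Qed.

Definition in_Ux v := exists w, v = w * x.

Lemma in_Ux_mul z u : in_Ux u -> in_Ux (z * u).
Proof. by move=> [w ->]; exists (z * w); rewrite mulrA. Qed.
Lemma toUJ_Ux u : in_Ux u -> toUJ u = 0.
Proof. by case=> w ->; exact: toUJ_x. Qed.

Lemma J_elim u : u \in @J K -> exists a c, u = y * a + c * x.
Proof.
move=> /asboolP[a [b [c [d ->]]]]; exists (a + y * b), (c - d * x).
by rewrite X_xm2 X_xp2 !expr2; nc_ring.
Qed.

Lemma x_pow_ge v N M : (N <= M)%N -> in_Ux (x ^+ N * v) -> in_Ux (x ^+ M * v).
Proof. by move=> NM vN; rewrite -(subnK NM) exprD -mulrA; exact: in_Ux_mul. Qed.

Lemma trunc_stable u v N M : (N <= M)%N -> in_Ux (x ^+ N * v) ->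
  toUJ (u * trunc M * v) = toUJ (u * trunc N * v).
Proof.
move=> NM vN; elim: M NM => [|M IH]; first by rewrite leqn0 => /eqP->.
rewrite leq_eqVlt => /predU1P[->//|NM].
rewrite truncS mulrDr mulrDl toUJD IH // -!mulrA [X in _ + X]toUJ_Ux ?addr0 //.
by do 3 apply: in_Ux_mul; exact: x_pow_ge vN.
Qed.

Lemma trunc_Jl u v N : u \in @J K -> in_Ux (x ^+ N.+1 * v) -> toUJ (u * trunc N.+1 * v) = 0.
Proof.
move=> /J_elim[a [c ->]] vN; rewrite !mulrDl toUJD -!mulrA toUJ_y add0r.
rewrite [x * (_ * _)]mulrA x_trunc -!mulrA; apply: toUJ_Ux.
by do 4 apply: in_Ux_mul.
Qed.

Lemma trunc_Jr u v : v \in @J K -> exists N, forall M, (N <= M)%N -> toUJ (u * trunc M * v) = 0.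
Proof.
move=> /J_elim[a [c ->]]; have [N aN] := x_pow_right a; exists N.+1 => -[//|M] NM.
rewrite mulrDr toUJD [X in _ + X]toUJ_Ux ?addr0; last by apply: in_Ux_mul; exists c.
rewrite [_ * (y * a)]mulrA -[_ * trunc _ * y]mulrA trunc_y -!mulrA; apply: toUJ_Ux.
by do 4 apply: in_Ux_mul; exact: aN.
Qed.

Lemma diamondE u v N : in_Ux (x ^+ N.+1 * v) -> toUJ u <o> toUJ v = toUJ (u * trunc N.+1 * v).
Proof.
move=> vN; rewrite /diamond; set u' := repr (toUJ u); set v' := repr (toUJ v).
have [N' v'N] := x_pow_right v'.
have [N'' jN] := trunc_Jr u (toUJ_repr v).
(* [N'] bounds the support of the sum, [N''] allows the right representative to be changed, and [N]
   is the truncation returned to at the end. *)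
pose M := (N + N' + N'')%N.
rewrite (fsbigT_seq (r := index_iota 0 M.+1)) ?iota_uniq //; last first.
  move=> n; rewrite mem_index_iota /= -leqNgt => Mn.
  by rewrite -mulrA toUJ_Ux //; apply/in_Ux_mul/v'N; rewrite /M in Mn; lia.
rewrite big_mkord -(big_morph _ (@toUJD K) (@toUJ0 K)).
rewrite (_ : \sum_(n < _) _ = u' * trunc M.+1 * v'); last first.
  by rewrite mulr_sumr mulr_suml; apply: eq_bigr => n _; rewrite !mulrA.
have -> : toUJ (u' * trunc M.+1 * v') = toUJ (u * trunc M.+1 * v').
  rewrite -[u'](subrK u) mulrDl mulrDl toUJD (trunc_Jl (toUJ_repr u)) ?add0r //.
  by apply: v'N; rewrite /M; lia.
rewrite -[v'](subrK v) mulrDr toUJD jN ?add0r; last by rewrite /M; lia.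
by apply: trunc_stable vN; rewrite /M; lia.
Qed.

End Diamond.

(** * Triangularity *)

Section KapSizes.
Variable K : numFieldType.

Lemma size_Xadd1_exp b : size (('X + 1 : {poly K}) ^+ b) = b.+1.
Proof. by rewrite -[1]opprK -polyCN size_exp_XsubC. Qed.

Lemma size_Xadd1_expB b : (size (('X + 1 : {poly K}) ^+ b - 'X^b)%R <= b)%N.
Proof.
elim: b => [|b IH]; first by rewrite subrr size_poly0.
have -> : ('X + 1 : {poly K}) ^+ b.+1 - 'X^(b.+1) = (('X + 1) ^+ b - 'X^b) * ('X + 1) + 'X^b.
  by rewrite !exprSr; ring.
apply: leq_trans (size_polyD _ _) _; rewrite geq_max size_polyXn leqnn andbT.
by apply: leq_trans (size_polyMleq _ _) _; rewrite -['X + 1]expr1 size_Xadd1_exp addn2.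
Qed.

Lemma size_kapXn a b b' : (b' < size (kap a * 'X^b : {poly K})%R)%N ->
  (0 < a)%N && (b' <= b + odd a)%N.
Proof.
have [->|a0] := posnP a; first by rewrite /kap /= mul0r size_poly0.
move=> b'lt; rewrite andTb; suff: (size (kap a * 'X^b : {poly K})%R <= (odd a).+1 + b)%N by lia.
apply: leq_trans (size_polyMleq _ _) _; rewrite size_polyXn addnS /= leq_add2r /kap.
case: (odd a); last by rewrite -polyC_natr size_polyC_leq1.
apply: leq_trans (size_polyD _ _) _; rewrite size_polyX geq_max /= -polyC_natr.
by apply: leq_trans (size_polyC_leq1 _) _.
Qed.

(** For even c the leading terms of X ^ b and its shift cancel and the degree drops; for odd c they
    add up. *)
Lemma size_shiftXn n c b b' :
  (b' < size ((-1) ^+ n * ('X^b \Po ('X + 1) - (-1) ^+ c * 'X^b) : {poly K})%R)%N ->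
  (b' + ~~ odd c <= b)%N.
Proof.
rewrite size_Msign comp_Xn_poly -signr_odd; case: (odd c) => /= b'lt.
  rewrite addn0 -ltnS; apply: leq_trans b'lt _; apply: leq_trans (size_polyD _ _) _.
  by rewrite size_polyN size_Msign size_Xadd1_exp size_polyXn maxnn.
by rewrite addn1; apply: leq_trans b'lt _; rewrite expr0 mul1r size_Xadd1_expB.
Qed.
End KapSizes.

Section Triangularity.
Variable K : numFieldType.
Local Notation y1 := (eL (xm1 : osp K)).
Local Notation x1 := (eL (xp1 : osp K)).
Local Notation y := (X_ (xm1 : osp K)).
Local Notation x := (X_ (xp1 : osp K)).
Local Notation mon := (@pbw K).
Local Notation uspan := (@uspan K).
Implicit Types (u v w z : U K) (f : Uh_loc K) (S : nat -> nat -> nat -> bool).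

Lemma uspan_term S f a b c : S a b c -> uspan S (atH f * mon a 'X^b c).
Proof. by move=> Sabc; rewrite -[_ * _]addr0; apply: uspanS => //; exact: uspan0. Qed.

Lemma uspan_monl S S' (n : nat) u : uspan S u ->
  (forall a b c, S a b c -> S' (n + a)%N b c) -> uspan S' (y1 ^+ n * u).
Proof.
move=> + SS'; apply: (uspan_map (T := fun u => y1 ^+ n * u)) => [|v w|f a b c Sabc].
- by rewrite mulr0.
- by rewrite mulrDr.
rewrite mulrA (has_wt_atH _ (has_wtX n (wt_y1 K))) -mulrA y1X_mon.
by apply: uspan_term; exact: SS'.
Qed.

Lemma uspan_monr S S' (n : nat) u : uspan S u ->
  (forall a b c, S a b c -> S' a b (c + n)%N) -> uspan S' (u * x1 ^+ n).
Proof.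
move=> + SS'; apply: (uspan_map (T := fun u => u * x1 ^+ n)) => [|v w|f a b c Sabc].
- by rewrite mul0r.
- by rewrite mulrDl.
by rewrite -mulrA mon_x1X; apply: uspan_term; exact: SS'.
Qed.

(** The two conditions on [S'] follow the first two summands of [x_mon]: contracting x with a y1
    lowers a and brings in [kap a], of degree at most odd a, while commuting with the rest raises c.
    The third summand ends in x. *)
Lemma uspan_x S S' u : uspan S u ->
  (forall a b c b', S a b c -> (0 < a)%N -> (b' <= b + odd a)%N -> S' a.-1 b' c) ->
  (forall a b c b', S a b c -> (b' + ~~ odd c <= b)%N -> S' a b' c.+1) ->
  exists u' w, uspan S' u' /\ x * u = u' + w * x.
Proof.
move=> + S1 S2; elim=> [|f a b c v Sabc _ [u' [w [Su' xv]]]].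
  by exists 0, 0; split; [exact: uspan0|rewrite mulr0 mul0r addr0].
pose g := atH (shift 1 f); pose s : U K := (-1) ^+ (a + c).
exists (g * mon a.-1 (kap a * 'X^b) c +
  g * mon a ((-1) ^+ a * ('X^b \Po ('X + 1) - (-1) ^+ c * 'X^b)) c.+1 + u').
exists (g * (s * mon a 'X^b c) + w); split.
  apply: uspanD Su'; apply: uspanD; apply: uspan_mon => b'.
    by case/size_kapXn/andP=> a0; exact: (S1 _ _ _ _ Sabc).
  by move/size_shiftXn; exact: (S2 _ _ _ _ Sabc).
rewrite mulrDr xv mulrA (has_wt_atH _ (wt_x K)) -/g -mulrA x_mon -/s; nc_ring.
Qed.

(** Mirror image of [uspan_x], by [mon_y]: y is moved to the left through u, where its last summand
    lies in y U and disappears in U/J. *)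
Lemma uspan_yr S S' f n u : uspan S u ->
  (forall a b c b', S a b c -> (0 < c)%N -> (b' <= b + odd c)%N -> S' a b' (c.-1 + n)%N) ->
  (forall a b c b', S a b c -> (b' + ~~ odd a <= b)%N -> S' a.+1 b' (c + n)%N) ->
  exists2 u', uspan S' u' & toUJ (u * atH f * y * x1 ^+ n) = toUJ u'.
Proof.
move=> + S1 S2; elim=> [|g a b c v Sabc _ [u' Su' vu']].
  by exists 0; [exact: uspan0|rewrite !mul0r].
pose k := atH g * atH (shift (c%:Z - a%:Z) f); pose s : U K := (-1) ^+ (a + c).
exists (k * mon a (kap c * 'X^b) (c.-1 + n) +
  k * mon a.+1 ((-1) ^+ c * ('X^b \Po ('X + 1) - (-1) ^+ a * 'X^b)) (c + n) + u').
  rewrite /k -atHM; apply: uspanD Su'; apply: uspanD; apply: uspan_mon => b'.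
    by case/size_kapXn/andP=> a0; exact: (S1 _ _ _ _ Sabc).
  by move/size_shiftXn; exact: (S2 _ _ _ _ Sabc).
rewrite !mulrDl !toUJD vu'; congr (_ + _).
rewrite -[atH g * _ * _]mulrA (has_wt_atH _ (wt_mon _ _ _)) mulrA -/k -[k * _ * y]mulrA mon_y -/s.
rewrite -!mon_x1X !mulrDr !mulrDl toUJD [X in _ + X](_ : _ = 0) ?addr0; first by rewrite toUJD !mulrA.
rewrite /s -kcst_sign -atH_cst !mulrA /k -!atHM (atH_has_wt _ (wt_y K)) -!mulrA.
exact: toUJ_y.
Qed.

End Triangularity.

(** * Products with powers of x_{-a} and bar h on the left *)

Section BarMonomials.
Variable K : numFieldType.
Local Notation y1 := (eL (xm1 : osp K)).
Local Notation h1 := (eL (xh : osp K)).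
Local Notation y := (X_ (xm1 : osp K)).
Local Notation H := (X_ (xh : osp K)).
Local Notation x := (X_ (xp1 : osp K)).
Local Notation lin := (loc_in (@D K)).
Local Notation mon := (@pbw K).
Local Notation uspan := (@uspan K).
Local Notation F1 := (atH (phi K 1)).
Local Notation F2 := (atH (phi K 2)).
Implicit Types (u v w z : U K) (f : Uh_loc K) (S : nat -> nat -> nat -> bool).

Definition in_yU u := exists w, u = y * w.

Lemma in_yUD u v : in_yU u -> in_yU v -> in_yU (u + v).
Proof. by move=> [w ->] [w' ->]; exists (w + w'); rewrite mulrDr. Qed.
Lemma in_yUN u : in_yU u -> in_yU (- u).
Proof. by move=> [w ->]; exists (- w); rewrite mulrN. Qed.
Lemma in_yU_mulr u z : in_yU u -> in_yU (u * z).
Proof. by move=> [w ->]; exists (w * z); rewrite mulrA. Qed.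
Lemma in_yU_atH f u : in_yU u -> in_yU (atH f * u).
Proof. by move=> [w ->]; rewrite mulrA (atH_has_wt _ (wt_y K)) -mulrA; eexists. Qed.
Lemma in_yU_y u : in_yU (y * u). Proof. by exists u. Qed.
Lemma toUJ_yU u : in_yU u -> toUJ u = 0.
Proof. by case=> w ->; exact: toUJ_y. Qed.

Lemma diamond_scalel f (a b : UJ K) : (f *: a) <o> b = f *: (a <o> b).
Proof.
elim/UJP: a => u; elim/UJP: b => v; have [N vN] := x_pow_right v.
have xv : in_Ux (x ^+ N.+1 * v) by exact: vN.
by rewrite scale_toUJ !(diamondE _ xv) scale_toUJ !mulrA.
Qed.

Lemma diamond_cst_r (k : K) (a b : UJ K) : a <o> (kcst k *: b) = kcst k *: (a <o> b).
Proof.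
elim/UJP: a => u; elim/UJP: b => v; have [N vN] := x_pow_right v.
have xv : in_Ux (x ^+ N.+1 * v) by exact: vN.
have kxv : in_Ux (x ^+ N.+1 * (atH (kcst k) * v)).
  by rewrite atH_cst mulrA -kcstC -mulrA; exact: in_Ux_mul.
rewrite !scale_toUJ (diamondE _ xv) (diamondE _ kxv).
by rewrite scale_toUJ atH_cst mulrA -kcstC !mulrA.
Qed.

Lemma diamond_x u v : in_Ux (x * v) -> toUJ u <o> toUJ v = toUJ (u * v).
Proof.
rewrite -{1}(expr1 x) => xv; rewrite (diamondE _ xv).
by rewrite /trunc big_ord1 /= atH1 !expr0 !mulr1.
Qed.

Lemma trunc3 N : trunc K N.+3 = 1 + F1 * y * x + F2 * y ^+ 2 * x ^+ 2 +
  \sum_(n < N) atH (phi K n.+3) * y ^+ n.+3 * x ^+ n.+3.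
Proof.
elim: N => [|N IH]; last by rewrite truncS IH big_ord_recr addrA.
rewrite !truncS {1}/trunc !big_ord0 add0r addr0.
by rewrite [atH (phi K 0)]atH1 !expr0 !expr1 !mulr1.
Qed.

(** For n >= 3 the term begins with u f y ^ 3, so it lies in y U by the hypothesis on u, whatever v
    is. *)
Lemma diamond3 u v : (forall f, in_yU (u * atH f * y ^+ 3)) ->
  toUJ u <o> toUJ v =
  toUJ (u * v) + toUJ (u * F1 * y * (x * v)) + toUJ (u * F2 * y ^+ 2 * (x ^+ 2 * v)).
Proof.
move=> uy; have [N vN] := x_pow_right v.
have xv : in_Ux (x ^+ N.+3 * v) by apply: vN; lia.
rewrite (diamondE _ xv) trunc3 !mulrDr !mulrDl !toUJD mulr1 !mulrA [X in _ + X]toUJ_yU ?addr0 //.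
rewrite mulr_sumr mulr_suml; apply: big_ind; [by exists 0; rewrite mulr0|exact: in_yUD|].
move=> n _; rewrite (_ : _ * v = u * atH (phi K n.+3) * y ^+ 3 * (y ^+ n * x ^+ n.+3 * v)).
  by apply: in_yU_mulr; exact: uy.
by rewrite (exprD y 3 n) !mulrA.
Qed.

Lemma diamond2 u v : (forall f, in_yU (u * atH f * y ^+ 2)) ->
  toUJ u <o> toUJ v = toUJ (u * v) + toUJ (u * F1 * y * (x * v)).
Proof.
move=> uy; rewrite diamond3 => [|f]; last by rewrite exprSr mulrA; exact: in_yU_mulr.
by rewrite [X in _ + X]toUJ_yU ?addr0 //; apply: in_yU_mulr; exact: uy.
Qed.

Lemma y1X_y n : y1 ^+ n * y = (-1) ^+ n * (y * y1 ^+ n) + (1 - (-1) ^+ n) * y1 ^+ n.+1.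
Proof.
have := mon_y2 n (1 : {poly K}) 0; rewrite /pbw phorner1 expr0 !mulr1 addn0 => e.
rewrite X_E mulrDr e mulrDl -exprS -exprSr; nc_ring.
Qed.

Lemma y1X_y_even n : ~~ odd n -> y1 ^+ n * y = y * y1 ^+ n.
Proof. by move=> en; rewrite y1X_y -signr_odd (negPf en) expr0 mul1r subrr mul0r addr0. Qed.

Lemma y1X_y_odd n : odd n -> y1 ^+ n * y = 2%:R * y1 ^+ n.+1 - y * y1 ^+ n.
Proof. by move=> en; rewrite y1X_y -signr_odd en expr1 mulN1r opprK addrC mulr2n. Qed.

Lemma y1X_atH_y2 n f : in_yU (y1 ^+ n * atH f * y ^+ 2).
Proof.
rewrite (has_wt_atH _ (has_wtX n (wt_y1 K))) -mulrA; apply: in_yU_atH.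
rewrite expr2 mulrA; have [on|en] := boolP (odd n).
  rewrite y1X_y_odd // mulrBl -mulrA y1X_y_even /= ?on // mulrA mulr_natl -[_ *+ 2]mulr_natr -mulrA -mulrA.
  by apply: in_yUD; [|apply: in_yUN]; exact: in_yU_y.
by rewrite y1X_y_even // -mulrA; exact: in_yU_y.
Qed.

Lemma y1X_diamond_even n v : ~~ odd n -> toUJ (y1 ^+ n) <o> toUJ v = toUJ (y1 ^+ n * v).
Proof.
move=> en; rewrite diamond2 => [|f]; last exact: y1X_atH_y2.
rewrite [X in _ + X]toUJ_yU ?addr0 //; apply: in_yU_mulr.
rewrite (has_wt_atH _ (has_wtX n (wt_y1 K))) -mulrA; apply: in_yU_atH.
by rewrite y1X_y_even //; exact: in_yU_y.
Qed.

Lemma y1X_diamond_odd n v : odd n -> toUJ (y1 ^+ n) <o> toUJ v =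
  toUJ (y1 ^+ n * v + kcst 2%:R * atH (shift (-1 *+ n) (phi K 1)) * y1 ^+ n.+1 * (x * v)).
Proof.
move=> on; rewrite diamond2 => [|f]; last exact: y1X_atH_y2.
rewrite toUJD (has_wt_atH _ (has_wtX n (wt_y1 K))) -[_ * _ * y]mulrA y1X_y_odd //.
rewrite mulrBr mulrBl toUJB [X in _ - X]toUJ_yU ?subr0; last first.
  by apply: in_yU_mulr; apply: in_yU_atH; exact: in_yU_y.
have <- : kcst 2%:R = 2%:R :> U K by exact: kcst_nat.
by rewrite [atH _ * (kcst _ * _)]mulrA -kcstC !mulrA.
Qed.

Definition eta_h : U K := 2%:R * h1 - H.

Lemma wt_eta : has_wt 0 eta_h.
Proof.
have := wt_h1 K; rewrite /has_wt /eta_h kcst0 addr0 mulrBl mulrBr => h.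
by rewrite mulr_natl mulrnAl h mulrnAr.
Qed.

Lemma eta_y : eta_h * y = y * (eta_h - 1) + 2%:R * y1.
Proof.
have [_ hy _] := triple_eL K; have [_ _ [_ hy2 _]] := super_eLR K; have [_ hy3 _] := triple_X K.
rewrite /eta_h mulrBl hy3 -mulrA X_E mulrDr hy hy2 !mulr_natl !mulr2n; nc_ring.
Qed.

Lemma y1_y : y1 * y = kcst 2%:R * y1 ^+ 2 - y * y1.
Proof. by rewrite kcst_nat; exact: (@y1X_y_odd 1). Qed.

Lemma shift0 f : shift 0 f = f.
Proof.
have [d [p [Dd fp]]] := Uh_loc_frac f.
have l0 q : shift 0 (lin q) = lin q by rewrite shift_in addr0 comp_polyXr.
by apply: (loc_in_D_inj Dd); rewrite -[in LHS]l0 -shiftM fp l0.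
Qed.

Lemma eta_atH_y f : exists w, eta_h * atH f * y = y * w + kcst 2%:R * atH f * y1.
Proof.
rewrite (has_wt_atH _ wt_eta) shift0 -mulrA eta_y mulrDr.
have <- : kcst 2%:R = 2%:R :> U K by exact: kcst_nat.
rewrite [atH _ * (kcst _ * _)]mulrA -kcstC.
by have [w ->] := in_yU_atH f (in_yU_y (eta_h - 1)); exists w.
Qed.

(** Modulo y U, each y on the right brings a factor 2: eta_h becomes 2 y1, and 2 y1 becomes 4 y1 ^
    2. Since y1 ^ 2 commutes with y, a third y leaves nothing, so [eta_diamond] has three terms. *)
Lemma eta_atH_y2 f : exists w, eta_h * atH f * y ^+ 2 = y * w + kcst 4%:R * atH f * y1 ^+ 2.
Proof.
have [w e] := eta_atH_y f; rewrite expr2 mulrA e mulrDl -!mulrA y1_y.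
have [w' e'] := in_yU_atH f (in_yU_y y1).
exists (w * y - kcst 2%:R * w').
rewrite [atH f * (_ - _)]mulrBr e' [atH f * (kcst _ * _)]mulrA -kcstC mulrBr [y * (_ - _)]mulrBr.
by rewrite !mulrA -kcstM -natrM -[y * kcst _]kcstC; nc_ring.
Qed.

Lemma eta_diamond v : toUJ eta_h <o> toUJ v =
  toUJ (eta_h * v + kcst 2%:R * F1 * y1 * (x * v) + kcst 4%:R * F2 * y1 ^+ 2 * (x ^+ 2 * v)).
Proof.
rewrite diamond3 => [|f].
  rewrite !toUJD; have [w ->] := eta_atH_y (phi K 1); have [w' ->] := eta_atH_y2 (phi K 2).
  by rewrite !mulrDl !toUJD -!(mulrA y) !toUJ_y !add0r.
have [w e] := eta_atH_y2 f; rewrite exprSr mulrA e mulrDl -[y * w * y]mulrA -[_ * y1 ^+ 2 * y]mulrA y1X_y_even //.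
apply: in_yUD; first exact: in_yU_y.
rewrite -mulrA -atH_cst; do 2 apply: in_yU_atH; exact: in_yU_y.
Qed.

(* Exponents (a, b, c) occurring in the corrections to eta_h ^ r (S0), in the
   supercommutator of x with them (S1), and in the commutator of x ^ 2 (S2). The
   bounds express that the PBW degree, for which x, y, h, x ^ 2, y ^ 2 all have
   degree 1, does not increase. *)
Definition S0 (m r a b c : nat) := [&& a == c, (m <= a)%N & (b + 2 * uphalf a <= r)%N].
Definition S1 (r a b c : nat) := (c == a.+1) && (b + a + 1 <= r)%N.
Definition S2 (r a b c : nat) := (c == a.+2) && (b + 2 * uphalf a.+2 <= r.+1)%N.

Lemma x_S0 r u : uspan (S0 0 r) u -> exists u' w, uspan (S1 r) u' /\ x * u = u' + w * x.
Proof. by move=> Su; apply: (uspan_x Su) => a b c b'; rewrite /S0 /S1; lia. Qed.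

Lemma x_S1 r u : uspan (S1 r) u -> exists u' w, uspan (S2 r) u' /\ x * u = u' + w * x.
Proof. by move=> Su; apply: (uspan_x Su) => a b c b'; rewrite /S2 /S1; lia. Qed.

Lemma eta_uspan S S' u : uspan S u ->
  (forall a b c b', S a b c -> (b' <= b.+1)%N -> S' a b' c) -> uspan S' (eta_h * u).
Proof.
move=> + SS'; apply: (uspan_map (T := fun u => eta_h * u)) => [|v w|f a b c Sabc].
- by rewrite mulr0.
- by rewrite mulrDr.
rewrite mulrA (has_wt_atH _ wt_eta) shift0 -mulrA; apply: uspan_scale.
rewrite /eta_h mulrBl -mulrA h1_mon; apply: uspanB.
  have <- : kcst 2%:R = 2%:R :> U K by exact: kcst_nat.
  apply: uspan_cst; apply: uspan_mon1 => b' b'lt; apply: (SS' _ _ _ _ Sabc).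
  suff: (size (('X + a%:R) * 'X^b : {poly K})%R <= b.+2)%N by move=> h; have := leq_trans b'lt h.
  apply: leq_trans (size_polyMleq _ _) _; rewrite size_polyXn addnS /= -addn2 addnC leq_add2l.
  apply: leq_trans (size_polyD _ _) _; rewrite size_polyX geq_max /= -polyC_natr.
  by apply: leq_trans (size_polyC_leq1 _) _.
rewrite -(phornerX H) -atH_phorner; apply: uspan_term; exact: SS' Sabc (leqnSn b).
Qed.

(** In eta_h = 2 h1 - H the element H counts as a coefficient, so the leading term in h1 is 2 ^ r h1
    ^ r. *)
Lemma eta_pow r : uspan (fun a b c => [&& a == 0, c == 0 & b < r]%N)
  (eta_h ^+ r - kcst (2 ^ r)%:R * mon 0 'X^r 0).
Proof.
have E0 b : mon 0 'X^b 0 = h1 ^+ b by rewrite /pbw !expr0 mul1r mulr1 phornerXn.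
rewrite E0; elim: r => [|r IH].
  by rewrite expn0 !expr0 kcst1 mulr1 subrr; exact: uspan0.
have -> : eta_h ^+ r.+1 - kcst (2 ^ r.+1)%:R * h1 ^+ r.+1 =
    eta_h * (eta_h ^+ r - kcst (2 ^ r)%:R * h1 ^+ r) - atH (lin 'X) * (kcst (2 ^ r)%:R * h1 ^+ r).
  rewrite atH_phorner phornerX mulrBr -exprS [eta_h * (kcst _ * _)]mulrA -kcstC.
  rewrite -[kcst _ * eta_h * _]mulrA {3}/eta_h mulrBl mulrBr -mulrA -exprS expnS natrM [_ * (2 ^ r)%:R]mulrC kcstM.
  have <- : kcst 2%:R = 2%:R :> U K by exact: kcst_nat.
  by rewrite [H * (kcst _ * _)]mulrA -[H * kcst _]kcstC; move: (kcst (2 ^ r)%:R) => k; nc_ring.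
apply: uspanB; first by apply: (eta_uspan IH) => a b c b'; lia.
by apply/uspan_scale/uspan_cst; rewrite -E0; apply: uspan_mon1 => b; rewrite size_polyXn; lia.
Qed.

Lemma eta_pow_le r : uspan (fun a b c => [&& a == 0, c == 0 & b <= r]%N) (eta_h ^+ r).
Proof.
rewrite -[eta_h ^+ r](subrK (kcst (2 ^ r)%:R * mon 0 'X^r 0)); apply: uspanD.
  by apply: sub_uspan (eta_pow r) => a b c; lia.
by apply: uspan_cst; apply: uspan_mon1 => b; rewrite size_polyXn; lia.
Qed.

Lemma bar_xh : bar (xh : osp K) = toUJ eta_h.
Proof. by rewrite /bar tildeE. Qed.

(** In the terms n = 1 and n = 2 of [eta_diamond], x or x ^ 2 raises c over a by n, and y1 ^ n
    restores a = c. The degree bounds of [S1] and [S2] are exactly what returns these terms to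
    [S0 1 r.+1]. *)
Lemma bar_xh_pow r : exists2 w, uspan (S0 1 r) w & bar (xh : osp K) ^<o> r = toUJ (eta_h ^+ r + w).
Proof.
elim: r => [|r [w Sw e]]; first by exists 0; [exact: uspan0|rewrite expr0 addr0].
rewrite /diamond_exp iterS -/(diamond_exp _ _) e bar_xh eta_diamond.
set v := eta_h ^+ r + w; have Sv : uspan (S0 0 r) v.
  apply: uspanD; first by apply: sub_uspan (eta_pow_le r) => a b c; rewrite /S0; lia.
  by apply: sub_uspan Sw => a b c; rewrite /S0; lia.
have [v1 [w1 [Sv1 xv]]] := x_S0 Sv; have [v2 [w2 [Sv2 xv1]]] := x_S1 Sv1.
exists (eta_h * w + kcst 2%:R * (F1 * (y1 ^+ 1 * v1)) + kcst 4%:R * (F2 * (y1 ^+ 2 * v2))).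
  apply: uspanD; [apply: uspanD|].
  - by apply: (eta_uspan Sw) => a b c b'; rewrite /S0; lia.
  - by apply/uspan_cst/uspan_scale/(uspan_monl Sv1) => a b c; rewrite /S0 /S1; lia.
  - by apply/uspan_cst/uspan_scale/(uspan_monl Sv2) => a b c; rewrite /S0 /S2; lia.
rewrite expr2 -[x * x * v]mulrA xv [x * (_ + _)]mulrDr xv1 /v !mulrDr -exprS expr1 !toUJD !mulrA !toUJ_x.
by rewrite !addr0 !addrA.
Qed.

End BarMonomials.

(** * Leading terms of the bar monomials *)

Section Triangular.
Variable K : numFieldType.
Local Notation y1 := (eL (xm1 : osp K)).
Local Notation x1 := (eL (xp1 : osp K)).
Local Notation y := (X_ (xm1 : osp K)).
Local Notation x := (X_ (xp1 : osp K)).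
Local Notation mon := (@pbw K).
Local Notation uspan := (@uspan K).
Local Notation etaK := (@eta_h K).
Local Notation F1 := (atH (phi K 1)).
Implicit Types (u v w z : U K) (f : Uh_loc K) (S : nat -> nat -> nat -> bool).

Lemma bar_xm1 : bar (xm1 : osp K) = toUJ (2%:R * y1).
Proof. by rewrite /bar tildeE toUJB -[y]mulr1 toUJ_y subr0. Qed.
Lemma bar_xp1 : bar (xp1 : osp K) = toUJ (2%:R * x1).
Proof. by rewrite /bar tildeE toUJB -[x]mul1r toUJ_x subr0. Qed.
Lemma bar_xm2 : bar (xm2 : osp K) = toUJ (2%:R * y1 ^+ 2).
Proof. by rewrite /bar tildeE toUJB X_xm2 expr2 toUJ_y subr0 eL_xm2. Qed.
Lemma bar_xp2 : bar (xp2 : osp K) = toUJ (- 2%:R * x1 ^+ 2).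
Proof.
by rewrite /bar tildeE toUJB X_xp2 toUJN [x ^+ 2]expr2 toUJ_x oppr0 subr0 eL_xp2 mulrN mulNr.
Qed.

Lemma x_x1 : x * x1 = kcst 2%:R * x1 ^+ 2 - x1 * x.
Proof.
have [[xx _ _] _ _] := super_eLR K.
by rewrite X_E kcst_nat mulrDl mulrDr xx expr2 mulr_natl mulr2n; nc_ring.
Qed.

(** Consequently only the term n = 0 remains when multiplying on the right by a power of
    [bar xp2]. *)
Lemma x_x1_even n : x * x1 ^+ (2 * n) = x1 ^+ (2 * n) * x.
Proof.
have e : x * x1 ^+ 2 = x1 ^+ 2 * x.
  rewrite [x1 ^+ 2]expr2 mulrA x_x1 mulrBl -[x1 * x * x1]mulrA x_x1 mulrBr.
  by rewrite [x1 * (kcst _ * _)]mulrA -kcstC expr2; nc_ring.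
rewrite exprM; elim: n => [|n IH]; first by rewrite expr0 mulr1 mul1r.
by rewrite [(x1 ^+ 2) ^+ n.+1]exprS mulrA e -mulrA IH mulrA.
Qed.

Lemma bar_xm2_pow p : bar (xm2 : osp K) ^<o> p = kcst (2 ^ p)%:R *: toUJ (y1 ^+ (2 * p)).
Proof.
elim: p => [|p IH]; first by rewrite muln0 expn0 kcst1 scale1r expr0.
rewrite /diamond_exp iterS -/(diamond_exp _ _) IH bar_xm2 diamond_cst_r.
rewrite -[2%:R]kcst_nat -atH_cst -scale_toUJ diamond_scalel y1X_diamond_even // -exprD.
by rewrite scalerA -kcstM -natrM mulnC -expnS mulnS.
Qed.

Lemma diamond1 (a : UJ K) : a <o> toUJ 1 = a.
Proof. by elim/UJP: a => u; rewrite diamond_x ?mulr1 //; exists 1; rewrite mul1r. Qed.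

Lemma bar_ym p (q : 'I_2) : bar (xm2 : osp K) ^<o> p <o> bar xm1 ^<o> q =
  kcst (2 ^ (p + q))%:R *: toUJ (y1 ^+ (2 * p + q)).
Proof.
case: q => -[|[|//]] q2 /=; first by rewrite diamond1 bar_xm2_pow !addn0.
rewrite /diamond_exp /= -/(diamond_exp _ _) diamond1 bar_xm2_pow bar_xm1.
rewrite -[2%:R]kcst_nat -atH_cst -scale_toUJ diamond_cst_r diamond_scalel.
rewrite y1X_diamond_even ?mul2n ?odd_double // -exprSr scalerA -kcstM -natrM -expnS.
by rewrite !addn1.
Qed.

Lemma bar_xp2_pow t : bar (xp2 : osp K) ^<o> t = kcst ((- 2%:R) ^+ t) *: toUJ (x1 ^+ (2 * t)).
Proof.
elim: t => [|t IH]; first by rewrite muln0 expr0 kcst1 scale1r expr0.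
rewrite /diamond_exp iterS -/(diamond_exp _ _) IH bar_xp2 diamond_cst_r.
have <- : kcst (- 2%:R) = - 2%:R :> U K by rewrite kcstN kcst_nat.
rewrite -atH_cst -scale_toUJ diamond_scalel diamond_x; last first.
  by rewrite x_x1_even; eexists.
by rewrite -exprD scalerA -kcstM -exprSr mulnS.
Qed.

(* SV A r is the set of exponents of the corrections to y1 ^ A <> h ^ r; the second
   condition ensures that the term phi_1 y x of the product with x_a on the right,
   which can raise b by one if c is odd, leads to SF A r, the exponents of rank less
   than that of (A, r, c). *)
Definition SV (A r a b c : nat) := (b < r)%N && (2 * (b + odd c) + odd a < 2 * r + odd A)%N.
Definition SF (A r a b c : nat) := (2 * b + odd a < 2 * r + odd A)%N.

Lemma y1X_bar_xh A r : exists2 w, uspan (SV A r) w &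
  toUJ (y1 ^+ A) <o> bar (xh : osp K) ^<o> r = toUJ (y1 ^+ A * etaK ^+ r + w).
Proof.
have [w Sw ->] := bar_xh_pow K r; set v := etaK ^+ r + w.
have Sv : uspan (S0 0 r) v.
  apply: uspanD; first by apply: sub_uspan (eta_pow_le K r) => a b c; rewrite /S0; lia.
  by apply: sub_uspan Sw => a b c; rewrite /S0; lia.
have SAw : uspan (SV A r) (y1 ^+ A * w).
  by apply: (uspan_monl Sw) => a b c; rewrite /SV /S0; lia.
have [oA|eA] := boolP (odd A); last first.
  by exists (y1 ^+ A * w) => //; rewrite y1X_diamond_even // mulrDr.
have [v1 [w1 [Sv1 xv]]] := x_S0 Sv.
exists (y1 ^+ A * w + kcst 2%:R * (atH (shift (-1 *+ A) (phi K 1)) * (y1 ^+ A.+1 * v1))).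
  apply: uspanD => //; apply/uspan_cst/uspan_scale/(uspan_monl Sv1) => a b c.
  by rewrite /SV /S1 oA; lia.
rewrite y1X_diamond_odd // xv {1}/v !mulrDr !toUJD !mulrA toUJ_x.
by rewrite !addr0 !addrA.
Qed.

(** x ^ 2 commutes with x1, so only n <= 1 contributes, and modulo U x the factor x x1 of the term n
    = 1 is 2 x1 ^ 2. Moving its y to the left through u gives the corrections: monomials of u with
    odd c may gain one degree in h1, which [SV] leaves room for. *)
Lemma diamond_x1 A r w : uspan (SV A r) w -> exists2 w', uspan (SF A r) w' &
  toUJ (y1 ^+ A * etaK ^+ r + w) <o> bar (xp1 : osp K) =
  kcst 2%:R *: toUJ (y1 ^+ A * etaK ^+ r * x1 + w').
Proof.
move=> Sw; set u := y1 ^+ A * etaK ^+ r + w.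
have Su : uspan (fun a b c => [|| [&& a == A, c == 0 & b <= r] | SV A r a b c])%N u.
  apply: uspanD; last by apply: sub_uspan Sw => a b c ->; rewrite orbT.
  by apply: (uspan_monl (eta_pow_le K r)) => a b c; lia.
have [w1 Sw1 uw1] : exists2 w1, uspan (SF A r) w1 & toUJ (u * F1 * y * x1 ^+ 2) = toUJ w1.
  by apply: uspan_yr Su _ _ => a b c b'; rewrite /SF /SV; lia.
exists (w * x1 ^+ 1 + kcst 2%:R * w1).
  apply: uspanD; last exact: uspan_cst.
  by apply: (uspan_monr Sw) => a b c; rewrite /SV /SF; lia.
have x2x1 : in_Ux (x ^+ 2 * x1).
  exists (x1 * x); rewrite x_sqr mulrDl -exprSr.
  have [[xx _ _] _ _] := super_eLR K.
  by rewrite -[x1 * x * x]mulrA -expr2 x_sqr mulrDr -exprS (sqr_comm (or_intror xx)).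
rewrite bar_xp1 -[2%:R](kcst_nat (U K) 2) -atH_cst -scale_toUJ diamond_cst_r (diamondE _ x2x1).
congr (_ *: _); rewrite truncS /trunc big_ord1 [atH (phi K 0)]atH1 !expr0 !expr1 !mulr1.
have -> : u * (1 + F1 * y * x) * x1 =
    u * x1 + kcst 2%:R * (u * F1 * y * x1 ^+ 2) - u * F1 * y * x1 * x.
  rewrite mulrDr mulr1 mulrDl !mulrA -[_ * x * x1]mulrA x_x1 mulrBr.
  by rewrite [_ * (kcst _ * _)]mulrA -kcstC; nc_ring.
rewrite toUJB toUJ_x subr0 toUJD -(atH_cst 2%:R) -scale_toUJ uw1 scale_toUJ.
by rewrite -toUJD {1}/u mulrDl addrA.
Qed.

Lemma diamond_bar_xp1_pow A r (s : 'I_2) w : uspan (SV A r) w ->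
  exists2 w', uspan (SF A r) w' &
  toUJ (y1 ^+ A * etaK ^+ r + w) <o> bar (xp1 : osp K) ^<o> s =
  kcst (2 ^ s)%:R *: toUJ (y1 ^+ A * etaK ^+ r * x1 ^+ s + w').
Proof.
move=> Sw; case: s => -[|[|//]] s2 /=.
  exists w; first by apply: sub_uspan Sw => a b c; rewrite /SV /SF; lia.
  by rewrite diamond1 expn0 kcst1 scale1r expr0 mulr1.
have [w' Sw' e] := diamond_x1 Sw; exists w' => //.
by rewrite /diamond_exp /= diamond1 e expn1 expr1.
Qed.

Lemma bar_monomial p (q : 'I_2) r (s : 'I_2) t : exists k w,
  [/\ k != 0, uspan (SF (2 * p + q) r) w &
  bar (xm2 : osp K) ^<o> p <o> bar xm1 ^<o> q <o> bar xh ^<o> r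
    <o> bar xp1 ^<o> s <o> bar xp2 ^<o> t =
  kcst k *: pbw_class K (2 * p + q, r, s + 2 * t)%N + toUJ w].
Proof.
rewrite bar_ym diamond_scalel; set A := (2 * p + q)%N.
have [w Sw ->] := y1X_bar_xh A r; rewrite diamond_scalel.
have [w' Sw' ->] := diamond_bar_xp1_pow s Sw.
rewrite bar_xp2_pow diamond_scalel diamond_scalel diamond_cst_r diamond_x; last first.
  by rewrite x_x1_even; eexists.
rewrite !scalerA -!kcstM; set k := _ * _ * _.
have k0 : k != 0.
  by rewrite !mulf_neq0 ?expf_neq0 ?oppr_eq0 ?pnatr_eq0 ?expn_eq0.
(* [d] is eta_h ^ r without its leading term; the factor 2 ^ r of that term enters the scalar of the
   monomial. *)
pose d := etaK ^+ r - kcst (2 ^ r)%:R * mon 0 'X^r 0.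
exists (k * (2 ^ r)%:R), (kcst k * (y1 ^+ A * d * x1 ^+ s * x1 ^+ (2 * t) + w' * x1 ^+ (2 * t))).
split; first by rewrite mulf_neq0 ?pnatr_eq0 ?expn_eq0.
  apply/uspan_cst/uspanD; last first.
    by apply: (uspan_monr Sw') => a b c.
  rewrite -mulrA -exprD; apply: (uspan_monr (S := SF A r)) => [|a b c] //.
  by apply: (uspan_monl (eta_pow K r)) => a b c; rewrite /SF; lia.
rewrite kcstM -scalerA -[kcst k * _]/(_ * _) -(atH_cst k) -!scale_toUJ -scalerDr; congr (_ *: _).
rewrite /pbw_class /= scale_toUJ atH_cst -toUJD; congr toUJ.
rewrite mulrDl addrA; congr (_ + _).
rewrite -(subrK (kcst (2 ^ r)%:R * mon 0 'X^r 0) (etaK ^+ r)) -/d mulrDr !mulrDl addrC; congr (_ + _).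
rewrite -[LHS]mulrA -exprD [y1 ^+ A * (kcst _ * _)]mulrA -kcstC -[kcst _ * _ * mon _ _ _]mulrA.
by rewrite y1X_mon -[LHS]mulrA mon_x1X addn0.
Qed.

End Triangular.

(** * From triangularity to a basis *)

Section BasisCriterion.
Variables (A : pzRingType) (M : lmodType A) (I : choiceType) (b : I -> M).

Lemma sum_group (l : seq (A * I)) : \sum_(x <- l) x.1 *: b x.2 =
  \sum_(i <- undup (map snd l)) (\sum_(x <- l | x.2 == i) x.1) *: b i.
Proof.
under [RHS]eq_bigr do rewrite scaler_suml big_mkcond.
rewrite exchange_big big_seq [RHS]big_seq; apply: eq_bigr => x xl.
rewrite (bigD1_seq x.2) ?undup_uniq ?mem_undup ?map_f //= eqxx big1 ?addr0 // => i.
by rewrite eq_sym => /negPf->.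
Qed.

Lemma is_basis_criterion :
  (forall m, exists l : seq (A * I), m = \sum_(x <- l) x.1 *: b x.2) ->
  (forall (s : seq I) (c : I -> A), uniq s -> \sum_(i <- s) c i *: b i = 0 ->
    forall i, i \in s -> c i = 0) ->
  is_basis b.
Proof.
move=> span free m; have [l ->] := span m.
pose c i := \sum_(x <- l | x.2 == i) x.1; pose r := undup (map snd l).
have cr i : i \notin r -> c i = 0.
  rewrite mem_undup => il; rewrite /c big_seq_cond big1 // => x /andP[xl /eqP xi].
  by rewrite -xi map_f in il.
have fin_sum (c' : I -> A) (s : seq I) : uniq s -> (forall i, i \notin s -> c' i = 0) ->
    \sum_(i \in [set: I]%classic) c' i *: b i = \sum_(i <- s) c' i *: b i.
  by move=> us c's; apply: fsbigT_seq => // i /c's->; rewrite scale0r.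
exists c; split.
  split; last by rewrite (fin_sum c r) ?undup_uniq // sum_group.
  apply: (@sub_finite_set _ _ [set` r]%classic) => [i /=|]; last exact: finite_seq.
  by apply: contraNT => /cr->.
move=> c' [/finite_seqP[s c's] e]; apply/funext => i.
have c's0 j : j \notin s -> c' j = 0.
  move=> js; apply/eqP; apply: contraNT js => c'j.
  by have : [set` s]%classic j by rewrite -c's.
(* A list containing both supports, on which freeness is applied to the difference of the two
   coefficient families. *)
pose t := undup (r ++ s).
have ct j : j \notin t -> c j - c' j = 0.
  by rewrite mem_undup mem_cat negb_or => /andP[/cr-> /c's0->]; rewrite subrr.
have [it|/ct/eqP] := boolP (i \in t); last by rewrite subr_eq0 => /eqP.
apply/eqP; rewrite -subr_eq0; apply/eqP.
apply: (free t (fun j => c j - c' j) (undup_uniq _) _ i it).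
under eq_bigr do rewrite scalerBl.
rewrite sumrB -!fin_sum ?undup_uniq //; last 2 first.
- by move=> j; rewrite mem_undup mem_cat negb_or => /andP[_ /c's0].
- by move=> j; rewrite mem_undup mem_cat negb_or => /andP[/cr].
by rewrite -e (fin_sum c r) ?undup_uniq // -sum_group subrr.
Qed.

End BasisCriterion.

Section Final.
Variable K : numFieldType.
Local Notation idx := (nat * 'I_2 * nat * 'I_2 * nat)%type.
Local Notation tri := (nat * nat * nat)%type.

Definition bar_mon (i : idx) : UJ K := let: (p, q, r, s, t) := i in
  bar (xm2 : osp K) ^<o> p <o> bar xm1 ^<o> q <o> bar xh ^<o> r
    <o> bar xp1 ^<o> s <o> bar xp2 ^<o> t.

Definition exponents (i : idx) : tri := let: (p, q, r, s, t) := i in (2 * p + q, r, s + 2 * t)%N.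

Lemma exponents_inj : injective exponents.
Proof.
move=> [[[[p q] r] s] t] [[[[p' q'] r'] s'] t'] [e1 -> e2].
have := (ltn_ord q, ltn_ord q', ltn_ord s, ltn_ord s') => -[[[q2 q'2] s2] s'2].
have -> : p = p' by lia.
have -> : t = t' by lia.
by have [-> ->] : q = q' /\ s = s' by split; apply: val_inj => /=; lia.
Qed.

Lemma exponents_surj t : exists i, exponents i = t.
Proof.
case: t => [[a r] c].
exists (a./2, inord (odd a), r, inord (odd c), c./2).
by rewrite /exponents !inordK ?ltnS ?leq_b1 //; congr (_, _, _); lia.
Qed.

Definition rank (t : tri) : nat := (2 * t.1.2 + odd t.1.1)%N.

Lemma bar_mon_comb i : exists k l, [/\ k != 0, all (fun x => (rank x.2 < rank (exponents i))%N) l &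
  bar_mon i = comb ((kcst k, exponents i) :: l)].
Proof.
case: i => [[[[p q] r] s] t]; have [k [w [k0 Sw e]]] := bar_monomial K p q r s t.
have [l Sl wl] := uspan_comb Sw; exists k, l; split=> //.
by rewrite /comb big_cons -[\sum_(_ <- l) _]/(comb l) -wl /bar_mon e.
Qed.

(** Induction on the rank: the triangular relation is solved for its leading class, whose
    coefficient is a nonzero scalar and hence invertible. *)
Lemma pbw_class_span n t : (rank t < n)%N -> exists l : seq (Uh_loc K * idx),
  pbw_class K t = \sum_(x <- l) x.1 *: bar_mon x.2.
Proof.
elim: n t => // n IH t; rewrite ltnS => tn; have [i it] := exponents_surj t.
have [k [l [k0 ll e]]] := bar_mon_comb i.
have [l' e'] : exists l' : seq (Uh_loc K * idx), comb l = \sum_(x <- l') x.1 *: bar_mon x.2.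
  elim: l ll {e} => [|[f t'] l IHl] /=; first by exists [::]; rewrite /comb !big_nil.
  case/andP=> t't /IHl[l' e']; rewrite it in t't; have [l'' e''] := IH t' (leq_trans t't tn).
  exists ([seq (f * x.1, x.2) | x <- l''] ++ l').
  rewrite /comb big_cons -[\sum_(_ <- l) _]/(comb l) e' big_cat /=; congr (_ + _).
  by rewrite e'' scaler_sumr big_map; apply: eq_bigr => x _; rewrite scalerA.
exists ((kcst k^-1, i) :: [seq (- kcst k^-1 * x.1, x.2) | x <- l']).
rewrite big_cons e /comb big_cons -[\sum_(_ <- l) _]/(comb l) e' it big_map /=.
rewrite scalerDr scalerA -kcstM mulVf // kcst1 scale1r.
under [X in _ + _ + X]eq_bigr do rewrite mulNr scaleNr -scalerA.
by rewrite sumrN -scaler_sumr addrK.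
Qed.

Lemma coef_cat l l' t : coef (l ++ l') t = coef l t + coef l' t :> Uh_loc K.
Proof. exact: big_cat. Qed.

(** Let i have maximal rank among the indices with c i != 0, and compare coefficients at
    [exponents i]. Corrections have smaller rank than their leading class and distinct indices have
    distinct leading exponents, so only the leading class of i contributes, with an invertible
    scalar. *)
Lemma bar_mon_free (s : seq idx) (c : idx -> Uh_loc K) : uniq s ->
  \sum_(i <- s) c i *: bar_mon i = 0 -> forall i, i \in s -> c i = 0.
Proof.
move=> us cs0.
have /choice[kl klP] : forall i, exists x : K * seq (Uh_loc K * tri),
    [/\ x.1 != 0, all (fun y => (rank y.2 < rank (exponents i))%N) x.2 &
    bar_mon i = comb ((kcst x.1, exponents i) :: x.2)].
  by move=> i; have [k [l kl]] := bar_mon_comb i; exists (k, l).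
pose terms i := [seq (c i * x.1, x.2) | x <- (kcst (kl i).1, exponents i) :: (kl i).2].
have coef0 t : \sum_(i <- s) coef (terms i) t = 0.
  have <- : coef (flatten (map terms s)) t = \sum_(i <- s) coef (terms i) t.
    elim: (s) => [|i s' IH]; first by rewrite /coef !big_nil.
    by rewrite big_cons -IH -coef_cat.
  apply: pbw_class_free; rewrite /comb big_flatten big_map; apply: etrans cs0; apply: eq_bigr => i _.
  have [_ _ ->] := klP i; rewrite /terms /comb big_map scaler_sumr.
  by apply: eq_bigr => x _; rewrite scalerA.
pose P n := has (fun i => (c i != 0) && (rank (exponents i) == n)) s.
have [[n Pn]|nP] := pselect (exists n, P n); last first.
  move=> i si; apply/eqP; apply: contra_notT nP => ci.
  by exists (rank (exponents i)); apply/hasP; exists i; rewrite // ci eqxx.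
have bound m : P m -> (m <= \max_(i <- s) rank (exponents i))%N.
  by move=> /hasP[i si /andP[_ /eqP <-]]; exact: leq_bigmax_seq.
case: (ex_maxnP (ex_intro _ n Pn) bound) => m /hasP[i si /andP[ci /eqP im]] mP.
case/negP: ci; rewrite -subr_eq0 subr0; apply/eqP.
have [ki li _] := klP i.
suff e : \sum_(j <- s) coef (terms j) (exponents i) = c i * kcst (kl i).1.
  by rewrite -[c i]mulr1 -kcst1 -(divff ki) kcstM mulrA -e coef0 mul0r.
have terms0 j : j \in s -> coef [seq (c j * x.1, x.2) | x <- (kl j).2] (exponents i) = 0.
  move=> sj; rewrite /coef big_map big_seq_cond big1 // => x /andP[xl /eqP /= xi].
  have [->|cj] := eqVneq (c j) 0; first by rewrite mul0r.
  have [_ /allP/(_ x xl)] := klP j; rewrite xi im => mj.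
  have /(leq_trans mj) : (rank (exponents j) <= m)%N.
    by apply: mP; apply/hasP; exists j; rewrite // cj eqxx.
  by rewrite ltnn.
rewrite (bigD1_seq i) //= big_seq_cond big1 ?addr0 => [|j /andP[sj ji]].
  rewrite /terms /coef /= big_cons /= eqxx.
  by rewrite -[X in _ + X]/(coef _ _) terms0 ?addr0.
rewrite /terms /coef /= big_cons /= (inj_eq exponents_inj) (negPf ji).
exact: terms0.
Qed.

Lemma bar_mon_basis : is_basis bar_mon.
Proof.
apply: is_basis_criterion; last exact: bar_mon_free.
move=> m; have [l ->] := pbw_class_generate m; elim: l => [|[f t] l [l' e]].
  by exists [::]; rewrite /comb !big_nil.
have [l'' e''] := pbw_class_span (ltnSn (rank t)).
exists ([seq (f * x.1, x.2) | x <- l''] ++ l').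
rewrite /comb big_cons -[\sum_(_ <- l) _]/(comb l) e big_cat /=; congr (_ + _).
by rewrite e'' scaler_sumr big_map; apply: eq_bigr => x _; rewrite scalerA.
Qed.
End Final.

Theorem proposition3p6 (R : realType) :
  is_basis (fun i : nat * 'I_2 * nat * 'I_2 * nat =>
    let: (p, q, r, s, t) := i in
    bar (xm2 : osp R[i]) ^<o> p <o> bar xm1 ^<o> q <o> bar xh ^<o> r
      <o> bar xp1 ^<o> s <o> bar xp2 ^<o> t).
Proof. exact: (@bar_mon_basis R[i]). Qed.
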